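(* Let $f$ be a quasiconformal $C^2$ diffeomorphism from the plane domain $\Omega$ onto the plane domain $G$. Let $\gamma_\Omega\subset\partial\Omega$ and $\gamma_G=f(\gamma_\Omega)\subset\partial G$ be $C^{1,\alpha}$, respectively $C^{2,\alpha}$, Jordan arcs. If for some $\tau\in\gamma_\Omega$ there exist positive constants $r$, $M$ and $N$ such that $$|\Delta f(z)|\le M|\nabla f(z)|^2+N,\quad z\in\Omega\cap D(\tau,r),$$ then $f$ has bounded partial derivatives in $\Omega\cap D(\tau,r_\tau)$ for some $r_\tau<r$. In particular, $f$ is a Lipschitz mapping in $\Omega\cap D(\tau,r_\tau)$.
   Context: The plane $\mathbb{R}^2$ is identified with $\mathbb{C}$, $z=x+iy$, and $D(\tau,r)$ is the disk with center $\tau$ and radius $r>0$ (also $r_\tau>0$). For a complex-valued $C^2$ function $f$: $\Delta f=f_{xx}+f_{yy}=4f_{z\bar z}$ and $|\nabla f|^2=|f_x|^2+|f_y|^2=2(|f_z|^2+|f_{\bar z}|^2)$. The mapping $f$ is quasiconformal if there is $k\in[0,1)$ with $|f_{\bar z}|\le k|f_z|$ in the domain. $C^{l,\alpha}$ denotes the class of $l$ times differentiable objects whose $l$-th derivatives are Hölder continuous with exponent $\alpha$. The set $f(\gamma_\Omega)$ is the image of $\gamma_\Omega$ under the boundary values of $f$.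
   Formalization: It is additionally assumed that τ is not an endpoint of γ_Ω and that near τ the boundary ∂Ω consists only of points of γ_Ω; otherwise the claim fails, e.g. f(z)=z^{2/3} on the sector 0<arg z<3π/2, |z|<1, with γ_Ω=[0,1/2], τ=0. *)

(* Defs.v *)
From mathcomp Require Import all_boot all_order all_algebra.
From mathcomp Require Import all_classical all_reals all_analysis.
From mathcomp Require Import complex.

Set Implicit Arguments.
Unset Strict Implicit.
Unset Printing Implicit Defensive.

Import Order.TTheory GRing.Theory Num.Theory.
Import numFieldNormedType.Exports.

Local Open Scope classical_set_scope.
Local Open Scope ring_scope.

(* The plane is [R * R].  The library norm on a product is the max norm (it
   induces the usual topology, but its balls are squares), hence the separate
   Euclidean modulus [cabs] below; complex arithmetic is done in [R[i]]. *)

Definition toC (R : realType) (w : R * R) : R[i] := Complex w.1 w.2.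

Definition cabs (R : realType) (w : R * R) : R := ComplexField.Normc.normc (toC w).

Definition disk (R : realType) (tau : R * R) (r : R) : set (R * R) :=
  [set z | cabs (z - tau) < r].

Definition boundary (T : topologicalType) (A : set T) : set T :=
  closure A `\` interior A.

Definition plane_domain (R : realType) (Omega : set (R * R)) : Prop :=
  [/\ Omega !=set0, open Omega & connected Omega].

Definition e_x (R : realType) : R * R := (1, 0).
Definition e_y (R : realType) : R * R := (0, 1).

Definition dx (R : realType) (f : R * R -> R * R) (z : R * R) : R * R :=
  'D_(e_x R) f z.
Definition dy (R : realType) (f : R * R -> R * R) (z : R * R) : R * R :=
  'D_(e_y R) f z.

Definition laplacian (R : realType) (f : R * R -> R * R) (z : R * R) : R * R :=
  dx (dx f) z + dy (dy f) z.

Definition grad_sq (R : realType) (f : R * R -> R * R) (z : R * R) : R :=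
  cabs (dx f z) ^+ 2 + cabs (dy f z) ^+ 2.

Definition d_z (R : realType) (f : R * R -> R * R) (z : R * R) : R[i] :=
  (toC (dx f z) - 'i%C * toC (dy f z)) / 2%:R.
Definition d_zbar (R : realType) (f : R * R -> R * R) (z : R * R) : R[i] :=
  (toC (dx f z) + 'i%C * toC (dy f z)) / 2%:R.

Definition C1_on (R : realType) (Omega : set (R * R)) (f : R * R -> R * R) :
    Prop :=
  forall z, Omega z ->
    [/\ derivable f z (e_x R), derivable f z (e_y R),
        {for z, continuous (dx f)} & {for z, continuous (dy f)}].

Definition C2_on (R : realType) (Omega : set (R * R)) (f : R * R -> R * R) :
    Prop :=
  [/\ C1_on Omega f, C1_on Omega (dx f) & C1_on Omega (dy f)].

(* [f] is total but only its values on the open set [Omega] matter. *)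
Definition C2_diffeo (R : realType) (Omega G : set (R * R))
    (f : R * R -> R * R) : Prop :=
  [/\ set_bij Omega G f, C2_on Omega f &
      exists2 h : R * R -> R * R,
        C2_on G h & forall z, Omega z -> h (f z) = z].

Definition quasiconformal (R : realType) (Omega : set (R * R))
    (f : R * R -> R * R) : Prop :=
  exists2 k : R, 0 <= k < 1 &
    forall z, Omega z ->
      ComplexField.Normc.normc (d_zbar f z)
        <= k * ComplexField.Normc.normc (d_z f z).

(* [g'] is the derivative of [g] relative to [I]: one-sided at the endpoints
   when [I] is an interval. *)
Definition has_derivative_in (R : realType) (I : set R) (g g' : R -> R * R) :
    Prop :=
  forall t, I t ->
    (s - t)^-1 *: (g s - g t) @[s --> within (I `\ t) (nbhs t)] --> g' t.

Definition hoelder_in (R : realType) (I : set R) (alpha : R) (g : R -> R * R) :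
    Prop :=
  exists K : R, forall s t, I s -> I t ->
    cabs (g s - g t) <= K * `|s - t| `^ alpha.

Fixpoint C_hoelder (R : realType) (l : nat) (alpha : R) (I : set R)
    (g : R -> R * R) : Prop :=
  if l is l'.+1 then
    exists2 g' : R -> R * R,
      has_derivative_in I g g' & C_hoelder l' alpha I g'
  else hoelder_in I alpha g.

(* A Jordan arc of class [C^{l,alpha}] (l >= 1), with its endpoints
   [g 0] and [g 1].  The condition [g' <> 0] makes the class a property of the
   curve and not only of the map [g]: without it corners would be allowed. *)
Definition jordan_arc (R : realType) (l : nat) (alpha : R) (g : R -> R * R)
    (gamma : set (R * R)) : Prop :=
  [/\ set_inj `[0, 1]%classic g, gamma = g @` `[0, 1]%classic, C_hoelder l alpha `[0, 1]%classic g &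
      exists2 g' : R -> R * R,
        has_derivative_in `[0, 1]%classic g g' & forall t, `[0, 1]%classic t -> g' t != 0].

Definition boundary_values (R : realType) (Omega gamma : set (R * R))
    (f F : R * R -> R * R) : Prop :=
  forall zeta, gamma zeta -> f @ within Omega (nbhs zeta) --> F zeta.

(* Main.v *)
Require Import Defs.
From mathcomp Require Import all_boot all_order all_algebra.
From mathcomp Require Import all_classical all_reals all_analysis.
From mathcomp Require Import complex ring lra.
Import Order.TTheory GRing.Theory Num.Theory.
Import numFieldNormedType.Exports.
Local Open Scope classical_set_scope.
Local Open Scope ring_scope.

(** The image arc is locally a graph, say v = g(u) with g of class C^2, so
    w = f_2 - g(f_1) tends to 0 at gamma_Omega. By quasiconformality |grad w| and |grad f| are
    comparable, hence |Laplacian w| <= a |grad w|^2 + b, and everything reduces to bounding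
    grad w near tau.

    Linear decay: exp(a w) - 1 and exp(- a w) - 1 have Laplacian bounded below, so they are
    dominated by a multiple of an explicit barrier, positive on the domain because the
    boundary is C^{1,alpha}; this gives |w(z)| <= C |z - zeta| for every boundary point zeta
    near tau. Interior estimate: on a square of side comparable to the distance h from z to
    the boundary, where |w| <= C h, the maximum principle gives a bound of grad w by
    sup |w| / h + h sup |Laplacian w|, and the quadratic term is absorbed by maximising
    |grad w| with a weight vanishing on the boundary of the square, since h is small.

    The arc through tau splits a neighbourhood of tau in two sides, each of which is contained
    in Omega or disjoint from it; both may lie in Omega. Lipschitz continuity follows from the
    gradient bound along paths parallel to the axes, crossing gamma_Omega if necessary. *)

(** * Calculus along the coordinate axes *)

Section Plane.
Context {R : realType}.
Implicit Types (p q : R * R) (x y e l a b h M N : R).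

(** Nothing is known about the regularity of f along gamma_Omega beyond the existence of limits, so
    no linear decay can be claimed for the components of f; w is formed because its boundary values
    are known to be 0. The price is the term g''(f_1) |grad f_1|^2 in its Laplacian, which is where
    two derivatives of the image arc enter. Quadratic growth is the critical one: if |grad w| is of
    order S / h on a square of side h, with S = sup |w|, then the term a |grad w|^2 contributes a S
    times that order, whatever h is. It can therefore be absorbed only when a S is small; linear
    decay gives this smallness and at the same time bounds S / h. Squares replace disks because
    their comparison functions are polynomials and all derivatives can be taken along the axes. *)

Lemma nbhs_boxP p (A : set (R * R)) :
  nbhs p A <-> exists2 e : R, 0 < e &
    forall x y, `|x - p.1| < e -> `|y - p.2| < e -> A (x, y).
Proof.
split=> [/nbhs_ballP[e /= e0 H]|[e e0 H]].
  exists e => // x y Hx Hy; apply: H; split=> /=; rewrite /ball /= distrC //.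
apply/nbhs_ballP; exists e => //= -[x y] [/= Hx Hy].
by apply: H => /=; rewrite distrC.
Qed.

Definition cont_at (u : R * R -> R) p := {for p, continuous u}.

Lemma continuous_boxP (u : R * R -> R) p :
  cont_at u p <-> forall e, 0 < e -> exists2 d : R, 0 < d &
    forall x y, `|x - p.1| < d -> `|y - p.2| < d -> `|u (x, y) - u p| < e.
Proof.
split=> [/cvgrPdist_lt H e e0|H].
  have /nbhs_boxP[d d0 Hd] := H e e0.
  by exists d => // x y Hx Hy; rewrite distrC; exact: Hd.
apply/cvgrPdist_lt => e e0; have [d d0 Hd] := H e e0.
by apply/nbhs_boxP; exists d => // x y Hx Hy; rewrite distrC; exact: Hd.
Qed.

(** The form without a quotient also makes sense at [y = x], so estimates need no separate case for
    a zero increment. *)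
Lemma is_deriveP (f : R -> R) x l :
  is_derive x 1 f l <-> forall e, 0 < e -> exists2 d : R, 0 < d &
    forall y, `|y - x| < d -> `|f y - f x - l * (y - x)| <= e * `|y - x|.
Proof.
split=> [[df dl] e e0|H].
  have := df; rewrite /derivable => /cvg_ex [l' Hl'].
  have ll' : l = l' by rewrite -dl; apply/cvg_lim.
  move: Hl'; rewrite -ll' => /cvgrPdist_le /(_ e e0).
  rewrite near_withinE => /nbhs_ballP[d /= d0 Hd].
  exists d => // y Hy; have [->|yx] := eqVneq y x; first by rewrite !subrr mulr0 subrr !normr0 mulr0.
  have h0 : y - x != 0 by rewrite subr_eq0.
  have /Hd /(_ h0) : ball 0 d (y - x) by rewrite /ball /= sub0r normrN.
  rewrite /= [_ *: 1]mulr1 subrK.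
  have -> : f y - f x - l * (y - x) = - (l - (y - x)^-1 *: (f y - f x)) * (y - x).
    by rewrite opprB mulrBl -[_ *: _]/(_ * _) mulrAC mulVf // mul1r.
  by rewrite normrM normrN => Hle; rewrite ler_pM2r // normr_gt0.
have Hl : (fun h : R => h^-1 *: ((f \o shift x) (h *: 1) - f x)) @ 0^' --> l.
  apply/cvgrPdist_le => e e0; have [d d0 Hd] := H e e0.
  rewrite near_withinE; apply/nbhs_ballP; exists d => //= h.
  rewrite /ball /= sub0r normrN => hd h0.
  rewrite [_ *: 1]mulr1.
  have := Hd (h + x); rewrite addrK => /(_ hd).
  have -> : f (h + x) - f x - l * h = - (l - h^-1 *: (f (h + x) - f x)) * h.
    by rewrite opprB mulrBl -[_ *: _]/(_ * _) mulrAC mulVf // mul1r.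
  by rewrite normrM normrN ler_pM2r // normr_gt0.
split; first by apply/cvg_ex; exists l.
by rewrite /derive; apply/cvg_lim.
Qed.

(** Since [h' x = 0], a positive [l] would make [h'] positive just to the right of [x], and the mean
    value theorem would then give a value of [h] above the maximum. *)
Lemma second_derivative_at_max (h h' : R -> R) x l e : 0 < e ->
  (forall t, `|t - x| < e -> is_derive t 1 h (h' t)) -> is_derive x 1 h' l ->
  (forall t, `|t - x| < e -> h t <= h x) -> l <= 0.
Proof.
move=> e0 Dh Dh' Hmax.
have ball_itv t : t \in `]x - e, x + e[ -> `|t - x| < e.
  by rewrite in_itv /= ltr_distl => /andP[-> ->].
have h'x0 : h' x = 0.
  have := @derive1_at_max _ h (x - e) (x + e) x.
  have le_e : x - e <= x + e by lra.
  have xin : x \in `]x - e, x + e[ by rewrite in_itv /=; apply/andP; split; lra.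
  move=> /(_ le_e) /(_ _ xin) []; [|by move=> t /ball_itv; exact: Hmax|].
    by move=> t /ball_itv /Dh [].
  move=> _ D0; have [_ D1] := Dh x (ball_itv _ xin).
  by rewrite -D1 D0.
rewrite leNgt; apply/negP => l0.
have [d d0 Hd] := (is_deriveP _ _ _).1 Dh' _ (divr_gt0 l0 (ltr0Sn R 1)).
set s := Num.min d e / 2.
have m0 : 0 < Num.min d e by rewrite lt_min d0 e0.
have md : Num.min d e <= d by rewrite ge_min lexx.
have me : Num.min d e <= e by rewrite ge_min lexx orbT.
have s0 : 0 < s by rewrite /s; lra.
have sd : s < d by rewrite /s; lra.
have se : s < e by rewrite /s; lra.
have xs : x < x + s by lra.
have Dc c : c \in `]x, (x + s)[ -> is_derive c 1 h (h' c).
  by rewrite in_itv /= => /andP[c1 c2]; apply: Dh; rewrite gtr0_norm; lra.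
have Hc : {within `[x, (x + s)], continuous h}.
  apply: continuous_in_subspaceT => c; rewrite inE /= in_itv /= => /andP[c1 c2].
  apply/differentiable_continuous/derivable1_diffP.
  have : `|c - x| < e by rewrite ger0_norm; lra.
  by move=> /Dh [].
have [c] := MVT xs Dc Hc.
rewrite in_itv /= => /andP[c1 c2] E.
have hm : h (x + s) <= h x by apply: Hmax; rewrite gtr0_norm; lra.
have := Hd c; rewrite gtr0_norm ?subr_gt0 // h'x0 subr0.
have cx : c - x < d by lra.
move=> /(_ cx); rewrite ler_norml => /andP[+ _].
move: E; have -> : x + s - x = s by lra.
move=> E H; have : 0 < h' c * s by apply: mulr_gt0 => //; nra.
by lra.
Qed.

Lemma derD (f g : R -> R) x a b : is_derive x 1 f a -> is_derive x 1 g b ->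
  is_derive x 1 (fun t => f t + g t) (a + b).
Proof. by move=> Df Dg; exact: is_deriveD. Qed.

Lemma derB (f g : R -> R) x a b : is_derive x 1 f a -> is_derive x 1 g b ->
  is_derive x 1 (fun t => f t - g t) (a - b).
Proof. by move=> Df Dg; exact: is_deriveB. Qed.

Lemma derN (f : R -> R) x a : is_derive x 1 f a -> is_derive x 1 (fun t => - f t) (- a).
Proof. by move=> Df; exact: is_deriveN. Qed.

Lemma derM (f g : R -> R) x a b : is_derive x 1 f a -> is_derive x 1 g b ->
  is_derive x 1 (fun t => f t * g t) (a * g x + f x * b).
Proof.
move=> Df Dg; apply: is_derive_eq (is_deriveM Df Dg) _.
by rewrite /GRing.scale /= addrC mulrC.
Qed.

Lemma derC (c : R) x : is_derive x 1 (fun=> c) 0.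
Proof. exact: is_derive_cst. Qed.

Lemma derI x : is_derive x 1 (fun t : R => t) 1.
Proof. exact: is_derive_id. Qed.

Lemma der_comp (f g : R -> R) x a b : is_derive (g x) 1 f a -> is_derive x 1 g b ->
  is_derive x 1 (fun t => f (g t)) (a * b).
Proof. by move=> Df Dg; exact: is_derive1_comp. Qed.

Lemma der_eq (f : R -> R) x a b : is_derive x 1 f a -> a = b -> is_derive x 1 f b.
Proof. by move=> + <-. Qed.

Lemma closure_boxP (V : set (R * R)) p : closure V p ->
  forall e, 0 < e -> exists x y, [/\ V (x, y), `|x - p.1| < e & `|y - p.2| < e].
Proof.
move=> clp e e0.
have /clp [[x y] [Vxy [/= h1 h2]]] : nbhs p
    [set q : R * R | `|q.1 - p.1| < e /\ `|q.2 - p.2| < e].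
  by apply/nbhs_boxP; exists e.
by exists x, y.
Qed.

Lemma continuous_fst2 p : cont_at (@fst R R) p.
Proof. exact: cvg_fst. Qed.

Lemma continuous_snd2 p : cont_at (@snd R R) p.
Proof. exact: cvg_snd. Qed.

Lemma continuous_comp2 (u : R * R -> R) (f g : R * R -> R) p :
  cont_at f p -> cont_at g p ->
  cont_at u (f p, g p) -> cont_at (fun q => u (f q, g q)) p.
Proof.
move=> cf cg /continuous_boxP cu; apply/continuous_boxP => e /cu[d d0 Hd].
have [d1 d10 H1] := (continuous_boxP _ _).1 cf d d0.
have [d2 d20 H2] := (continuous_boxP _ _).1 cg d d0.
exists (Num.min d1 d2) => [|x y]; first by rewrite lt_min d10.
rewrite !lt_min => /andP[? ?] /andP[? ?].
by apply: Hd; [apply: H1|apply: H2].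
Qed.

Lemma contD (f g : R * R -> R) p : cont_at f p -> cont_at g p ->
  cont_at (fun q => f q + g q) p.
Proof. by move=> cf cg; exact: cvgD. Qed.

Lemma contB (f g : R * R -> R) p : cont_at f p -> cont_at g p ->
  cont_at (fun q => f q - g q) p.
Proof. by move=> cf cg; exact: cvgB. Qed.

Lemma contN (f : R * R -> R) p : cont_at f p ->
  cont_at (fun q => - f q) p.
Proof. by move=> cf; exact: cvgN. Qed.

Lemma contM (f g : R * R -> R) p : cont_at f p -> cont_at g p ->
  cont_at (fun q => f q * g q) p.
Proof. by move=> cf cg; exact: cvgM. Qed.

Lemma contC (c : R) p : cont_at (fun=> c) p.
Proof. exact: cvg_cst. Qed.

End Plane.

(** [is_derive] is a class; [notypeclasses refine] keeps its premises as goals, solved by recursion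
    or by a hypothesis. [der_by] then leaves the equality of the computed and the announced
    derivative. *)
Ltac der := lazymatch goal with
  | |- is_derive _ _ (fun=> ?c) _ => exact: derC
  | |- is_derive _ _ (fun t => t) _ => exact: derI
  | |- is_derive _ _ (fun t => @?f t - @?g t) _ => notypeclasses refine (derB f g _ _ _ _ _); der
  | |- is_derive _ _ (fun t => @?f t + @?g t) _ => notypeclasses refine (derD f g _ _ _ _ _); der
  | |- is_derive _ _ (fun t => - @?f t) _ => notypeclasses refine (derN f _ _ _); der
  | |- is_derive _ _ (fun t => @?f t * @?g t) _ => notypeclasses refine (derM f g _ _ _ _ _); der
  | |- is_derive _ _ _ _ => try eassumption end.
Ltac der_by tac := notypeclasses refine (der_eq _ _ _ _ _ _); [der | cbn beta; tac].

Ltac cont := lazymatch goal with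
  | |- cont_at (fun q => @?f q - @?g q) _ => apply: (contB f g); cont
  | |- cont_at (fun q => @?f q + @?g q) _ => apply: (contD f g); cont
  | |- cont_at (fun q => - @?f q) _ => apply: (contN f); cont
  | |- cont_at (fun q => @?f q * @?g q) _ => apply: (contM f g); cont
  | |- cont_at fst _ => exact: continuous_fst2
  | |- cont_at snd _ => exact: continuous_snd2
  | |- cont_at (fun q => fst q) _ => exact: continuous_fst2
  | |- cont_at (fun q => snd q) _ => exact: continuous_snd2
  | |- cont_at (fun q => _) _ => first [exact: contC | try assumption]
  | |- _ => try assumption end.

(** * Maximum principle and gradient estimate on squares *)

Section MaximumPrinciple.
Context {R : realType}.
Implicit Types (p q : R * R) (x y e l a b h M N : R).

(** The derivatives are explicit data, so that sums, products and compositions come with formulas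
    for their Laplacian [uxx + uyy]. *)
Record C2fun (D : set (R * R)) (u ux uy uxx uyy : R * R -> R) : Prop := MkC2fun {
  C2c : forall p, D p -> cont_at u p;
  C2x : forall x y, D (x, y) -> is_derive x 1 (fun t => u (t, y)) (ux (x, y));
  C2y : forall x y, D (x, y) -> is_derive y 1 (fun t => u (x, t)) (uy (x, y));
  C2xx : forall x y, D (x, y) -> is_derive x 1 (fun t => ux (t, y)) (uxx (x, y));
  C2yy : forall x y, D (x, y) -> is_derive y 1 (fun t => uy (x, t)) (uyy (x, y)) }.

(** At an interior maximum both pure second derivatives are nonpositive, against the strict sign of
    the Laplacian. The boundary condition is an upper limit, since the functions compared later are
    only defined inside. *)
Lemma max_principle (V : set (R * R)) (v vx vy vxx vyy : R * R -> R) (B : R) :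
  open V -> (forall p, V p -> `|p.1| <= B /\ `|p.2| <= B) ->
  C2fun V v vx vy vxx vyy -> (forall p, V p -> 0 < vxx p + vyy p) ->
  (forall p, closure V p -> ~ V p -> forall e, 0 < e -> exists2 d : R, 0 < d &
    forall x y, `|x - p.1| < d -> `|y - p.2| < d -> V (x, y) -> v (x, y) < e) ->
  forall p, V p -> v p <= 0.
Proof.
move=> oV bV Cv Lv bdv p0 Vp0; rewrite leNgt; apply/negP => mu0.
pose A := [set p | V p /\ v p0 <= v p].
(* The boundary condition keeps this superlevel set away from the boundary of [V]; it is therefore
   closed in the plane, hence compact, and a maximum is attained. *)
have clA : closed A.
  move=> p clp.
  have Vp : V p.
    apply: contrapT => nVp.
    have clVp : closure V p by apply: closure_subset clp => q [].
    have [d d0 Hd] := bdv p clVp nVp _ mu0.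
    have /clp [[x y] [[Vxy le] [/= h1 h2]]] : nbhs p
        [set q : R * R | `|q.1 - p.1| < d /\ `|q.2 - p.2| < d].
      by apply/nbhs_boxP; exists d.
    by have := Hd x y h1 h2 Vxy; rewrite ltNge le.
  split=> //; rewrite leNgt; apply/negP => lt.
  have [d d0 Hd] := (continuous_boxP _ _).1 (C2c _ _ _ _ _ _ Cv p Vp) (v p0 - v p) ltac:(lra).
  have /clp [[x y] [[Vxy le] [/= h1 h2]]] : nbhs p
      [set q : R * R | `|q.1 - p.1| < d /\ `|q.2 - p.2| < d].
    by apply/nbhs_boxP; exists d.
  have := Hd x y h1 h2; rewrite ltr_norml => /andP[_]; lra.
have cA : compact A.
  apply: (@subclosed_compact _ _ (`[-B, B] `*` `[-B, B])) => //.
    by apply: compact_setX; exact: segment_compact.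
  by move=> p [/bV [h1 h2] _]; split=> /=; rewrite in_itv /= -ler_norml.
have [|||[cx cy]] := @compact_EVT_max _ R v A.
- by exists p0; split.
- exact: cA.
- apply: continuous_in_subspaceT => p; rewrite inE => -[Vp _].
  exact: (C2c _ _ _ _ _ _ Cv).
rewrite inE => -[Vc lec] Hmax.
have maxV q : V q -> v q <= v (cx, cy).
  move=> Vq; have [le|/ltW lt] := leP (v p0) (v q); last exact: le_trans lt _.
  by apply: Hmax; rewrite inE.
have /nbhs_boxP[e e0 He] : nbhs (cx, cy) V by exact: open_nbhs_nbhs.
have hx : vxx (cx, cy) <= 0.
  apply: (@second_derivative_at_max R (fun t => v (t, cy)) (fun t => vx (t, cy)) cx _ e) => //.
  - by move=> t te; apply: (C2x _ _ _ _ _ _ Cv); apply: He; rewrite //= subrr normr0.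
  - exact: (C2xx _ _ _ _ _ _ Cv).
  - by move=> t te; apply: maxV; apply: He; rewrite //= subrr normr0.
have hy : vyy (cx, cy) <= 0.
  apply: (@second_derivative_at_max R (fun t => v (cx, t)) (fun t => vy (cx, t)) cy _ e) => //.
  - by move=> t te; apply: (C2y _ _ _ _ _ _ Cv); apply: He; rewrite //= subrr normr0.
  - exact: (C2yy _ _ _ _ _ _ Cv).
  - by move=> t te; apply: maxV; apply: He; rewrite //= subrr normr0.
have := Lv _ Vc; lra.
Qed.

Lemma gradient_estimate_half (D : set (R * R)) (u ux uy uxx uyy : R * R -> R) a b h M N :
  C2fun D u ux uy uxx uyy -> 0 < h ->
  (forall x y, `|x - a| <= h -> `|y - b| <= h -> D (x, y)) ->
  (forall x y, `|x - a| <= h -> `|y - b| <= h -> `|u (x, y)| <= M) ->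
  (forall x y, `|x - a| <= h -> `|y - b| <= h -> `|uxx (x, y) + uyy (x, y)| < N) ->
  uy (a, b) <= 2 * M / h + N * h / 2.
Proof.
move=> Cu h0 hD hM hN.
have aa : `|a - a| <= h by rewrite subrr normr0 ltW.
have bb : `|b - b| <= h by rewrite subrr normr0 ltW.
have M0 : 0 <= M by apply: le_trans (hM a b aa bb).
have N0 : 0 < N by apply: le_lt_trans (hN a b aa bb).
pose k := M / h ^+ 2.
have k0 : 0 <= k by apply: divr_ge0 => //; apply: exprn_ge0; lra.
have kh : k * h ^+ 2 = M by rewrite /k divfK // expf_neq0 // gt_eqF.
clearbody k.
(* Comparison of the odd part of u in y - b with the barrier psi on the upper half square
   (Gilbarg and Trudinger, section 3.4). *)
pose psi x y := k * ((x - a) * (x - a) + (y - b) * (2 * h - (y - b)))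
               + N / 2 * ((y - b) * (h - (y - b))).
pose v p := (u p - u (p.1, 2 * b - p.2)) / 2 - psi p.1 p.2.
pose vx p := (ux p - ux (p.1, 2 * b - p.2)) / 2 - k * (2 * (p.1 - a)).
pose vy p := (uy p + uy (p.1, 2 * b - p.2)) / 2 - k * (2 * h - 2 * (p.2 - b))
   - N / 2 * (h - 2 * (p.2 - b)).
pose vxx p := (uxx p - uxx (p.1, 2 * b - p.2)) / 2 - k * 2.
pose vyy p := (uyy p - uyy (p.1, 2 * b - p.2)) / 2 + k * 2 + N.
pose V := [set p : R * R | `|p.1 - a| < h /\ b < p.2 < b + h].
have VD x y : V (x, y) -> D (x, y) /\ D (x, 2 * b - y).
  move=> [/= h1 /andP[h2 h3]]; split; apply: hD; rewrite ?(ltW h1) // ler_norml; apply/andP; split; lra.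
have refl (w : R * R -> R) x y l : is_derive (2 * b - y) 1 (fun t => w (x, t)) l ->
    is_derive y 1 (fun t => w (x, 2 * b - t)) (- l).
  move=> Dw; apply: der_eq (@der_comp R (fun t => w (x, t)) (fun t => 2 * b - t) y l (0 - 1) Dw _) _.
  by ring.
have contv p : `|p.1 - a| <= h -> b <= p.2 <= b + h -> cont_at v p.
  move=> h1 /andP[h2 h3].
  have c1 : cont_at u p.
    case: p h1 h2 h3 => x y /= h1 h2 h3.
    apply: (C2c _ _ _ _ _ _ Cu); apply: hD => //; rewrite ler_norml; apply/andP; split; lra.
  have c2 : cont_at (fun q : R * R => u (q.1, 2 * b - q.2)) p.
    apply: continuous_comp2; cont.
    apply: (C2c _ _ _ _ _ _ Cu); apply: hD => //; rewrite ler_norml; apply/andP; split; lra.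
  rewrite /v /psi; cont.
have Cv : C2fun V v vx vy vxx vyy.
  split.
  - by move=> p [h1 /andP[h2 h3]]; apply: contv; rewrite ?ltW //; apply/andP; split; lra.
  - move=> x y /VD[D1 D2]; rewrite /v /vx /psi /=.
    have e1 := C2x _ _ _ _ _ _ Cu _ _ D1; have e2 := C2x _ _ _ _ _ _ Cu _ _ D2.
    der_by ltac:(idtac); rewrite ?mulr0 ?mul0r; by field.
  - move=> x y /VD[D1 D2]; rewrite /v /vy /psi /=.
    have e1 := C2y _ _ _ _ _ _ Cu _ _ D1; have e2 := refl _ _ _ _ (C2y _ _ _ _ _ _ Cu _ _ D2).
    der_by ltac:(idtac); rewrite ?mulr0 ?mul0r; by field.
  - move=> x y /VD[D1 D2]; rewrite /vx /vxx /=.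
    have e1 := C2xx _ _ _ _ _ _ Cu _ _ D1; have e2 := C2xx _ _ _ _ _ _ Cu _ _ D2.
    der_by ltac:(idtac); rewrite ?mulr0 ?mul0r; by field.
  - move=> x y /VD[D1 D2]; rewrite /vy /vyy /=.
    have e1 := C2yy _ _ _ _ _ _ Cu _ _ D1; have e2 := refl _ _ _ _ (C2yy _ _ _ _ _ _ Cu _ _ D2).
    der_by ltac:(idtac); rewrite ?mulr0 ?mul0r; by field.
(* The part of [psi] with factor [k] is harmonic and the part with factor [N] has Laplacian [- N],
   while half the difference of two values of the Laplacian of u is greater than [- N]. *)
have Lv p : V p -> 0 < vxx p + vyy p.
  case: p => x y [/= h1 /andP[h2 h3]].
  have := hN x y (ltW h1) ltac:(rewrite ler_norml; apply/andP; split; lra).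
  have := hN x (2 * b - y) (ltW h1) ltac:(rewrite ler_norml; apply/andP; split; lra).
  rewrite /vxx /vyy /= !ltr_norml => /andP[g1 g2] /andP[g3 g4]; lra.
have oV : open V.
  clear -V.
  rewrite openE => -[x y] [/= h1 /andP[h2 h3]]; apply/nbhs_boxP => /=.
  move: h1; rewrite ltr_norml => /andP[h1 h1'].
  exists (Num.min (Num.min (x - a + h) (h - (x - a))) (Num.min (y - b) (b + h - y))).
    rewrite !lt_min; apply/andP; split; apply/andP; split; lra.
  move=> x' y'; rewrite !lt_min => /andP[/andP[+ +] _] /andP[_ /andP[+ +]].
  rewrite !ltr_norml => /andP[? ?] /andP[? ?] /andP[? ?] /andP[? ?].
  by split=> /=; rewrite ?ltr_norml; apply/andP; split; lra.
have vle0 p : V p -> v p <= 0.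
  apply: (@max_principle V v vx vy vxx vyy (`|a| + `|b| + h)) => //.
    move=> q [h1 /andP[h2 h3]]; have := ler_normD (q.1 - a) a.
    have := ler_normD (q.2 - b) b; rewrite !subrK => g1 g2.
    have : `|q.2 - b| < h by rewrite ltr_norml; apply/andP; split; lra.
    have := normr_ge0 a; have := normr_ge0 b; clear -h1 g1 g2; split; lra.
  move=> q clq nVq e e0.
  have b1 : `|q.1 - a| <= h.
    apply/ler_addgt0Pr => d d0; have [x [y [[/= h1 _] h2 _]]] := closure_boxP _ _ clq d d0.
    have := ler_distD x q.1 a; rewrite (distrC q.1 x); lra.
  have b2 : b <= q.2.
    apply/ler_addgt0Pr => d d0; have [x [y [[/= _ /andP[h1 _]] _ h2]]] := closure_boxP _ _ clq d d0.
    by move: h2; rewrite ltr_norml => /andP[? ?]; lra.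
  have b3 : q.2 <= b + h.
    apply/ler_addgt0Pr => d d0; have [x [y [[/= _ /andP[_ h1]] _ h2]]] := closure_boxP _ _ clq d d0.
    by move: h2; rewrite ltr_norml => /andP[? ?]; lra.
  have vq : v q <= 0.
    have u1 : `|u q| <= M.
      by rewrite [q]surjective_pairing; apply: hM => //; rewrite ler_norml; apply/andP; split; lra.
    have u2 : `|u (q.1, 2 * b - q.2)| <= M.
      by apply: hM => //; rewrite ler_norml; apply/andP; split; lra.
    have n1 : 0 <= N / 2 * ((q.2 - b) * (h - (q.2 - b))).
      by clear -N0 b2 b3; apply: mulr_ge0; [lra|apply: mulr_ge0; lra].
    have n2 : 0 <= k * ((q.2 - b) * (2 * h - (q.2 - b))).
      by clear -k0 h0 b2 b3; apply: mulr_ge0 => //; apply: mulr_ge0; lra.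
    have n3 : 0 <= k * ((q.1 - a) * (q.1 - a)) by apply: mulr_ge0 => //; rewrite -expr2 sqr_ge0.
    move: u1 u2; rewrite !ler_norml => /andP[u1 u1'] /andP[u2 u2'].
    (* On the bottom [y = b] the odd part vanishes and [psi] is nonnegative. On the top and on the
       lateral sides [psi >= k * h ^+ 2 = M], which dominates the odd part. *)
    have [E|qb] := eqVneq q.2 b.
      have -> : v q = - psi q.1 q.2.
        by rewrite /v; have -> : (q.1, 2 * b - q.2) = q; [rewrite [RHS]surjective_pairing E; congr pair; ring|ring].
      by rewrite /psi; clear -n1 n2 n3; lra.
    have [E|qh] := eqVneq q.2 (b + h).
      suff : psi q.1 q.2 >= M by rewrite /v; clear -u1 u1' u2 u2'; lra.
      by rewrite /psi E -kh; rewrite E in n1 n2 n3; clear -n1 n2 n3; lra.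
    have E : (q.1 - a) * (q.1 - a) = h ^+ 2.
      rewrite -expr2 -real_normK ?num_real //; congr (_ ^+ 2).
      apply/eqP; rewrite eq_le b1 /= leNgt; apply/negP => lt; apply: nVq; split=> //.
      by rewrite !lt_neqAle b2 b3 qh eq_sym qb.
    suff : psi q.1 q.2 >= M by rewrite /v; clear -u1 u1' u2 u2'; lra.
    by rewrite /psi mulrDr E kh; clear -n1 n2; lra.
  have [d d0 Hd] := (continuous_boxP _ _).1 (contv q b1 ltac:(by rewrite b2 b3)) e e0.
  exists d => // x y h1 h2 _; have := Hd x y h1 h2; rewrite ltr_norml => /andP[_]; lra.
apply/ler_addgt0Pr => e e0.
have [d d0 Hd] := (is_deriveP _ _ _).1 (C2y _ _ _ _ _ _ Cu _ _ (hD _ _ aa bb)) e e0.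
pose t := Num.min d h / 2.
have m0 : 0 < Num.min d h by rewrite lt_min d0 h0.
have md : Num.min d h <= d by rewrite ge_min lexx.
have mh : Num.min d h <= h by rewrite ge_min lexx orbT.
have [t0 td th] : [/\ 0 < t, t < d & t < h] by rewrite /t; clear -m0 md mh; split; lra.
have /vle0 : V (a, b + t).
  by split=> /=; rewrite ?subrr ?normr0 //; clear -t0 th; apply/andP; split; lra.
have := Hd (b + t); have -> : b + t - b = t by ring.
have := Hd (b - t); have -> : b - t - b = - t by ring.
rewrite normrN (gtr0_norm t0) !ler_norml => /(_ td) /andP[g1 g2] /(_ td) /andP[g3 g4].
rewrite /v /psi /=; have -> : 2 * b - (b + t) = b - t by ring.
have -> : b + t - b = t by ring.
rewrite subrr mul0r add0r => g5.
(* The first order expansions at heights [t] and [- t] bound the odd part below by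
   [(uy (a, b) - e) * t], and [psi] vanishes linearly in [t] with slope [2 * k * h + N * h / 2]. *)
have key : (uy (a, b) - e) * t <= (k * (2 * h) + N / 2 * h) * t.
  have t0' := ltW t0; have N0' := ltW N0.
  have k1 : 0 <= k * t * t by apply: mulr_ge0 => //; exact: mulr_ge0.
  have k2 : 0 <= N * t * t by apply: mulr_ge0 => //; exact: mulr_ge0.
  by clear -g1 g2 g3 g4 g5 k1 k2; lra.
move: key; rewrite ler_pM2r // => key.
have -> : 2 * M / h = k * (2 * h) by rewrite -kh; field; rewrite gt_eqF.
by clear -key; lra.
Qed.

Lemma C2fun_opp D u ux uy uxx uyy : C2fun D u ux uy uxx uyy ->
  C2fun D (fun p => - u p) (fun p => - ux p) (fun p => - uy p)
    (fun p => - uxx p) (fun p => - uyy p).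
Proof.
case=> c1 c2 c3 c4 c5; split=> [p Dp|x y Dp|x y Dp|x y Dp|x y Dp].
- by apply: contN; exact: c1.
- by apply: derN; exact: c2.
- by apply: derN; exact: c3.
- by apply: derN; exact: c4.
- by apply: derN; exact: c5.
Qed.

(** The value type is arbitrary so that domains, which are predicates, are transposed in the same
    way as functions. *)
Definition swap {T : Type} (u : R * R -> T) p := u (p.2, p.1).

Lemma cont_at_swap u p : cont_at u (p.2, p.1) -> cont_at (swap u) p.
Proof. by move=> cu; apply: continuous_comp2 => //; cont. Qed.

Lemma C2fun_swap D u ux uy uxx uyy : C2fun D u ux uy uxx uyy ->
  C2fun (swap D) (swap u) (swap uy) (swap ux) (swap uyy) (swap uxx).
Proof.
case=> c1 c2 c3 c4 c5; split=> [p Dp|x y Dp|x y Dp|x y Dp|x y Dp].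
- by apply: cont_at_swap; exact: c1.
- exact: c3.
- exact: c2.
- exact: c5.
- exact: c4.
Qed.

Lemma gradient_estimate_y (D : set (R * R)) (u ux uy uxx uyy : R * R -> R) a b h M N :
  C2fun D u ux uy uxx uyy -> 0 < h ->
  (forall x y, `|x - a| <= h -> `|y - b| <= h -> D (x, y)) ->
  (forall x y, `|x - a| <= h -> `|y - b| <= h -> `|u (x, y)| <= M) ->
  (forall x y, `|x - a| <= h -> `|y - b| <= h -> `|uxx (x, y) + uyy (x, y)| < N) ->
  `|uy (a, b)| <= 2 * M / h + N * h / 2.
Proof.
move=> Cu h0 hD hM hN; rewrite ler_norml lerNl; apply/andP; split; last first.
  exact: (gradient_estimate_half _ _ _ _ _ _ _ _ _ _ _ Cu).
apply: (gradient_estimate_half _ _ _ _ _ _ _ _ _ _ _ (C2fun_opp _ _ _ _ _ _ Cu)) => // x y hx hy.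
  by rewrite normrN; exact: hM.
by rewrite -opprD normrN; exact: hN.
Qed.

Lemma gradient_estimate (D : set (R * R)) (u ux uy uxx uyy : R * R -> R) a b h M N :
  C2fun D u ux uy uxx uyy -> 0 < h ->
  (forall x y, `|x - a| <= h -> `|y - b| <= h -> D (x, y)) ->
  (forall x y, `|x - a| <= h -> `|y - b| <= h -> `|u (x, y)| <= M) ->
  (forall x y, `|x - a| <= h -> `|y - b| <= h -> `|uxx (x, y) + uyy (x, y)| < N) ->
  `|ux (a, b)| + `|uy (a, b)| <= 4 * M / h + N * h.
Proof.
move=> Cu h0 hD hM hN.
have E1 : `|uy (a, b)| <= 2 * M / h + N * h / 2.
  exact: (gradient_estimate_y _ _ _ _ _ _ _ _ _ _ _ Cu).
have E2 : `|ux (a, b)| <= 2 * M / h + N * h / 2.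
  apply: (gradient_estimate_y _ _ _ _ _ _ b a _ _ _ (C2fun_swap _ _ _ _ _ _ Cu)) => //.
  - by move=> x y hx hy; exact: hD.
  - by move=> x y hx hy; exact: hM.
  - by move=> x y hx hy; rewrite addrC; exact: hN.
have -> : 4 * M / h + N * h = (2 * M / h + N * h / 2) + (2 * M / h + N * h / 2).
  by field; lra.
exact: lerD.
Qed.

End MaximumPrinciple.

(** * Interior gradient estimate for quadratic growth *)

Section InteriorEstimate.
Context {R : realType}.
Implicit Types (p q : R * R) (x y e l a b h M N : R).

(** The choice [th = 1 / (16 * a * Phi)] turns the quadratic term into [Phi / 4] and the first one
    into [64 * a * S * Phi <= Phi / 4]. If [8 * a * Phi <= 1] this choice may exceed [1 / 2], but
    then [th = 1 / 2] already absorbs the quadratic term. *)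
Lemma nagumo_arith Phi S a b h : 0 <= Phi -> 0 < a -> 0 <= b -> 256 * a * S <= 1 -> 0 <= S ->
  (forall th, 0 < th -> th <= 2^-1 ->
     Phi <= 4 * S / th + 4 * a * th * Phi ^+ 2 + th * b * h ^+ 2) ->
  Phi <= 16 * S + b * h ^+ 2.
Proof.
move=> P0 a0 b0 aS S0 H.
have bh : 0 <= b * h ^+ 2 by rewrite mulr_ge0 // sqr_ge0.
have [le|lt] := leP (8 * a * Phi) 1.
  have := H 2^-1 ltac:(lra) ltac:(lra).
  rewrite invrK expr2 => E.
  by have := ler_wpM2r P0 le; lra.
have aP : 0 < a * Phi by lra.
have th0 : 0 < (16 * (a * Phi))^-1 by rewrite invr_gt0; lra.
have th1 : (16 * (a * Phi))^-1 <= 2^-1 by rewrite lef_pV2 ?posrE; lra.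
have := H _ th0 th1; rewrite invrK.
have -> : 4 * a * (16 * (a * Phi))^-1 * Phi ^+ 2 = Phi / 4.
  have [a1 P1] : a != 0 /\ Phi != 0.
    by split; apply: contraTneq aP => ->; rewrite ?mul0r ?mulr0 ltxx.
  by field; rewrite a1 P1.
have : (16 * (a * Phi))^-1 * (b * h ^+ 2) <= 2^-1 * (b * h ^+ 2) by rewrite ler_wpM2r.
have : 4 * S * (16 * (a * Phi)) <= Phi / 4.
  have -> : 4 * S * (16 * (a * Phi)) = 256 * a * S * (Phi / 4) by field.
  by rewrite ler_piMl //; lra.
rewrite -[in X in _ -> _ -> X]mulrA; lra.
Qed.

Lemma cont_norm (f : R * R -> R) p : cont_at f p -> cont_at (fun q => `|f q|) p.
Proof. by move=> cf; exact: cvg_norm. Qed.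

Lemma interior_gradient (D : set (R * R)) (u ux uy uxx uyy : R * R -> R) (x0 y0 h S a b : R) :
  C2fun D u ux uy uxx uyy ->
  (forall p, D p -> cont_at ux p /\ cont_at uy p) ->
  0 < h -> 0 < a -> 0 <= b -> 1024 * a * S <= 1 ->
  (forall x y, `|x - x0| <= h -> `|y - y0| <= h -> D (x, y) /\ `|u (x, y)| <= S) ->
  (forall p, D p -> `|uxx p + uyy p| < a * (ux p ^+ 2 + uy p ^+ 2) + b) ->
  `|ux (x0, y0)| + `|uy (x0, y0)| <= (16 * S + b * h ^+ 2) / h.
Proof.
move=> Cu cD h0 a0 b0 aS hDS hL.
have xx : `|x0 - x0| <= h by rewrite subrr normr0 ltW.
have yy : `|y0 - y0| <= h by rewrite subrr normr0 ltW.
have S0 : 0 <= S by have [_] := hDS x0 y0 xx yy; apply: le_trans.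
pose G p : R := `|ux p| + `|uy p|.
have G0 p : 0 <= G p by apply: addr_ge0.
have G2 p : ux p ^+ 2 + uy p ^+ 2 <= G p ^+ 2.
  rewrite -(real_normK (num_real (ux p))) -(real_normK (num_real (uy p))).
  have := mulr_ge0 (normr_ge0 (ux p)) (normr_ge0 (uy p)).
  by rewrite /G sqrrD; clear; lra.
(* The weight equals [h] at the centre, vanishes on the sides, and is at most the distance to each
   side; the maximum of [W * G] thus bounds [h * G (x0, y0)]. *)
pose W p : R := (h - `|p.1 - x0|) * (h - `|p.2 - y0|) / h.
pose A := (`[x0 - h, x0 + h]%classic `*` `[y0 - h, y0 + h]%classic : set (R * R)).
have AP x y : A (x, y) <-> `|x - x0| <= h /\ `|y - y0| <= h.
  by rewrite /A /= !in_itv /= !ler_distl.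
have [|||[cx cy]] := @compact_EVT_max _ R (fun p => W p * G p) A.
- by exists (x0, y0); apply/AP.
- by apply: compact_setX; exact: segment_compact.
- apply: continuous_in_subspaceT => -[x y]; rewrite inE => /AP[h1 h2].
  have [D1 _] := hDS x y h1 h2; have [c1 c2] := cD _ D1.
  have n1 := cont_norm _ _ c1; have n2 := cont_norm _ _ c2.
  have n3 : cont_at (fun q => `|q.1 - x0|) (x, y) by apply: cont_norm; cont.
  have n4 : cont_at (fun q => `|q.2 - y0|) (x, y) by apply: cont_norm; cont.
  have : cont_at (fun p => W p * G p) (x, y) by rewrite /W /G; cont.
  exact.
rewrite inE => /AP[hx hy] Hmax.
have {}Hmax x y : `|x - x0| <= h -> `|y - y0| <= h -> W (x, y) * G (x, y) <= W (cx, cy) * G (cx, cy).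
  by move=> h1 h2; apply: Hmax; rewrite inE; apply/AP.
set Phi := W (cx, cy) * G (cx, cy) in Hmax.
have Wge0 x y : `|x - x0| <= h -> `|y - y0| <= h -> 0 <= W (x, y).
  by move=> h1 h2; rewrite /W; apply: divr_ge0; [apply: mulr_ge0; rewrite subr_ge0|exact: ltW].
have P0 : 0 <= Phi by apply: mulr_ge0 => //; exact: Wge0.
suff PhiS : Phi <= 16 * S + b * h ^+ 2.
  rewrite ler_pdivlMr // mulrC.
  apply: le_trans PhiS; apply: le_trans (Hmax _ _ xx yy).
  by rewrite /W /= !subrr normr0 subr0 mulfK // gt_eqF.
have [Phi0|Phin0] := eqVneq Phi 0.
  by rewrite Phi0; apply: addr_ge0; [lra|apply: mulr_ge0 => //; exact: sqr_ge0].
pose w : R := W (cx, cy).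
have PhiE : Phi = w * G (cx, cy) by [].
clearbody Phi.
have w0 : 0 < w.
  by rewrite lt_neqAle Wge0 // andbT; apply: contraNneq Phin0 => E; rewrite PhiE -E mul0r.
have whx : w <= h - `|cx - x0|.
  rewrite /w /W /= ler_pdivrMr //; apply: ler_wpM2l; first by rewrite subr_ge0.
  by rewrite gerBl.
have why : w <= h - `|cy - y0|.
  rewrite /w /W /= ler_pdivrMr // mulrC; apply: ler_wpM2l; first by rewrite subr_ge0.
  by rewrite gerBl.
(* The factor 4 comes from the loss in the weight below: [(4 * Phi) ^+ 2] against [Phi ^+ 2] makes
   [16 * a], and [256 * (4 * a)] explains the 1024 in the hypothesis. *)
apply: (nagumo_arith _ _ (4 * a)) => //; [clear -a0; lra|clear -aS; lra|].
move=> th th0 th1.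
pose rho := th * w.
have rho0 : 0 < rho by apply: mulr_gt0.
have rhow : rho <= w / 2 by rewrite /rho [w / 2]mulrC; apply: ler_wpM2r => //; exact: ltW.
(* As [rho] is at most half the distance from the maximum point to each side, both factors of the
   weight lose at most one half in the small square, and [G] is at most [4 * Phi / w] there. *)
have sub x y : `|x - cx| <= rho -> `|y - cy| <= rho ->
    [/\ `|x - x0| <= h, `|y - y0| <= h & G (x, y) * w <= 4 * Phi].
  move=> h1 h2.
  have d1 : h - `|x - x0| >= (h - `|cx - x0|) / 2.
    by have := ler_distD cx x x0; clear -h1 rhow whx; lra.
  have d2 : h - `|y - y0| >= (h - `|cy - y0|) / 2.
    by have := ler_distD cy y y0; clear -h2 rhow why; lra.
  have e1 : `|x - x0| <= h by clear -d1 hx; lra.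
  have e2 : `|y - y0| <= h by clear -d2 hy; lra.
  split=> //; have WG := Hmax x y e1 e2.
  have : w <= 4 * W (x, y).
    rewrite /w /W /= mulrA ler_wpM2r ?invr_ge0 ?(ltW h0) //.
    have -> : (h - `|cx - x0|) * (h - `|cy - y0|) =
      4 * ((h - `|cx - x0|) / 2 * ((h - `|cy - y0|) / 2)) by field.
    apply: ler_wpM2l => //; apply: ler_pM => //; clear -hx hy; lra.
  move=> wW; apply: (@le_trans _ _ (4 * (W (x, y) * G (x, y)))).
    by rewrite mulrA mulrC ler_wpM2r.
  by apply: ler_wpM2l.
pose N := a * (4 * Phi / w) ^+ 2 + b.
have := @gradient_estimate R D u ux uy uxx uyy cx cy rho S N Cu rho0.
have H1 x y : `|x - cx| <= rho -> `|y - cy| <= rho -> D (x, y).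
  by move=> h1 h2; have [e1 e2 _] := sub x y h1 h2; have [] := hDS x y e1 e2.
have H2 x y : `|x - cx| <= rho -> `|y - cy| <= rho -> `|u (x, y)| <= S.
  by move=> h1 h2; have [e1 e2 _] := sub x y h1 h2; have [] := hDS x y e1 e2.
have H3 x y : `|x - cx| <= rho -> `|y - cy| <= rho -> `|uxx (x, y) + uyy (x, y)| < N.
  move=> h1 h2; apply: lt_le_trans (hL _ (H1 _ _ h1 h2)) _.
  rewrite /N lerD2r ler_wpM2l //; first exact: ltW.
  apply: le_trans (G2 _) _; rewrite lerXn2r ?nnegrE //.
    by apply: divr_ge0; [clear -P0; lra|exact: ltW].
  by rewrite ler_pdivlMr //; have [_ _] := sub x y h1 h2.
move=> /(_ H1 H2 H3) E.
have whh : w <= h by apply: le_trans whx _; rewrite gerBl.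
have wE : w * (4 * S / rho + N * rho) = 4 * S / th + 4 * (4 * a) * th * Phi ^+ 2 + th * b * w ^+ 2.
  rewrite /N /rho; have tn : th != 0 by rewrite gt_eqF.
  by have wn : w != 0 by [rewrite gt_eqF]; field; rewrite tn wn.
apply: (@le_trans _ _ (w * (4 * S / rho + N * rho))).
  by rewrite [X in X <= _]PhiE ler_wpM2l // ltW.
rewrite wE lerD2l ler_wpM2l //; first by rewrite mulr_ge0 // ltW.
by rewrite lerXn2r ?nnegrE // ltW.
Qed.
End InteriorEstimate.

(** * Barrier at a boundary point of class C^{1,alpha} *)

Section Barrier.
Context {R : realType}.
Implicit Types (p q : R * R) (x y e l a b h M N : R).

Lemma C2fun_add D u ux uy uxx uyy v vx vy vxx vyy :
  C2fun D u ux uy uxx uyy -> C2fun D v vx vy vxx vyy ->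
  C2fun D (fun p => u p + v p) (fun p => ux p + vx p) (fun p => uy p + vy p)
    (fun p => uxx p + vxx p) (fun p => uyy p + vyy p).
Proof.
case=> c1 c2 c3 c4 c5 [d1 d2 d3 d4 d5]; split=> [p Dp|x y Dp|x y Dp|x y Dp|x y Dp].
- by apply: contD; [exact: c1|exact: d1].
- by apply: derD; [exact: c2|exact: d2].
- by apply: derD; [exact: c3|exact: d3].
- by apply: derD; [exact: c4|exact: d4].
- by apply: derD; [exact: c5|exact: d5].
Qed.

Lemma C2fun_mul D u ux uy uxx uyy v vx vy vxx vyy :
  C2fun D u ux uy uxx uyy -> C2fun D v vx vy vxx vyy ->
  C2fun D (fun p => u p * v p) (fun p => ux p * v p + u p * vx p)
    (fun p => uy p * v p + u p * vy p)
    (fun p => uxx p * v p + 2 * (ux p * vx p) + u p * vxx p)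
    (fun p => uyy p * v p + 2 * (uy p * vy p) + u p * vyy p).
Proof.
case=> c1 c2 c3 c4 c5 [d1 d2 d3 d4 d5]; split=> [p Dp|x y Dp|x y Dp|x y Dp|x y Dp].
- by apply: contM; [exact: c1|exact: d1].
- by apply: derM; [exact: c2|exact: d2].
- by apply: derM; [exact: c3|exact: d3].
- move: (c2 _ _ Dp) (c4 _ _ Dp) (d2 _ _ Dp) (d4 _ _ Dp) => e1 e2 e3 e4.
  by der_by ltac:(ring).
- move: (c3 _ _ Dp) (c5 _ _ Dp) (d3 _ _ Dp) (d5 _ _ Dp) => e1 e2 e3 e4.
  by der_by ltac:(ring).
Qed.

Lemma C2fun_cst D (c : R) : C2fun D (fun=> c) (fun=> 0) (fun=> 0) (fun=> 0) (fun=> 0).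
Proof. by split=> *; [exact: contC|..]; exact: derC. Qed.

Lemma C2fun_sub (D E : set (R * R)) u ux uy uxx uyy : E `<=` D ->
  C2fun D u ux uy uxx uyy -> C2fun E u ux uy uxx uyy.
Proof. by move=> ED [c1 c2 c3 c4 c5]; split=> *; auto. Qed.

(* The normal coordinate at a boundary point (xi, eta) of slope m, and the squared
   distance, scaled by 1 + m^2 so that no normalisation of the normal is needed. *)
Definition bY m xi eta p : R := (p.2 - eta) - m * (p.1 - xi).
Definition bq m xi eta p : R := (1 + m ^+ 2) * ((p.1 - xi) ^+ 2 + (p.2 - eta) ^+ 2).

(* The region above the graph contains points where Y >= - K q^(2 e + 1/2) only. There and
   near Y = 0 the terms in q^(e + 1/2) and Y^2 q^(e - 1/2) make the barrier positive and
   strictly superharmonic; for larger Y the term in Y q^e keeps it superharmonic. *)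
Definition barrier (e m xi eta : R) p : R :=
  bY m xi eta p - 9 / (4 * e) * bY m xi eta p * bq m xi eta p `^ e
  + bq m xi eta p `^ (e + 2^-1) - 3 * bY m xi eta p ^+ 2 * bq m xi eta p `^ (e - 2^-1).

Lemma bY_le_bq m xi eta p : bY m xi eta p ^+ 2 <= bq m xi eta p.
Proof.
rewrite -subr_ge0.
have -> : bq m xi eta p - bY m xi eta p ^+ 2 = ((p.1 - xi) + m * (p.2 - eta)) ^+ 2.
  by rewrite /bq /bY; ring.
exact: sqr_ge0.
Qed.

Lemma C2fun_bY m xi eta D : C2fun D (bY m xi eta) (fun=> - m) (fun=> 1) (fun=> 0) (fun=> 0).
Proof.
rewrite /bY; split=> [p _|x y _|x y _|x y _|x y _] /=.
- cont.
- by der_by ltac:(ring).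
- by der_by ltac:(ring).
- exact: derC.
- exact: derC.
Qed.

Lemma C2fun_bq m xi eta D : C2fun D (bq m xi eta)
  (fun p => (1 + m ^+ 2) * (2 * (p.1 - xi))) (fun p => (1 + m ^+ 2) * (2 * (p.2 - eta)))
  (fun=> (1 + m ^+ 2) * 2) (fun=> (1 + m ^+ 2) * 2).
Proof.
rewrite /bq; split=> [p _|x y _|x y _|x y _|x y _] /=; rewrite ?expr2.
- have -> : (fun q : R * R => (1 + m * m) * ((q.1 - xi) ^+ 2 + (q.2 - eta) ^+ 2)) =
    (fun q => (1 + m * m) * ((q.1 - xi) * (q.1 - xi) + (q.2 - eta) * (q.2 - eta))).
    by apply/funext => q; rewrite !expr2.
  by cont.
- by under eq_fun do rewrite expr2; der_by ltac:(ring).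
- by under eq_fun do rewrite (expr2 (_ - eta)); der_by ltac:(ring).
- by der_by ltac:(ring).
- by der_by ltac:(ring).
Qed.

Lemma is_derive_powR_comp (f : R -> R) x l s : 0 < f x -> is_derive x 1 f l ->
  is_derive x 1 (fun t => f t `^ s) (s * l * f x `^ (s - 1)).
Proof.
move=> f0 Df; have Dp := is_derive1_powR s f0.
by apply: der_eq (@der_comp R (fun y => y `^ s) f x _ _ Dp Df) _; ring.
Qed.

Lemma C2fun_powR D u ux uy uxx uyy s : C2fun D u ux uy uxx uyy -> (forall p, D p -> 0 < u p) ->
  C2fun D (fun p => u p `^ s) (fun p => s * ux p * u p `^ (s - 1))
    (fun p => s * uy p * u p `^ (s - 1))
    (fun p => s * uxx p * u p `^ (s - 1) + s * ux p * ((s - 1) * ux p * u p `^ (s - 1 - 1)))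
    (fun p => s * uyy p * u p `^ (s - 1) + s * uy p * ((s - 1) * uy p * u p `^ (s - 1 - 1))).
Proof.
case=> c1 c2 c3 c4 c5 pos; split=> [p Dp|x y Dp|x y Dp|x y Dp|x y Dp].
- apply: (@continuous_comp _ _ _ u (fun y => y `^ s)); first exact: c1.
  apply/differentiable_continuous/derivable1_diffP.
  by have [] := is_derive1_powR s (pos _ Dp).
- by apply: is_derive_powR_comp; [exact: pos|exact: c2].
- by apply: is_derive_powR_comp; [exact: pos|exact: c3].
- have e1 := @is_derive_powR_comp (fun t => u (t, y)) _ _ (s - 1) (pos _ Dp) (c2 _ _ Dp).
  move: (c4 _ _ Dp) => e2.
  by der_by ltac:(ring).
- have e1 := @is_derive_powR_comp (fun t => u (x, t)) _ _ (s - 1) (pos _ Dp) (c3 _ _ Dp).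
  move: (c5 _ _ Dp) => e2.
  by der_by ltac:(ring).
Qed.

Lemma powR_shift (q s s' : R) n : 0 < q -> s = s' + n%:R -> q `^ s = q ^+ n * q `^ s'.
Proof.
move=> q0 ->; rewrite powRD; last by apply/implyP => _; rewrite gt_eqF.
by rewrite powR_mulrn ?(ltW q0) // mulrC.
Qed.

(** The formula rests on |grad q|^2 = 4 (1 + m^2) q, Laplacian q = 4 (1 + m^2) and grad Y . grad q =
    2 (1 + m^2) Y. In particular Y q^e has Laplacian 4 e (1 + e) (1 + m^2) Y q^(e - 1), and the
    coefficient [9 / (4 * e)] cancels the factor 4 e. *)
Lemma barrier_C2 e m xi eta : 0 < e -> exists bx by_ bxx byy,
  C2fun [set p | 0 < bq m xi eta p] (barrier e m xi eta) bx by_ bxx byy /\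
  forall p, 0 < bq m xi eta p -> bxx p + byy p = (1 + m ^+ 2) *
   ((- 9 * (1 + e)) * bY m xi eta p * bq m xi eta p `^ (e - 1)
    + ((1 + 2 * e) ^+ 2 - 6) * bq m xi eta p `^ (e - 2^-1)
    + 3 * (1 - 2 * e) * (3 + 2 * e) * bY m xi eta p ^+ 2 * bq m xi eta p `^ (e - 3 / 2)).
Proof.
move=> e0; set D := [set p | _].
have CY := C2fun_bY m xi eta D; have Cq := C2fun_bq m xi eta D.
have pos p : D p -> 0 < bq m xi eta p by [].
have CP s := C2fun_powR D _ _ _ _ _ s Cq pos.
have C1 := C2fun_mul _ _ _ _ _ _ _ _ _ _ _ (C2fun_mul _ _ _ _ _ _ _ _ _ _ _ (C2fun_cst D (9 / (4 * e))) CY) (CP e).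
have C2 := C2fun_mul _ _ _ _ _ _ _ _ _ _ _ (C2fun_mul _ _ _ _ _ _ _ _ _ _ _ (C2fun_cst D 3)
  (C2fun_mul _ _ _ _ _ _ _ _ _ _ _ CY CY)) (CP (e - 2^-1)).
have C3 := C2fun_add _ _ _ _ _ _ _ _ _ _ _ (C2fun_add _ _ _ _ _ _ _ _ _ _ _
  (C2fun_add _ _ _ _ _ _ _ _ _ _ _ CY (C2fun_opp _ _ _ _ _ _ C1)) (CP (e + 2^-1)))
  (C2fun_opp _ _ _ _ _ _ C2).
do 4 eexists; split; first exact: C3.
move=> p q0 /=.
(* All powers are reduced to the two lowest exponents [e - 2] and [e - 5 / 2]; with these as atoms
   the claim is a rational identity. *)
have P1 := powR_shift (bq m xi eta p) (e - 1) (e - 1 - 1) 1 q0 ltac:(ring).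
have P2 := powR_shift (bq m xi eta p) e (e - 1 - 1) 2 q0 ltac:(ring).
have P3 := powR_shift (bq m xi eta p) (e - 2^-1) (e - 5 / 2) 2 q0 ltac:(by field).
have P4 := powR_shift (bq m xi eta p) (e - 2^-1 - 1) (e - 5 / 2) 1 q0 ltac:(by field).
have P5 := powR_shift (bq m xi eta p) (e - 2^-1 - 1 - 1) (e - 5 / 2) 0 q0 ltac:(by field).
have P6 := powR_shift (bq m xi eta p) (e + 2^-1 - 1) (e - 5 / 2) 2 q0 ltac:(by field).
have P7 := powR_shift (bq m xi eta p) (e + 2^-1 - 1 - 1) (e - 5 / 2) 1 q0 ltac:(by field).
have P8 := powR_shift (bq m xi eta p) (e - 3 / 2) (e - 5 / 2) 1 q0 ltac:(by field).
rewrite P5 P4 P7 P6 P8 P3 P1 P2.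
set a1 := _ `^ (e - 1 - 1); set a2 := _ `^ (e - 5 / 2).
clearbody a1 a2; rewrite /bq /bY; field.
by rewrite gt_eqF.
Qed.

(** This is the barrier divided by the square root of q, with c = Y / sqrt q and t = q^e. For
    [c >= 0] the two subtracted terms are at most [c]; for [c < 0], [- c <= K * t ^+ 2 <= t / 5] is
    negligible against the term [t]. *)
Lemma barrier_arith (A K t c : R) : 9 <= A -> 0 <= K -> 0 < t -> (A + 3 + 5 * K) * t <= 1 ->
  - K * t ^+ 2 <= c -> c <= 1 -> t / 4 <= c - A * c * t + t - 3 * c ^+ 2 * t <= 2.
Proof.
move=> A9 K0 t0 At Kc c1.
have t0' := ltW t0.
have Kt0 : 0 <= K * t by exact: mulr_ge0.
have h1 : A * t >= 9 * t by rewrite ler_wpM2r.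
have t1 : t <= 1 / 12 by clear -h1 At Kt0; lra.
have A1 : A * t <= 1 by clear -h1 At Kt0 t0'; lra.
have Kt : K * t <= 1 / 5 by clear -h1 At Kt0 t0'; lra.
have [c0|/ltW c0] := leP 0 c.
  have : c * ((A + 3) * t) <= c * 1 by apply: ler_wpM2l => //; clear -At Kt0; lra.
  have : c * c * t <= c * t by rewrite ler_wpM2r // ler_piMl.
  have : 0 <= A * c * t by rewrite !mulr_ge0 //; clear -A9; lra.
  have : 0 <= c * c * t by rewrite !mulr_ge0.
  rewrite expr2; clear -c1 t1 t0'; move=> *; apply/andP; split; lra.
have Kc' : - (K * t * t) <= c by rewrite -mulrA -expr2 -mulNr.
have n0 : 0 <= - c by rewrite oppr_ge0.
have h2 : - c <= t / 5 by have := ler_wpM2r t0' Kt; clear -Kc'; lra.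
have h3 : 0 <= - c * (1 - A * t) by rewrite mulr_ge0 // subr_ge0.
have h4 : - c * (1 - A * t) <= - c.
  by rewrite ler_piMr // gerBl; clear -h1 t0'; lra.
have h5 : (- c) * (- c) * t <= 1 * 1 * t.
  rewrite ler_wpM2r //; apply: ler_pM => //; clear -h2 t1; lra.
have h6 : 0 <= (- c) * (- c) * t by rewrite !mulr_ge0.
have h7 : (- c) * (- c) * t <= 1 / 60 * (1 / 60) * t.
  rewrite ler_wpM2r //; apply: ler_pM => //; clear -h2 t1; lra.
rewrite expr2; clear -h2 h3 h4 h5 h6 h7 t1 t0'; apply/andP; split; lra.
Qed.

(** The coefficient of [c ^+ 2] is at most 9 and [c ^+ 2 <= c] on [0, 1], so the linear term with
    its 9 wins for [c >= 0]. For [c < 0], where |c| <= 1/5, the constant term, at most - 15/4,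
    dominates. *)
Lemma barrier_lap_arith (e kappa c : R) : 0 < e -> e <= 1 / 4 -> 0 <= kappa -> kappa <= 1 / 5 ->
  - kappa <= c -> c <= 1 ->
  (- 9 * (1 + e)) * c + ((1 + 2 * e) ^+ 2 - 6) + 3 * (1 - 2 * e) * (3 + 2 * e) * c ^+ 2 <= - 1.
Proof.
move=> e0 e1 k0 k1 kc c1.
have e2 : e * e <= 1 / 4 * (1 / 4) by apply: ler_pM => //; exact: ltW.
have e3 : 0 <= e * e by rewrite mulr_ge0 // ltW.
have h1 : (1 + 2 * e) ^+ 2 - 6 <= - 15 / 4 by rewrite expr2; clear -e1 e2; lra.
have h2 : 3 * (1 - 2 * e) * (3 + 2 * e) * c ^+ 2 <= 9 * c ^+ 2.
  by rewrite ler_wpM2r ?sqr_ge0 //; clear -e0 e3; lra.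
have [c0|/ltW c0] := leP 0 c.
  have : c * c <= c by rewrite ler_piMl.
  have : 0 <= e * c by rewrite mulr_ge0 // ltW.
  move: h2; rewrite !expr2 in h1 *; clear -c0 h1; lra.
have : - c * (- c) <= 1 / 5 * (1 / 5) by apply: ler_pM; clear -kc k1 c0; lra.
have : e * (- c) <= 1 / 4 * (1 / 5) by apply: ler_pM; clear -kc k1 c0 e0 e1; lra.
move: h2; rewrite !expr2 in h1 *; clear -kc k1 h1; lra.
Qed.

Lemma barrier_bounds (e K m xi eta : R) p : 0 < e -> e <= 1 / 4 -> 0 <= K ->
  0 < bq m xi eta p -> (9 / (4 * e) + 3 + 5 * K) * bq m xi eta p `^ e <= 1 ->
  - K * bq m xi eta p `^ (2^-1 + 2 * e) <= bY m xi eta p ->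
  [/\ bq m xi eta p `^ (e + 2^-1) / 4 <= barrier e m xi eta p,
      barrier e m xi eta p <= 2 * bq m xi eta p `^ 2^-1 &
      (- 9 * (1 + e)) * bY m xi eta p * bq m xi eta p `^ (e - 1)
      + ((1 + 2 * e) ^+ 2 - 6) * bq m xi eta p `^ (e - 2^-1)
      + 3 * (1 - 2 * e) * (3 + 2 * e) * bY m xi eta p ^+ 2 * bq m xi eta p `^ (e - 3 / 2)
      <= - bq m xi eta p `^ (e - 2^-1)].
Proof.
move=> e0 e1 K0; rewrite /barrier; have := bY_le_bq m xi eta p.
set q := bq _ _ _ p; set Y := bY _ _ _ p; set A := 9 / (4 * e) => Yq q0 At KY.
have pw a b : q `^ (a + b) = q `^ a * q `^ b.
  by rewrite powRD //; apply/implyP => _; rewrite gt_eqF.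
set t := q `^ e in At *; set r := q `^ 2^-1.
have t0 : 0 < t by exact: powR_gt0.
have r0 : 0 < r by exact: powR_gt0.
have rr : r * r = q by rewrite -pw -[RHS](powRr1 (ltW q0)); congr (_ `^ _); field.
have E1 : q `^ (e + 2^-1) = t * r by rewrite pw.
have E2 : q `^ (e - 2^-1) = t / r by rewrite pw powRN.
have E3 : q `^ (e - 1) = t / (r * r) by rewrite pw powRN powRr1 ?ltW // rr.
have E4 : q `^ (e - 3 / 2) = t / (r * r * r).
  have -> : e - 3 / 2 = e - 1 - 2^-1 by field.
  by rewrite pw powRN E3 [in RHS]invfM mulrA.
have E5 : q `^ (2^-1 + 2 * e) = r * (t * t).
  by rewrite pw; congr (_ * _); rewrite -pw; congr (_ `^ _); ring.
rewrite E1 E2 E3 E4; rewrite E5 in KY.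
(* In the variables [c] and [t] the barrier is [r] times a function, and its Laplacian is
   [(1 + m ^+ 2) * (t / r)] times another; the two arithmetic lemmas estimate these functions. *)
pose c := Y / r; have YE : Y = c * r by rewrite /c divfK // gt_eqF.
have c1 : c <= 1.
  apply: le_trans (ler_norm _) _.
  rewrite -(@ler_pXn2r _ 2 isT) ?nnegrE ?ler01 ?normr_ge0 // expr1n real_normK ?num_real //.
  by rewrite /c expr_div_n ler_pdivrMr ?exprn_gt0 // mul1r (expr2 r) rr.
have Kc : - K * t ^+ 2 <= c.
  rewrite /c ler_pdivlMr //; apply: le_trans KY; rewrite expr2.
  by rewrite [X in X <= _](_ : _ = - K * (r * (t * t))) //; ring.
have A9 : 9 <= A.
  by rewrite /A ler_pdivlMr; [clear -e1; lra|clear -e0; lra].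
clearbody A t r c.
have /andP[b1 b2] := barrier_arith A K t c A9 K0 t0 At Kc c1.
have Kt2 : K * t ^+ 2 <= 1 / 5.
  have tt : t <= 1.
    have : 0 <= K * t by rewrite mulr_ge0 // ltW.
    have : 9 * t <= A * t by rewrite ler_wpM2r // ltW.
    by clear -At t0; lra.
  have : K * t * t <= K * t * 1 by rewrite ler_wpM2l // mulr_ge0 // ltW.
  have : 9 * t <= A * t by rewrite ler_wpM2r // ltW.
  by rewrite expr2 mulrA; clear -At t0; lra.
have Kt0 : 0 <= K * t ^+ 2 by rewrite mulr_ge0 // sqr_ge0.
have Kc' : - (K * t ^+ 2) <= c by rewrite -mulNr.
have b3 := barrier_lap_arith e _ c e0 e1 Kt0 Kt2 Kc' c1.
have rn : r != 0 by rewrite gt_eqF.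
have -> : Y - A * Y * t + t * r - 3 * Y ^+ 2 * (t / r) = (c - A * c * t + t - 3 * c ^+ 2 * t) * r.
  by rewrite YE; field.
split.
- by rewrite mulrAC ler_wpM2r // ltW.
- by rewrite ler_wpM2r // ltW.
- rewrite [X in X <= _](_ : _ = ((- 9 * (1 + e)) * c + ((1 + 2 * e) ^+ 2 - 6)
    + 3 * (1 - 2 * e) * (3 + 2 * e) * c ^+ 2) * (t / r)); last by rewrite YE; field.
  by rewrite -[X in _ <= X]mulN1r ler_wpM2r // divr_ge0 // ltW.
Qed.
End Barrier.

(** * Boundary gradient estimate above a graph *)

Section BoundaryDecay.
Context {R : realType}.
Implicit Types (p q : R * R) (x y e l a b h M N : R).

Definition above (g : R -> R) (x0 d : R) : set (R * R) :=
  [set p | `|p.1 - x0| < d /\ g p.1 < p.2 < g x0 + d].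

Lemma open_above (g : R -> R) (L x0 d : R) : 1 <= L ->
  (forall x x', `|x - x0| < d -> `|x' - x0| < d -> `|g x' - g x| <= L * `|x' - x|) ->
  open (above g x0 d).
Proof.
move=> L1 hL; rewrite openE => -[x y] [/= h1 /andP[h2 h3]]; apply/nbhs_boxP => /=.
pose r := Num.min (d - `|x - x0|) (Num.min ((y - g x) / (2 * L)) (Num.min ((y - g x) / 2) (g x0 + d - y))).
have LL : 0 < 2 * L by clear -L1; lra.
have r0 : 0 < r.
  rewrite /r !lt_min !subr_gt0 h1 h3 /= andbT; apply/andP; split.
    by rewrite divr_gt0 // subr_gt0.
  by rewrite divr_gt0 ?subr_gt0.
exists r => // x' y'; rewrite /r !lt_min => /andP[a1 /andP[a2 _]] /andP[_ /andP[_ /andP[b1 b2]]].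
have h4 : `|x' - x0| < d by have := ler_distD x x' x0; clear -a1; lra.
split=> //=; have := hL x x' h1 h4.
move: a2; rewrite ltr_pdivlMr // => a2.
move: b1 b2; rewrite !ltr_norml ler_norml => /andP[b1 _] /andP[_ b2] /andP[_ c].
apply/andP; split; [clear -a2 b1 c; lra|clear -b2; lra].
Qed.

Lemma C2fun_expR D u ux uy uxx uyy a : C2fun D u ux uy uxx uyy ->
  C2fun D (fun p => expR (a * u p)) (fun p => a * ux p * expR (a * u p))
    (fun p => a * uy p * expR (a * u p))
    (fun p => (a * uxx p + (a * ux p) ^+ 2) * expR (a * u p))
    (fun p => (a * uyy p + (a * uy p) ^+ 2) * expR (a * u p)).
Proof.
have aux (f : R -> R) x l : is_derive x 1 f l ->
    is_derive x 1 (fun t => expR (a * f t)) (a * l * expR (a * f x)).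
  move=> Df; have Da : is_derive x 1 (fun t => a * f t) (a * l) by der_by ltac:(ring).
  by apply: der_eq (@der_comp R expR (fun t => a * f t) x _ _ (is_derive_expR _) Da) _; ring.
case=> c1 c2 c3 c4 c5; split=> [p Dp|x y Dp|x y Dp|x y Dp|x y Dp].
- have c : cont_at (fun p => a * u p) p by apply: contM; [exact: contC|exact: c1].
  apply: (@continuous_comp _ _ _ (fun p => a * u p) expR) => //.
  exact: continuous_expR.
- by apply: aux; exact: c2.
- by apply: aux; exact: c3.
- have e1 := aux _ _ _ (c2 _ _ Dp); have e2 := c4 _ _ Dp.
  by der_by ltac:(ring).
- have e1 := aux _ _ _ (c3 _ _ Dp); have e2 := c5 _ _ Dp.
  by der_by ltac:(ring).
Qed.

Lemma sqrt_powR_le (q s : R) : 0 <= q -> 0 <= s -> q <= s ^+ 2 -> q `^ 2^-1 <= s.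
Proof.
move=> q0 s0 qs; rewrite powR12_sqrt // -[s]ger0_norm // -sqrtr_sqr.
by rewrite ler_wsqrtr.
Qed.

Lemma bq_bounds m xi eta p (L : R) : `|m| <= L -> 1 <= L ->
  [/\ (p.1 - xi) ^+ 2 <= bq m xi eta p, (p.2 - eta) ^+ 2 <= bq m xi eta p &
      bq m xi eta p <= ((1 + L) * (`|p.1 - xi| + `|p.2 - eta|)) ^+ 2].
Proof.
move=> mL L1; rewrite /bq.
have m2 : m ^+ 2 <= L ^+ 2.
  rewrite -(real_normK (num_real m)) lerXn2r ?nnegrE ?normr_ge0 //; clear -L1; lra.
set X := p.1 - xi; set Y := p.2 - eta.
have X0 := sqr_ge0 X; have Y0 := sqr_ge0 Y; have m0 := sqr_ge0 m.
have XY : 0 <= m ^+ 2 * (X ^+ 2 + Y ^+ 2) by rewrite mulr_ge0 // addr_ge0.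
split; [clear -XY Y0; lra|clear -XY X0; lra|].
rewrite exprMn; apply: ler_pM; [clear -m0; lra|exact: addr_ge0| |].
  by rewrite sqrrD; clear -m2 L1; lra.
rewrite [leRHS]sqrrD !real_normK ?num_real //.
have : 0 <= `|X| * `|Y| by rewrite mulr_ge0.
by clear; lra.
Qed.

(** The exponential absorbs the quadratic term: the Laplacian of exp(a u) is a exp(a u) (Laplacian u
    + a |grad u|^2), hence at least - a b exp(a S). Comparison with [lam] times the barrier at (xi,
    g xi) gives a u <= exp(a u) - 1 <= 2 lam sqrt q. All constants are independent of [xi]. *)
Lemma boundary_upper (g m : R -> R) (alpha K L x0 d S a b : R)
    (u ux uy uxx uyy : R * R -> R) :
  0 < d -> 0 < alpha <= 1 -> 0 <= K -> 1 <= L ->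
  (forall x x', `|x - x0| < d -> `|x' - x0| < d -> `|g x' - g x| <= L * `|x' - x|) ->
  (forall x, `|x - x0| < d -> `|m x| <= L) ->
  (forall x x', `|x - x0| < d -> `|x' - x0| < d ->
     `|g x' - g x - m x * (x' - x)| <= K * `|x' - x| `^ (1 + alpha)) ->
  C2fun (above g x0 d) u ux uy uxx uyy ->
  (forall p, above g x0 d p -> u p <= S) -> 0 < a -> 0 <= b ->
  (forall p, above g x0 d p -> - (a * (ux p ^+ 2 + uy p ^+ 2) + b) <= uxx p + uyy p) ->
  (forall x, `|x - x0| < d -> forall e, 0 < e -> exists2 r : R, 0 < r &
     forall x' y', `|x' - x| < r -> `|y' - g x| < r -> above g x0 d (x', y') ->
     u (x', y') < e) ->
  exists C rho : R, [/\ 0 <= C, 0 < rho & forall xi, `|xi - x0| < rho ->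
    forall x y, above g x0 d (x, y) -> `|x - xi| < rho -> `|y - g xi| < rho ->
      u (x, y) <= C * (`|x - xi| + `|y - g xi|)].
Proof.
move=> d0 /andP[al0 al1] K0 L1 hL hm hK Cu uS a0 b0 hLap hbd.
(* The graph deviates from its tangent by at most K sqrt(q) (q^e)^2, one factor q^e smaller than the
   positive term sqrt(q) q^e of the barrier. *)
pose e := alpha / 4.
have e0 : 0 < e by rewrite /e; clear -al0; lra.
have e1 : e <= 1 / 4 by rewrite /e; clear -al1; lra.
have alE : 1 + alpha = 2 * (2^-1 + 2 * e) by rewrite /e; field.
clearbody e.
pose T := 9 / (4 * e) + 3 + 5 * K.
have T0 : 0 < T.
  have : 0 < 9 / (4 * e) by apply: divr_gt0; clear -e0; lra.
  by rewrite /T; clear -K0; lra.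
pose Q : R := Num.min (T^-1 `^ e^-1) (Num.min 1 ((d / 4) ^+ 2)).
have d4 : 0 < d / 4 by clear -d0; lra.
have Q0 : 0 < Q by rewrite /Q !lt_min ltr01 powR_gt0 ?invr_gt0 // exprn_gt0.
have Q1 : Q <= 1 by rewrite /Q !ge_min lexx orbT.
have Qd : Q <= (d / 4) ^+ 2 by rewrite /Q !ge_min lexx !orbT.
have QT (q : R) : 0 <= q -> q <= Q -> T * q `^ e <= 1.
  move=> q0 qQ; rewrite -ler_pdivlMl // mulr1.
  have <- : (T^-1 `^ e^-1) `^ e = T^-1.
    by rewrite -powRrM mulVf ?gt_eqF // powRr1 // invr_ge0 ltW.
  apply: ge0_ler_powR; rewrite ?nnegrE ?powR_ge0 ?(ltW e0) //.
  by apply: le_trans qQ _; rewrite /Q ge_min lexx.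
clearbody Q.
pose E := expR (a * S).
have E0 : 0 < E by exact: expR_gt0.
(* The first term makes [lam] times the barrier at least [E] on the part of the boundary where
   [q = Q]; the second compensates the lower bound of the Laplacian of the exponential, and the 1
   makes the inequality strict. *)
pose lam := 4 * E / Q `^ (e + 2^-1) + a * b * E + 1.
have Qp : 0 < Q `^ (e + 2^-1) by exact: powR_gt0.
have lamQ : E <= lam * (Q `^ (e + 2^-1) / 4).
  have h : 0 <= (a * b * E + 1) * (Q `^ (e + 2^-1) / 4).
    by rewrite mulr_ge0 // ?divr_ge0 ?(ltW Qp) // addr_ge0 // !mulr_ge0 // ltW.
  rewrite /lam -addrA mulrDl [X in _ <= X + _](_ : _ = E); last by field; rewrite gt_eqF.
  by rewrite lerDl.
have abE : 0 <= a * b * E by rewrite !mulr_ge0 // ltW.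
have lam1 : a * b * E + 1 <= lam.
  rewrite /lam -addrA lerDr divr_ge0 ?(ltW Qp) // mulr_ge0 // ltW //.
have lam0 : 0 < lam by clear -lam1 abE; lra.
clearbody lam.
have L1' : 0 < 1 + L by clear -L1; lra.
have LL : 0 < (1 + L) * 2 by clear -L1; lra.
(* The first two entries keep the boundary point (xi, g xi) within [d / 4] of the centre; the last
   gives [s < Q] below, whence [q <= s ^+ 2 <= s < Q], because [Q <= 1]. *)
pose rho := Num.min (d / (4 * L)) (Num.min (d / 4) (Q / ((1 + L) * 2) / 2)).
have rho0 : 0 < rho.
  rewrite /rho !lt_min d4 divr_gt0 //=; last by clear -L1; lra.
  by rewrite !divr_gt0.
have rL : L * rho <= d / 4.
  rewrite mulrC -ler_pdivlMr; last by clear -L1; lra.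
  have -> : d / 4 / L = d / (4 * L) by rewrite -mulrA -invfM.
  by rewrite /rho ge_min lexx.
have rd : rho <= d / 4 by rewrite /rho !ge_min lexx orbT.
have rQ : (1 + L) * 2 * rho < Q.
  rewrite mulrC -ltr_pdivlMr //.
  apply: (@le_lt_trans _ _ (Q / ((1 + L) * 2) / 2)); first by rewrite /rho !ge_min lexx !orbT.
  by rewrite ltr_pdivrMr // ltr_pMr ?divr_gt0 //; clear; lra.
clearbody rho.
exists (2 * lam * (1 + L) / a), rho; split=> //.
  by rewrite divr_ge0 ?(ltW a0) // !mulr_ge0 ?(ltW lam0) ?(ltW L1').
move=> xi hxi x y axy hx hy.
have xid : `|xi - x0| < d by clear -hxi rd d0; lra.
have gxi : `|g xi - g x0| <= d / 4.
  apply: le_trans (hL x0 xi _ xid) _; first by rewrite subrr normr0.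
  apply: le_trans rL; apply: ler_wpM2l; [clear -L1; lra|exact: ltW].
pose q : R * R -> R := bq (m xi) xi (g xi).
have mxi := hm _ xid.
have qpos p : above g x0 d p -> 0 < q p.
  move=> [_ /andP[h _]].
  have [B1 B2 _] := bq_bounds (m xi) xi (g xi) p L mxi L1.
  rewrite lt_neqAle (le_trans (sqr_ge0 _) B1) andbT; apply/eqP => q0.
  have /eqP : (p.1 - xi) ^+ 2 = 0 by apply/le_anti; rewrite sqr_ge0 (le_trans B1) // -/(q p) -q0.
  have /eqP : (p.2 - g xi) ^+ 2 = 0 by apply/le_anti; rewrite sqr_ge0 (le_trans B2) // -/(q p) -q0.
  rewrite !sqrf_eq0 !subr_eq0 => /eqP h2 /eqP h1.
  by rewrite h1 h2 ltxx in h.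
have YK p : above g x0 d p -> - K * q p `^ (2^-1 + 2 * e) <= bY (m xi) xi (g xi) p.
  move=> [h1 /andP[h2 _]].
  have [B1 _ _] := bq_bounds (m xi) xi (g xi) p L mxi L1.
  have := hK xi p.1 xid h1; rewrite ler_norml => /andP[+ _].
  have : K * `|p.1 - xi| `^ (1 + alpha) <= K * q p `^ (2^-1 + 2 * e).
    apply: ler_wpM2l => //; rewrite alE powRrM; apply: ge0_ler_powR.
    - by clear -e0; lra.
    - by rewrite nnegrE powR_ge0.
    - by rewrite nnegrE (le_trans (sqr_ge0 _) B1).
    - by rewrite powR_mulrn // real_normK ?num_real.
  by rewrite /bY; clear -h2; lra.
have [bx [by_ [bxx [byy [Cb Lb]]]]] := barrier_C2 e (m xi) xi (g xi) e0.
pose ph : R * R -> R := barrier e (m xi) xi (g xi).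
have bounds p : above g x0 d p -> q p <= Q -> [/\ q p `^ (e + 2^-1) / 4 <= ph p,
    ph p <= 2 * q p `^ 2^-1 &
    exists2 X, X <= - q p `^ (e - 2^-1) & bxx p + byy p = (1 + m xi ^+ 2) * X].
  move=> ap qp; have [b1 b2 b3] := barrier_bounds e K (m xi) xi (g xi) p e0 e1 K0
    (qpos p ap) (QT _ (ltW (qpos p ap)) qp) (YK p ap).
  by split=> //; eexists; [exact: b3|exact: Lb (qpos p ap)].
clear Lb; rewrite -/ph in Cb; clearbody ph.
have Cv := C2fun_add _ _ _ _ _ _ _ _ _ _ _
  (C2fun_add _ _ _ _ _ _ _ _ _ _ _ (C2fun_expR _ _ _ _ _ _ a Cu) (C2fun_cst _ (- 1)))
  (C2fun_mul _ _ _ _ _ _ _ _ _ _ _ (C2fun_cst _ (- lam)) (C2fun_sub _ _ _ _ _ _ _ (qpos : above g x0 d `<=` _) Cb)).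
set v := (fun p => _ + _ : R) in Cv.
have lapb p : above g x0 d p -> q p <= Q -> bxx p + byy p <= - 1.
  move=> ap qp; have [_ _ [X hX ->]] := bounds p ap qp.
  have z1 : 1 <= q p `^ (e - 2^-1).
    rewrite -[leLHS](powRr0 (q p)); apply: ger_powR.
      by rewrite qpos //= (le_trans qp).
    by clear -e1; lra.
  have X1 : X <= - 1 by apply: le_trans hX _; rewrite lerN2.
  have : 0 <= m xi ^+ 2 * - X by rewrite mulr_ge0 ?sqr_ge0 //; clear -X1; lra.
  by clear -X1; lra.
have phge p : above g x0 d p -> q p <= Q -> 0 <= ph p.
  by move=> ap qp; have [h _ _] := bounds p ap qp; apply: le_trans h; rewrite divr_ge0 ?powR_ge0.
pose V := [set p | above g x0 d p /\ q p < Q].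
have qcont p : cont_at q p by exact: (C2c _ _ _ _ _ _ (C2fun_bq (m xi) xi (g xi) setT)).
have oV : open V.
  apply: openI; first exact: open_above hL.
  rewrite openE => p /= qp; apply/nbhs_boxP.
  have [r r0 Hr] := (continuous_boxP _ _).1 (qcont p) (Q - q p) ltac:(by rewrite subr_gt0).
  exists r => // x' y' h1 h2; have := Hr x' y' h1 h2; rewrite ltr_norml => /andP[_].
  by clear; lra.
have Vd p : q p <= Q -> `|p.1 - xi| <= d / 4 /\ `|p.2 - g xi| <= d / 4.
  move=> qp; have [B1 B2 _] := bq_bounds (m xi) xi (g xi) p L mxi L1.
  have d4' := ltW d4.
  split; rewrite -(@ler_pXn2r _ 2 isT) ?nnegrE ?normr_ge0 // real_normK ?num_real //.
    by apply: le_trans B1 _; apply: le_trans Qd.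
  by apply: le_trans B2 _; apply: le_trans Qd.
have near_above p : q p <= Q -> `|p.1 - x0| < d /\ p.2 < g x0 + d.
  move=> /Vd[h1 h2]; move: h2 gxi; rewrite !ler_norml => /andP[_ k1] /andP[_ k2].
  by have := ler_distD xi p.1 x0; clear -h1 hxi rd d0 k1 k2; split; lra.
have vle p : V p -> v p <= 0.
  have bV p0 : V p0 -> `|p0.1| <= `|xi| + `|g xi| + d /\ `|p0.2| <= `|xi| + `|g xi| + d.
    move=> [_ /ltW /Vd[h1 h2]].
    have := ler_normD (p0.1 - xi) xi; have := ler_normD (p0.2 - g xi) (g xi).
    rewrite !subrK; have := normr_ge0 xi; have := normr_ge0 (g xi).
    by clear -h1 h2 d0; split; lra.
  have VA : V `<=` above g x0 d by move=> p0 [].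
  apply: (max_principle V _ _ _ _ _ _ oV bV (C2fun_sub _ _ _ _ _ _ _ VA Cv)).
    move=> p0 [ap qp]; have lb := lapb p0 ap (ltW qp).
    have LE := hLap p0 ap.
    set EX := expR (a * u p0).
    have EX0 : 0 < EX by exact: expR_gt0.
    have EXE : EX <= E by rewrite ler_expR ler_wpM2l ?uS // ltW.
    have h1 : - lam * (bxx p0 + byy p0) >= lam by rewrite mulNr -mulrN ler_peMr ?(ltW lam0) // lerNr.
    have h2 : a * EX * (uxx p0 + uyy p0 + a * (ux p0 ^+ 2 + uy p0 ^+ 2)) >= a * EX * (- b).
      by apply: ler_wpM2l; [rewrite mulr_ge0 // ltW|clear -LE; lra].
    have h3 : a * b * EX <= a * b * E by rewrite ler_wpM2l // mulr_ge0 // ltW.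
    by clear -h1 h2 h3 lam1; rewrite !expr2 in h2 *; lra.
  move=> p0 cl nV eps eps0.
  have qp : q p0 <= Q.
    rewrite leNgt; apply/negP => lt.
    have [r r0 Hr] := (continuous_boxP _ _).1 (qcont p0) (q p0 - Q) ltac:(by rewrite subr_gt0).
    have [x' [y' [[_ h0] h1 h2]]] := closure_boxP _ _ cl r r0.
    by have := Hr x' y' h1 h2; rewrite ltr_norml => /andP[h3 _]; clear -h3 h0; lra.
  have [n1 n2] := near_above p0 qp.
  have n3 : g p0.1 <= p0.2.
    apply/ler_addgt0Pr => r r0.
    have r1 : 0 < r / ((1 + L) * 2) by exact: divr_gt0.
    have [x' [y' [[[/= h0 /andP[h1 _]] _] h2 h3]]] := closure_boxP _ _ cl _ r1.
    have := hL p0.1 x' n1 h0; move: h2 h3; rewrite !ltr_pdivlMr // => h2 h3.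
    have h4 := ler_norm (y' - p0.2); rewrite ler_norml => /andP[h6 _].
    have h7 : L * `|x' - p0.1| + `|y' - p0.2| <= r.
      have : 0 <= L * `|y' - p0.2| by rewrite mulr_ge0 //; clear -L1; lra.
      by have := normr_ge0 (x' - p0.1); have := normr_ge0 (y' - p0.2); clear -h2 h3; lra.
    by clear -h7 h6 h4 h1; lra.
  have [E1|n4] := eqVneq p0.2 (g p0.1).
    (* Below this bound on u the exponential is less than [1 + eps], and the barrier is nonnegative:
       this is the boundary condition on the graph. *)
    have eps1 : 0 < ln (1 + eps) / a by rewrite divr_gt0 // ln_gt0 // ltrDl.
    have [r r0 Hr] := hbd p0.1 n1 _ eps1.
    exists r => // x' y' h1 h2 [ap /ltW qp']; rewrite E1 in h2.
    have := Hr x' y' h1 h2 ap; rewrite ltr_pdivlMr // mulrC => h3.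
    have h4 : expR (a * u (x', y')) < 1 + eps.
      by rewrite -ltr_ln ?posrE ?expR_gt0 ?expRK //; clear -eps0; lra.
    have : 0 <= lam * ph (x', y') by rewrite mulr_ge0 ?(ltW lam0) // phge.
    by rewrite /v mulNr; clear -h4; lra.
  have ap : above g x0 d p0 by split=> //; rewrite n2 andbT lt_neqAle eq_sym n4.
  have qQ : q p0 = Q.
    by apply/eqP; rewrite eq_le qp leNgt; apply/negP => lt; apply: nV.
  have v0 : v p0 <= 0.
    have [h _ _] := bounds p0 ap qp; rewrite -/(q p0) qQ in h.
    have : lam * (Q `^ (e + 2^-1) / 4) <= lam * ph p0 by rewrite ler_wpM2l // ltW.
    have : expR (a * u p0) <= E by rewrite ler_expR ler_wpM2l ?uS // ltW.
    by rewrite /v mulNr; clear -lamQ; lra.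
  have [r r0 Hr] := (continuous_boxP _ _).1 (C2c _ _ _ _ _ _ Cv p0 ap) eps eps0.
  exists r => // x' y' h1 h2 _; have := Hr x' y' h1 h2.
  by rewrite ltr_norml => /andP[_]; clear -v0; lra.
have [B1 B2 B3] := bq_bounds (m xi) xi (g xi) (x, y) L mxi L1.
set s := (1 + L) * (`|x - xi| + `|y - g xi|).
have s0 : 0 <= s by rewrite mulr_ge0 ?(ltW L1') // addr_ge0.
have sQ : s < Q.
  apply: lt_trans rQ; rewrite /s -mulrA ltr_pM2l //; clear -hx hy; lra.
have qxy : q (x, y) < Q.
  apply: le_lt_trans B3 _; rewrite -/s expr2.
  by apply: (le_lt_trans _ sQ); rewrite ler_piMr // (le_trans (ltW sQ)).
have := vle (x, y) (conj axy qxy); rewrite /v mulNr => hv.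
have [_ h _] := bounds (x, y) axy (ltW qxy).
have h1 : lam * ph (x, y) <= lam * (2 * s).
  rewrite ler_wpM2l ?(ltW lam0) //; apply: le_trans h _; rewrite ler_wpM2l //.
  by apply: sqrt_powR_le => //; exact: ltW (qpos _ axy).
have h2 := expR_ge1Dx (a * u (x, y)).
rewrite [leRHS](_ : _ = lam * (2 * s) / a); last by rewrite /s; ring.
rewrite ler_pdivlMr // mulrC; clear -h1 h2 hv; lra.
Qed.

(** Linear decay holds for u and for - u, the hypotheses being symmetric. It is used from the foot
    (x, g x) of the vertical through the point, whose height over the graph is comparable to the
    distance. *)
Lemma gradient_bound_above (g m : R -> R) (alpha K L x0 d S a b : R)
    (u ux uy uxx uyy : R * R -> R) :
  0 < d -> 0 < alpha <= 1 -> 0 <= K -> 1 <= L ->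
  (forall x x', `|x - x0| < d -> `|x' - x0| < d -> `|g x' - g x| <= L * `|x' - x|) ->
  (forall x, `|x - x0| < d -> `|m x| <= L) ->
  (forall x x', `|x - x0| < d -> `|x' - x0| < d ->
     `|g x' - g x - m x * (x' - x)| <= K * `|x' - x| `^ (1 + alpha)) ->
  C2fun (above g x0 d) u ux uy uxx uyy ->
  (forall p, above g x0 d p -> cont_at ux p /\ cont_at uy p) ->
  (forall p, above g x0 d p -> `|u p| <= S) -> 0 < a -> 0 <= b ->
  (forall p, above g x0 d p -> `|uxx p + uyy p| <= a * (ux p ^+ 2 + uy p ^+ 2) + b) ->
  (forall x, `|x - x0| < d -> forall e, 0 < e -> exists2 r : R, 0 < r &
     forall x' y', `|x' - x| < r -> `|y' - g x| < r -> above g x0 d (x', y') ->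
     `|u (x', y')| < e) ->
  exists C rho : R, 0 < rho /\ forall x y, above g x0 d (x, y) ->
    `|x - x0| < rho -> `|y - g x0| < rho -> `|ux (x, y)| + `|uy (x, y)| <= C.
Proof.
move=> d0 al K0 L1 hL hm hK Cu cD uS a0 b0 hLap hbd.
have [C1 [r1 [C10 r10 H1]]] : exists C rho : R, [/\ 0 <= C, 0 < rho & forall xi, `|xi - x0| < rho ->
    forall x y, above g x0 d (x, y) -> `|x - xi| < rho -> `|y - g xi| < rho ->
      u (x, y) <= C * (`|x - xi| + `|y - g xi|)].
  apply: (boundary_upper g m alpha K L x0 d S a b u ux uy uxx uyy) => //.
  - by move=> p ap; apply: le_trans (ler_norm _) (uS p ap).
  - by move=> p ap; have := hLap p ap; rewrite ler_norml => /andP[].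
  - move=> x hx e e0; have [r r0 Hr] := hbd x hx e e0; exists r => // x' y' h1 h2 h3.
    by apply: le_lt_trans (ler_norm _) (Hr x' y' h1 h2 h3).
have [C2 [r2 [C20 r20 H2]]] : exists C rho : R, [/\ 0 <= C, 0 < rho & forall xi, `|xi - x0| < rho ->
    forall x y, above g x0 d (x, y) -> `|x - xi| < rho -> `|y - g xi| < rho ->
      - u (x, y) <= C * (`|x - xi| + `|y - g xi|)].
  apply: (boundary_upper g m alpha K L x0 d S a b _ _ _ _ _ _ _ _ _ _ _ _ (C2fun_opp _ _ _ _ _ _ Cu)) => //.
  - by move=> p ap; apply: le_trans (ler_norm _) _; rewrite normrN; exact: uS.
  - by move=> p ap; have := hLap p ap; rewrite ler_norml !sqrrN -opprD lerN2 => /andP[].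
  - move=> x hx e e0; have [r r0 Hr] := hbd x hx e e0; exists r => // x' y' h1 h2 h3.
    by apply: le_lt_trans (ler_norm _) _; rewrite normrN; exact: Hr.
pose C := C1 + C2.
have C0 : 0 <= C by exact: addr_ge0.
have [k [aC kE]] : exists k : R, 0 <= k /\ k = 2048 * (a * C).
  by eexists; split; last reflexivity; have := mulr_ge0 (ltW a0) C0; clear; lra.
(* With height [d' < eta] and |u| at most [2 * C * d'], the last entry gives the smallness
   [1024 * a * (2 * C * d') <= 1]; the others keep the square in the region of linear decay. *)
pose eta : R := Num.min (Num.min (d / 4) (Num.min (r1 / 4) (r2 / 4))) (k + 1)^-1.
have aC1 : 0 < k + 1 by clear -aC; lra.
have eta0 : 0 < eta by rewrite /eta !lt_min invr_gt0 aC1 !divr_gt0.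
have etad : eta <= d / 4 by rewrite /eta !ge_min lexx.
have etar1 : eta <= r1 / 4 by rewrite /eta !ge_min lexx !orbT.
have etar2 : eta <= r2 / 4 by rewrite /eta !ge_min lexx !orbT.
have etaa : (k + 1) * eta <= 1.
  by rewrite -ler_pdivlMl // mulr1 /eta !ge_min lexx !orbT.
clearbody eta.
have L1' : 0 < 1 + L by clear -L1; lra.
(* The height [y - g x] is less than [rho + L * rho = eta]. *)
pose rho := eta / (1 + L).
have rho0 : 0 < rho by exact: divr_gt0.
have rhoE : (1 + L) * rho = eta by rewrite /rho mulrC divfK // gt_eqF.
have rhoeta : rho <= eta by rewrite -rhoE ler_peMl ?(ltW rho0) //; clear -L1; lra.
clearbody rho.
exists (128 * L * C + (b + 1) * d), rho; split=> // x y axy hx hy.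
pose d' := y - g x.
have [/= hxd /andP[gy yd]] := axy.
have d'0 : 0 < d' by rewrite subr_gt0.
have x0d : `|x0 - x0| < d by rewrite subrr normr0.
have d'eta : d' < eta.
  have := hL x0 x x0d hxd; have := ler_norm (y - g x0); rewrite ler_norml => h /andP[h1 _].
  have : L * `|x - x0| <= L * rho by rewrite ler_wpM2l ?(ltW hx) //; clear -L1; lra.
  by rewrite /d'; clear -h h1 hy rhoE; lra.
(* Over this square the graph rises by at most [d' / 4] and the lower side drops by at most
   [d' / 4], so the square stays above the graph. *)
pose h := d' / (4 * L).
have L4 : 0 < 4 * L by clear -L1; lra.
have h0 : 0 < h by exact: divr_gt0.
have hE : 4 * (L * h) = d' by rewrite mulrA mulrC /h divfK // gt_eqF.
have hd' : h <= d' / 4.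
  have : 1 * h <= L * h by rewrite ler_wpM2r // ltW.
  by clear -hE; lra.
clearbody h.
have sq x' y' : `|x' - x| <= h -> `|y' - y| <= h ->
    above g x0 d (x', y') /\ `|u (x', y')| <= 2 * C * d'.
  move=> k1 k2.
  have k3 : `|x' - x0| < d by have := ler_distD x x' x0; clear -k1 hx hd' d'eta rhoeta etad d0; lra.
  have k4 : above g x0 d (x', y').
    split=> //=; have := hL x x' hxd k3.
    have : L * `|x' - x| <= L * h by rewrite ler_wpM2l //; clear -L1; lra.
    have [k21 k22] := andP (eq_ind _ is_true k2 _ (ler_norml _ _)).
    rewrite ler_norml => k5 /andP[_ k6].
    apply/andP; split; first by clear -k5 k6 k21 hE hd' d'0; rewrite /d' in hE hd' d'0; lra.
    have := ler_norm (y - g x0); clear -k22 hy hd' d'eta rhoeta etad eta0; lra.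
  split=> //.
  have y1 : `|y' - g x| <= h + d'.
    by have := ler_distD y y' (g x); rewrite (gtr0_norm d'0); clear -k2; lra.
  have xr1 : `|x - x0| < r1 by clear -hx rhoeta etar1 eta0; lra.
  have xr2 : `|x - x0| < r2 by clear -hx rhoeta etar2 eta0; lra.
  have a1 := H1 x xr1 x' y' k4 ltac:(clear -k1 hd' d'eta etar1 eta0; lra) ltac:(clear -y1 hd' d'eta etar1 eta0; lra).
  have a2 := H2 x xr2 x' y' k4 ltac:(clear -k1 hd' d'eta etar2 eta0; lra) ltac:(clear -y1 hd' d'eta etar2 eta0; lra).
  set s := `|x' - x| + `|y' - g x| in a1 a2.
  have sd : s <= 2 * d' by rewrite /s; clear -k1 y1 hd' d'0; lra.
  have s0 : 0 <= s by rewrite addr_ge0.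
  have b1 : C1 * s <= C * (2 * d') by apply: ler_pM => //; rewrite lerDl.
  have b2 : C2 * s <= C * (2 * d') by apply: ler_pM => //; rewrite lerDr.
  by rewrite ler_norml; apply/andP; split; clear -a1 a2 b1 b2; lra.
have S1 : 1024 * a * (2 * C * d') <= 1.
  have -> : 1024 * a * (2 * C * d') = k * d' by rewrite kE; ring.
  have : k * d' <= k * eta by rewrite ler_wpM2l // ltW.
  by clear -etaa eta0; lra.
have b1 : 0 <= b + 1 by clear -b0; lra.
apply: le_trans (interior_gradient _ _ _ _ _ _ x y h _ a (b + 1) Cu cD h0 a0 b1 S1 sq _) _.
  by move=> p ap; apply: le_lt_trans (hLap p ap) _; rewrite ltrD2l ltrDl.
have -> : (16 * (2 * C * d') + (b + 1) * h ^+ 2) / h = 128 * L * C + (b + 1) * h.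
  by rewrite -hE; field; rewrite gt_eqF.
rewrite lerD2l ler_wpM2l //; clear -hd' d'eta etad eta0 d0; lra.
Qed.
End BoundaryDecay.

(** * Curves and graphs *)

Section Curves.
Context {R : realType}.
Implicit Types (p : R * R) (x y e l s t : R).

Definition unit_itv : set R := `[0, 1]%classic.

Lemma unit_itvP t : unit_itv t <-> 0 <= t <= 1.
Proof. by rewrite /unit_itv /= in_itv. Qed.

Definition rderiv (f f' : R -> R) := forall t, unit_itv t -> forall e, 0 < e ->
  exists2 d : R, 0 < d & forall s, unit_itv s -> `|s - t| < d ->
    `|f s - f t - f' t * (s - t)| <= e * `|s - t|.

Lemma rderiv_of_cvg (f f' : R -> R) :
  (forall t, unit_itv t ->
    (s - t)^-1 * (f s - f t) @[s --> within (unit_itv `\ t) (nbhs t)] --> f' t) ->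
  rderiv f f'.
Proof.
move=> H t It e e0; have /cvgrPdist_le /(_ e e0) := H t It.
rewrite near_withinE => /nbhs_ballP[d /= d0 Hd].
exists d => // s Is sd; have [->|st] := eqVneq s t; first by rewrite !subrr mulr0 subrr !normr0 mulr0.
have /Hd /(_ (conj Is (elimN eqP st))) : ball t d s by rewrite /ball /= distrC.
have st0 : s - t != 0 by rewrite subr_eq0.
have -> : f s - f t - f' t * (s - t) = - (f' t - (s - t)^-1 * (f s - f t)) * (s - t).
  by rewrite opprB mulrBl mulrAC mulVf // mul1r.
by rewrite normrM normrN => Hle; rewrite ler_pM2r // normr_gt0.
Qed.

Lemma has_derivative_in_rderiv (g g' : R -> R * R) : has_derivative_in unit_itv g g' ->
  rderiv (fun t => (g t).1) (fun t => (g' t).1) /\ rderiv (fun t => (g t).2) (fun t => (g' t).2).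
Proof.
move=> H; split; apply: rderiv_of_cvg => t It.
  exact: (cvg_comp _ _ (H t It) (@cvg_fst _ _ (nbhs (g' t).1) (nbhs (g' t).2) _)).
exact: (cvg_comp _ _ (H t It) (@cvg_snd _ _ (nbhs (g' t).1) (nbhs (g' t).2) _)).
Qed.

(** [jordan_arc] supplies two derivatives by separate existentials, one of the required regularity
    and one without zeros; uniqueness identifies them, including at the endpoints. *)
Lemma rderiv_unique (f f1 f2 : R -> R) : rderiv f f1 -> rderiv f f2 ->
  forall t, unit_itv t -> f1 t = f2 t.
Proof.
move=> H1 H2 t It; apply/eqP; rewrite -subr_eq0 -normr_le0; apply/ler_addgt0Pr => e e0; rewrite add0r.
have e2 : 0 < e / 2 by rewrite divr_gt0.
have [d1 d10 K1] := H1 t It _ e2; have [d2 d20 K2] := H2 t It _ e2.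
have /unit_itvP/andP[t0 t1] := It.
have [s [Is sn sd1 sd2]] : exists s : R, [/\ unit_itv s, s - t != 0, `|s - t| < d1 & `|s - t| < d2].
  pose r : R := Num.min (Num.min d1 d2) 1 / 2.
  have m0 : 0 < Num.min (Num.min d1 d2) 1 by rewrite !lt_min d10 d20 ltr01.
  have m1 : Num.min (Num.min d1 d2) 1 <= d1 by rewrite !ge_min lexx.
  have m2 : Num.min (Num.min d1 d2) 1 <= d2 by rewrite !ge_min lexx !orbT.
  have m3 : Num.min (Num.min d1 d2) 1 <= 1 by rewrite !ge_min lexx !orbT.
  have [r0 r1 r2 r3] : [/\ 0 < r, r < d1, r < d2 & r <= 2^-1] by rewrite /r; clear -m0 m1 m2 m3; split; lra.
  clearbody r.
  have [tl|tr] := leP t 2^-1.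
    exists (t + r); have -> : t + r - t = r by ring.
    rewrite gt_eqF // gtr0_norm //; split=> //; apply/unit_itvP; clear -t0 tl r0 r3; apply/andP; split; lra.
  exists (t - r); have -> : t - r - t = - r by ring.
  rewrite oppr_eq0 normrN gt_eqF // gtr0_norm //; split=> //.
  apply/unit_itvP; clear -t1 tr r0 r3; apply/andP; split; lra.
have := lerD (K1 s Is sd1) (K2 s Is sd2); rewrite (distrC (f s - f t) (f2 t * _)).
move=> /(le_trans (ler_normD _ _)).
have -> : f s - f t - f1 t * (s - t) + (f2 t * (s - t) - (f s - f t)) = - (f1 t - f2 t) * (s - t) by ring.
rewrite normrM normrN -mulrDl ler_pM2r ?normr_gt0 // => h.
by apply: le_trans h _; clear; lra.
Qed.

Definition clamp (t : R) : R := Num.max 0 (Num.min 1 t).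

Lemma clamp_itv t : unit_itv (clamp t).
Proof.
by apply/unit_itvP; rewrite /clamp le_max lexx /= ge_max ler01 /= ge_min lexx.
Qed.

Lemma clamp_id t : unit_itv t -> clamp t = t.
Proof.
by move=> /unit_itvP/andP[t0 t1]; rewrite /clamp (min_idPr t1) (max_idPr t0).
Qed.

Lemma clamp_le0 t : t <= 0 -> clamp t = 0.
Proof.
move=> t0; rewrite /clamp (min_idPr _); last by apply: le_trans t0 ler01.
exact/max_idPl.
Qed.

Lemma clamp_ge1 t : 1 <= t -> clamp t = 1.
Proof. by move=> t1; rewrite /clamp (min_idPl t1); apply/max_idPr; exact: ler01. Qed.

Lemma clamp_dist s t : `|clamp s - clamp t| <= `|s - t|.
Proof.
wlog st : s t / s <= t => [H|].
  by have [/H//|/ltW/H] := leP s t; rewrite distrC (distrC t).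
rewrite !(distrC s) (distrC (clamp s)) !ger0_norm ?subr_ge0 //; last first.
  have h : Num.min 1 s <= Num.min 1 t by rewrite le_min !ge_min lexx st orbT.
  by rewrite /clamp ge_max !le_max lexx h orbT.
have [s0|s0] := leP s 0; have [t1|t1] := leP 1 t.
- by rewrite (clamp_le0 s) // (clamp_ge1 t) //; clear -s0 t1; lra.
- rewrite (clamp_le0 s) //; have [t0|t0] := leP t 0.
    by rewrite (clamp_le0 t) //; clear -st; lra.
  rewrite clamp_id; first by clear -s0; lra.
  by apply/unit_itvP; rewrite !ltW.
- have [s1|s1] := leP 1 s.
    by rewrite !clamp_ge1 //; clear -st; lra.
  rewrite clamp_ge1 // clamp_id; first by clear -t1; lra.
  by apply/unit_itvP; rewrite !ltW.
- have [Is It] : unit_itv s /\ unit_itv t.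
    by split; apply/unit_itvP; clear -s0 t1 st; apply/andP; split; lra.
  by rewrite !clamp_id.
Qed.

(* With k = f'' (resp. k = 0) this continues a C^2 (resp. C^1) function f on [0, 1] to the
   line, and its derivative is a function of the same form. *)
Definition taylor_ext (f f' k : R -> R) (t : R) : R :=
  f (clamp t) + f' (clamp t) * (t - clamp t) + k (clamp t) / 2 * (t - clamp t) ^+ 2.

Lemma taylor_ext_id f f' k t : unit_itv t -> taylor_ext f f' k t = f t.
Proof. by move=> It; rewrite /taylor_ext clamp_id // subrr expr0n /= !mulr0 !addr0. Qed.

(** For [s] near [t], either both lie in [0, 1] and the hypothesis applies, or [clamp s = clamp t]
    and the function is a polynomial there. At an endpoint both cases occur, one on each side. *)
Lemma is_derive_taylor_ext (f f' k : R -> R) t : rderiv f f' ->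
  is_derive t 1 (taylor_ext f f' k) (taylor_ext f' k (fun=> 0) t).
Proof.
move=> Hf; apply/is_deriveP => e e0.
have K0 : 0 < `|k (clamp t)| + 1 by rewrite ltr_wpDl.
have near_eq (r : R) : 0 < r -> (forall s, `|s - t| < r -> clamp s = clamp t \/ (unit_itv s /\ unit_itv t)) ->
    exists2 d : R, 0 < d & forall s, `|s - t| < d ->
      `|taylor_ext f f' k s - taylor_ext f f' k t - taylor_ext f' k (fun=> 0) t * (s - t)| <= e * `|s - t|.
  move=> r0 Hr.
  have [d1 d10 H1] : exists2 d : R, 0 < d & forall s, unit_itv t -> unit_itv s -> `|s - t| < d ->
      `|f s - f t - f' t * (s - t)| <= e * `|s - t|.
    have [It|nIt] := pselect (unit_itv t); last by exists 1.
    by have [d d0 Hd] := Hf t It e e0; exists d => // s _; exact: Hd.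
  exists (Num.min r (Num.min d1 (e / (`|k (clamp t)| + 1)))).
    by rewrite !lt_min r0 d10 divr_gt0.
  move=> s; rewrite !lt_min => /andP[sr /andP[sd1 sk]].
  have [E|[Is It]] := Hr s sr; last by rewrite !taylor_ext_id //; exact: H1.
  rewrite /taylor_ext E.
  have -> : f (clamp t) + f' (clamp t) * (s - clamp t) + k (clamp t) / 2 * (s - clamp t) ^+ 2
     - (f (clamp t) + f' (clamp t) * (t - clamp t) + k (clamp t) / 2 * (t - clamp t) ^+ 2)
     - (f' (clamp t) + k (clamp t) * (t - clamp t) + 0 / 2 * (t - clamp t) ^+ 2) * (s - t)
     = k (clamp t) / 2 * (s - t) * (s - t) by field.
  rewrite 2!normrM; apply: ler_wpM2r => //; move: sk; rewrite ltr_pdivlMr // => sk.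
  rewrite normrM (gtr0_norm (_ : 0 < 2^-1)) ?invr_gt0 //.
  have := mulr_ge0 (normr_ge0 (k (clamp t))) (normr_ge0 (s - t)).
  by have := normr_ge0 (s - t); clear -sk; lra.
have aux (s r : R) : `|s - t| < r -> t - r < s /\ s < t + r.
  by rewrite ltr_distl => /andP[].
have [t0|t0|t0] := ltgtP t 0; last first.
- apply: (near_eq 1) => // s /aux[_ s1]; rewrite t0 add0r in s1 *.
  have [s0|s0] := leP s 0; first by left; rewrite !clamp_le0.
  by right; split; apply/unit_itvP; rewrite ?lexx ?ler01 // !ltW.
- have [t1|t1|t1] := ltgtP t 1; last first.
  + apply: (near_eq 1) => // s /aux[s1 _]; rewrite t1 subrr in s1 *.
    have [s0|s0] := leP 1 s; first by left; rewrite !clamp_ge1.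
    by right; split; apply/unit_itvP; rewrite ?lexx ?ler01 // !ltW.
  + apply: (near_eq (t - 1)); rewrite ?subr_gt0 // => s /aux[s1 _].
    by left; rewrite !clamp_ge1 ?(ltW t1) //; clear -s1; lra.
  + apply: (near_eq (Num.min t (1 - t))); first by rewrite lt_min t0 subr_gt0.
    move=> s; rewrite lt_min => /andP[/aux[s1 _] /aux[_ s2]]; right.
    by split; apply/unit_itvP; clear -s1 s2 t0 t1; apply/andP; split; lra.
- apply: (near_eq (- t)); rewrite ?oppr_gt0 // => s /aux[_ s1].
  by left; rewrite !clamp_le0 ?(ltW t0) //; clear -s1; lra.
Qed.

Lemma is_derive_continuous (f : R -> R) x l : is_derive x 1 f l -> {for x, continuous f}.
Proof. by move=> [df _]; apply/differentiable_continuous/derivable1_diffP. Qed.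

Lemma mean_value_lt (f f' : R -> R) (a b : R) : a < b ->
  (forall t, a <= t <= b -> is_derive t 1 f (f' t)) ->
  exists c, a <= c <= b /\ f b - f a = f' c * (b - a).
Proof.
move=> ab Df.
have [||c] := @MVT R f f' a b ab.
- by move=> x; rewrite in_itv /= => /andP[x1 x2]; apply: Df; rewrite !ltW.
- apply: continuous_in_subspaceT => c; rewrite inE /= in_itv /= => hc.
  exact: is_derive_continuous (Df c hc).
by rewrite in_itv /= => /andP[c1 c2] E; exists c; split=> //; rewrite !ltW.
Qed.

Lemma mean_value (f f' : R -> R) (t0 r a b : R) :
  (forall t, `|t - t0| <= r -> is_derive t 1 f (f' t)) -> `|a - t0| <= r -> `|b - t0| <= r ->
  exists c, [/\ `|c - t0| <= r, `|c - a| <= `|b - a| & f b - f a = f' c * (b - a)].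
Proof.
move=> Df ha hb.
have inr c : Num.min a b <= c <= Num.max a b -> `|c - t0| <= r.
  move: ha hb; rewrite !ler_distl ge_min le_max => /andP[? ?] /andP[? ?] /andP[/orP h1 /orP h2].
  by apply/andP; case: h1 => ?; case: h2 => ?; split; lra.
have [ab|ba|->] := ltgtP a b; last by exists b; split=> //; rewrite ?subrr ?mulr0.
- have [|c [/andP[c1 c2] E]] := mean_value_lt f f' a b ab.
    by move=> t /andP[? ?]; apply/Df/inr; rewrite ge_min le_max; apply/andP; split; apply/orP; [left|right].
  exists c; split=> //; first by apply: inr; rewrite ge_min le_max c1 c2 orbT.
  by rewrite !ger0_norm ?subr_ge0 ?(ltW ab) //; clear -c2; lra.
- have [|c [/andP[c1 c2] E]] := mean_value_lt f f' b a ba.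
    by move=> t /andP[? ?]; apply/Df/inr; rewrite ge_min le_max; apply/andP; split; apply/orP; [right|left].
  exists c; split=> //; first by apply: inr; rewrite ge_min le_max c1 c2 orbT.
    by rewrite (distrC c) (distrC b) !ger0_norm ?subr_ge0 ?(ltW ba) //; clear -c1; lra.
  by rewrite -opprB E; ring.
Qed.

(** [X'] stays within [|X' t0| / 2] of [X' t0], so the mean value theorem makes X expanding with
    factor [kappa = |X' t0| / 2], and the intermediate value theorem covers an interval of radius
    [kappa * (eta / 2)]. *)
Lemma local_inverse (X X' : R -> R) (t0 eta0 : R) : (forall t, is_derive t 1 X (X' t)) ->
  {for t0, continuous X'} -> X' t0 != 0 -> 0 < eta0 ->
  exists eta kappa d T, [/\ [/\ 0 < eta, eta <= eta0, 0 < kappa & 0 < d],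
    forall t, `|t - t0| <= eta -> kappa <= `|X' t|,
    forall s t, `|s - t0| <= eta -> `|t - t0| <= eta -> kappa * `|s - t| <= `|X s - X t|,
    forall x, `|x - X t0| < d -> `|T x - t0| < eta /\ X (T x) = x &
    forall t, `|t - t0| <= eta -> `|X t - X t0| < d -> T (X t) = t].
Proof.
move=> DX cX' X0 eta00.
have k2 : 0 < `|X' t0| / 2 by rewrite divr_gt0 // normr_gt0.
have /cvgrPdist_lt /(_ _ k2) /nbhs_ballP[r /= r0 Hr] := cX'.
pose eta : R := Num.min (r / 2) eta0.
have eta0' : 0 < eta by rewrite /eta lt_min divr_gt0.
have etar : eta <= r / 2 by rewrite /eta ge_min lexx.
have X'near t : `|t - t0| <= eta -> `|X' t0 - X' t| < `|X' t0| / 2.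
  by move=> h; apply: Hr; rewrite /ball /= distrC; lra.
have X'k t : `|t - t0| <= eta -> `|X' t0| / 2 <= `|X' t|.
  by move=> /X'near h; have := ler_distD (X' t) (X' t0) 0; rewrite !subr0; lra.
have bil s t : `|s - t0| <= eta -> `|t - t0| <= eta -> `|X' t0| / 2 * `|s - t| <= `|X s - X t|.
  move=> hs ht; have [c [c1 _ ->]] := mean_value X X' t0 eta t s (fun t _ => DX t) ht hs.
  by rewrite normrM ler_wpM2r // X'k.
have inj s t : `|s - t0| <= eta -> `|t - t0| <= eta -> X s = X t -> s = t.
  move=> hs ht E; apply/eqP; rewrite -subr_eq0 -normr_le0.
  by have := bil s t hs ht; rewrite E subrr normr0 pmulr_rle0.
have d0 : 0 < `|X' t0| / 2 * (eta / 2) by rewrite mulr_gt0 // divr_gt0.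
have surj x : `|x - X t0| < `|X' t0| / 2 * (eta / 2) -> exists t, `|t - t0| < eta /\ X t = x.
  move=> hx.
  have h2 : `|t0 - (eta / 2) - t0| <= eta by rewrite addrAC subrr add0r normrN gtr0_norm ?divr_gt0 //; lra.
  have h3 : `|t0 + (eta / 2) - t0| <= eta by rewrite addrAC subrr add0r gtr0_norm ?divr_gt0 //; lra.
  have h0 : `|t0 - t0| <= eta by rewrite subrr normr0 ltW.
  have [c [c1 _ E1]] := mean_value X X' t0 eta t0 (t0 + eta / 2) (fun t _ => DX t) h0 h3.
  have [c' [c1' _ E2]] := mean_value X X' t0 eta t0 (t0 - eta / 2) (fun t _ => DX t) h0 h2.
  have le1 : t0 - eta / 2 <= t0 + eta / 2 by lra.
  have [||t] := @IVT R X (t0 - eta / 2) (t0 + eta / 2) x le1.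
  - apply: continuous_in_subspaceT => y _; exact: is_derive_continuous (DX y).
  - have := X'near c c1; have := X'near c' c1'.
    have e1 : X (t0 + eta / 2) = X t0 + X' c * (eta / 2) by rewrite -[LHS](subrK (X t0)) E1; ring.
    have e2 : X (t0 - eta / 2) = X t0 - X' c' * (eta / 2) by rewrite -[LHS](subrK (X t0)) E2; ring.
    rewrite e1 e2 !ltr_distl ge_min le_max => /andP[a1 a2] /andP[a3 a4].
    move: hx; rewrite ltr_distl => /andP[b1 b2].
    have e20 : 0 <= eta / 2 by rewrite divr_ge0 // ltW.
    have [Xp|Xn] := ltP 0 (X' t0).
      rewrite (gtr0_norm Xp) in a1 a2 a3 a4 b1 b2.
      have : X' t0 / 2 * (eta / 2) <= X' c * (eta / 2) by apply: ler_wpM2r => //; lra.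
      have : X' t0 / 2 * (eta / 2) <= X' c' * (eta / 2) by apply: ler_wpM2r => //; lra.
      by clear -b1 b2 => u1 u2; apply/andP; split; apply/orP; [left|right]; lra.
    rewrite (ler0_norm Xn) in a1 a2 a3 a4 b1 b2.
    have : X' c * (eta / 2) <= X' t0 / 2 * (eta / 2) by apply: ler_wpM2r => //; lra.
    have : X' c' * (eta / 2) <= X' t0 / 2 * (eta / 2) by apply: ler_wpM2r => //; lra.
    by clear -b1 b2 => u1 u2; apply/andP; split; apply/orP; [right|left]; lra.
  - rewrite in_itv /= => /andP[t1 t2] Xt; exists t; split=> //.
    by rewrite ltr_distl; apply/andP; split; lra.
(* The default [t0] is only taken outside the interval on which the inverse is used. *)
pose T x := xget t0 [set t | `|t - t0| < eta /\ X t = x].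
have TP x : `|x - X t0| < `|X' t0| / 2 * (eta / 2) -> `|T x - t0| < eta /\ X (T x) = x.
  by move=> /surj[t Ht]; rewrite /T; case: xgetP => [y -> //|/(_ t)].
exists eta, (`|X' t0| / 2), (`|X' t0| / 2 * (eta / 2)), T; split=> //.
  by split=> //; rewrite /eta ge_min lexx orbT.
move=> t ht hx; have [h1 h2] := TP _ hx.
by apply: inj => //; exact: ltW.
Qed.

(** With [g = Y \o T] and [m = Y' / X'] along [T], the Taylor remainder of g is that of Y minus [m]
    times that of X, both between [T x] and [T x']. This gives the order [1 + alpha] directly,
    without differentiating the inverse. *)
Lemma holder_graph (X X' Y Y' : R -> R) (t0 eta0 alpha K : R) :
  (forall t, is_derive t 1 X (X' t)) -> (forall t, is_derive t 1 Y (Y' t)) ->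
  0 < alpha -> 0 <= K ->
  (forall s t, `|X' s - X' t| <= K * `|s - t| `^ alpha) ->
  (forall s t, `|Y' s - Y' t| <= K * `|s - t| `^ alpha) ->
  X' t0 != 0 -> 0 < eta0 ->
  exists (eta d : R) (g m : R -> R) (K' L : R), [/\ [/\ 0 < eta, eta <= eta0, 0 < d, 0 <= K' & 1 <= L],
    forall x x', `|x - X t0| < d -> `|x' - X t0| < d -> `|g x' - g x| <= L * `|x' - x|,
    forall x, `|x - X t0| < d -> `|m x| <= L,
    forall x x', `|x - X t0| < d -> `|x' - X t0| < d ->
       `|g x' - g x - m x * (x' - x)| <= K' * `|x' - x| `^ (1 + alpha) &
    (forall x, `|x - X t0| < d -> exists t, [/\ `|t - t0| < eta, X t = x & Y t = g x]) /\
    (forall t, `|t - t0| <= eta -> `|X t - X t0| < d -> Y t = g (X t))].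
Proof.
move=> DX DY al0 K0 HX HY X0 eta00.
have cX' : {for t0, continuous X'}.
  apply/cvgrPdist_le => e e0.
  have K1 : 0 < K + 1 by rewrite ltr_wpDl.
  have eK : 0 < e / (K + 1) by rewrite divr_gt0.
  apply/nbhs_ballP; exists ((e / (K + 1)) `^ alpha^-1); first by rewrite /= powR_gt0.
  move=> t; rewrite /ball /= => ht; apply: le_trans (HX _ _) _.
  have : `|t0 - t| `^ alpha <= e / (K + 1).
    have <- : ((e / (K + 1)) `^ alpha^-1) `^ alpha = e / (K + 1).
      by rewrite -powRrM mulVf ?gt_eqF // powRr1 // ltW.
    by apply: ge0_ler_powR; rewrite ?nnegrE ?powR_ge0 ?(ltW al0) // ltW.
  rewrite ler_pdivlMr // => h; apply: le_trans h.
  by rewrite mulrDr mulr1 mulrC lerDl powR_ge0.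
have [eta [kappa [d [T [[eta0' etale k0 d0] X'k bil TP TK]]]]] := local_inverse X X' t0 eta0 DX cX' X0 eta00.
pose B := `|Y' t0| + K * eta `^ alpha.
have B0 : 0 <= B by rewrite addr_ge0 // mulr_ge0 // powR_ge0.
have Y'B t : `|t - t0| <= eta -> `|Y' t| <= B.
  move=> ht; have : `|t - t0| `^ alpha <= eta `^ alpha.
    by apply: ge0_ler_powR; rewrite ?nnegrE // ltW.
  move=> /(ler_wpM2l K0); have := HY t t0; have := ler_distD (Y' t0) (Y' t) 0.
  by rewrite !subr0 /B; clear; lra.
have taylor (f f' : R -> R) : (forall t, is_derive t 1 f (f' t)) ->
    (forall s t, `|f' s - f' t| <= K * `|s - t| `^ alpha) ->
    forall s t, `|s - t0| <= eta -> `|t - t0| <= eta ->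
    `|f s - f t - f' t * (s - t)| <= K * `|s - t| `^ (1 + alpha).
  move=> Df Hf s t hs ht.
  have [c [_ c2 ->]] := mean_value f f' t0 eta t s (fun t _ => Df t) ht hs.
  have [->|st] := eqVneq s t; first by rewrite subrr !mulr0 subrr !normr0 mulr_ge0 // powR_ge0.
  rewrite -mulrBl normrM powRD; last by apply/implyP => _; rewrite normr_eq0 subr_eq0.
  rewrite powRr1 // (mulrC `|s - t|) mulrA ler_wpM2r //.
  apply: le_trans (Hf c t) _; rewrite ler_wpM2l //.
  by apply: ge0_ler_powR; rewrite ?nnegrE // ltW.
pose L := B / kappa + 1.
have Bk : 0 <= B / kappa by rewrite divr_ge0 // ltW.
pose m x := Y' (T x) / X' (T x).
have mB x : `|x - X t0| < d -> `|m x| <= B / kappa.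
  move=> /TP[/ltW h1 h2]; rewrite /m normrM normfV.
  by apply: ler_pM; rewrite ?invr_ge0 ?Y'B // lef_pV2 ?posrE ?X'k // (lt_le_trans k0) // X'k.
have TL x x' : `|x - X t0| < d -> `|x' - X t0| < d -> `|T x' - T x| <= `|x' - x| / kappa.
  move=> /TP[/ltW h1 h2] /TP[/ltW h1' h2'].
  by rewrite ler_pdivlMr // mulrC -{2}h2 -{2}h2' bil.
exists eta, d, (Y \o T), m, ((1 + B / kappa) * K * kappa^-1 `^ (1 + alpha)), L; split.
- by split=> //; rewrite ?mulr_ge0 ?powR_ge0 ?addr_ge0 // /L lerDr.
- move=> x x' hx hx'; have [/ltW h1 h2] := TP _ hx; have [/ltW h1' h2'] := TP _ hx'.
  have [c [c1 _ E]] := mean_value Y Y' t0 eta (T x) (T x') (fun t _ => DY t) h1 h1'.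
  rewrite /= E normrM; apply: (@le_trans _ _ (B * (`|x' - x| / kappa))).
    by apply: ler_pM; rewrite ?Y'B ?TL.
  have -> : B * (`|x' - x| / kappa) = B / kappa * `|x' - x| by ring.
  by rewrite ler_wpM2r // /L lerDl.
- by move=> x hx; apply: le_trans (mB x hx) _; rewrite /L lerDl.
- move=> x x' hx hx'; have [/ltW h1 h2] := TP _ hx; have [/ltW h1' h2'] := TP _ hx'.
  have X'n : X' (T x) != 0 by rewrite -normr_gt0 (lt_le_trans k0) // X'k.
  have -> : (Y \o T) x' - (Y \o T) x - m x * (x' - x) =
     (Y (T x') - Y (T x) - Y' (T x) * (T x' - T x))
     - m x * (X (T x') - X (T x) - X' (T x) * (T x' - T x)).
    by rewrite h2 h2' /m /=; field.
  have t1 := taylor _ _ DY HY _ _ h1' h1; have t2 := taylor _ _ DX HX _ _ h1' h1.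
  have tp : `|T x' - T x| `^ (1 + alpha) <= kappa^-1 `^ (1 + alpha) * `|x' - x| `^ (1 + alpha).
    rewrite -powRM ?invr_ge0 ?(ltW k0) // (mulrC kappa^-1).
    by apply: ge0_ler_powR; rewrite ?nnegrE ?divr_ge0 ?(ltW k0) ?TL // addr_ge0 // ltW.
  apply: le_trans (ler_normB _ _) _; rewrite normrM.
  apply: (@le_trans _ _ ((1 + B / kappa) * (K * `|T x' - T x| `^ (1 + alpha)))).
    by rewrite mulrDl mul1r lerD // ler_pM // mB.
  rewrite -!mulrA ler_wpM2l ?addr_ge0 // ler_wpM2l //.
- split=> [x hx|t ht hX]; last by rewrite /= TK.
  by have [h1 h2] := TP _ hx; exists (T x).
Qed.

Lemma derV (f : R -> R) x l : f x != 0 -> is_derive x 1 f l ->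
  is_derive x 1 (fun t => (f t)^-1) (- l / f x ^+ 2).
Proof.
move=> f0 Df; apply: der_eq (is_deriveV f0 Df) _.
by rewrite /GRing.scale /= mulrC mulrN mulNr.
Qed.

(** Here the inverse is differentiated: g' is Y' / X' at [T x]. The bounds on g' and g'', which
    follow from [kappa <= |X'|], later become coefficients in the Laplacian of v - g(u). *)
Lemma C2_graph (X X' X'' Y Y' Y'' : R -> R) (t0 B : R) :
  (forall t, is_derive t 1 X (X' t)) -> (forall t, is_derive t 1 X' (X'' t)) ->
  (forall t, is_derive t 1 Y (Y' t)) -> (forall t, is_derive t 1 Y' (Y'' t)) ->
  (forall t, `|X'' t| <= B) -> (forall t, `|Y'' t| <= B) -> X' t0 != 0 ->
  exists (eta d : R) (g g' g'' : R -> R) (B' : R), [/\ 0 < eta, 0 < d,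
    forall x, `|x - X t0| < d ->
      [/\ is_derive x 1 g (g' x), is_derive x 1 g' (g'' x), `|g' x| <= B' & `|g'' x| <= B'] &
    forall t, `|t - t0| <= eta -> `|X t - X t0| < d -> Y t = g (X t)].
Proof.
move=> DX DX' DY DY' BX BY X0.
have [eta [kappa [d [T [[eta0 eta1 k0 d0] X'k bil TP TK]]]]] :=
  local_inverse X X' t0 1 DX (is_derive_continuous _ _ _ (DX' t0)) X0 ltr01.
have B0 : 0 <= B by apply: le_trans (BX 0).
have bd (f f' : R -> R) t : (forall t, is_derive t 1 f (f' t)) -> (forall t, `|f' t| <= B) ->
    `|t - t0| <= eta -> `|f t| <= `|f t0| + B.
  move=> Df Bf ht; have h0 : `|t0 - t0| <= eta by rewrite subrr normr0 ltW.
  have [c [_ _ E]] := mean_value f f' t0 eta t0 t (fun t _ => Df t) h0 ht.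
  have := ler_distD (f t0) (f t) 0; rewrite !subr0 E normrM => /le_trans; apply.
  rewrite addrC lerD2l -[leRHS]mulr1; apply: ler_pM => //.
  exact: le_trans eta1.
have X'n t : `|t - t0| <= eta -> X' t != 0.
  by move=> ht; rewrite -normr_gt0 (lt_le_trans k0) // X'k.
have DT x : `|x - X t0| < d -> is_derive x 1 T (X' (T x))^-1.
  move=> hx; have [h1 h2] := TP x hx.
  rewrite -{1}h2; apply: is_derive_inverse (DX (T x)) (X'n _ (ltW h1)).
    have cX := is_derive_continuous _ _ _ (DX (T x)).
    have e0 : 0 < d - `|x - X t0| by rewrite subr_gt0.
    have n1 : \forall s \near T x, `|X s - x| < d - `|x - X t0|.
      by have /cvgrPdist_lt /(_ _ e0) := cX; rewrite h2; apply: filterS => s; rewrite distrC.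
    have e1 : 0 < eta - `|T x - t0| by rewrite subr_gt0.
    have n2 : \forall s \near T x, `|s - T x| < eta - `|T x - t0|.
      by apply/nbhs_ballP; exists (eta - `|T x - t0|) => // s; rewrite /ball /= distrC.
    apply: filterS2 n1 n2 => s s1 s2; apply: TK.
      by have := ler_distD (T x) s t0; clear -s2; lra.
    by have := ler_distD x (X s) (X t0); clear -s1; lra.
  by apply/nbhs_ballP; exists 1 => //= s _; exact: is_derive_continuous (DX s).
pose q t := (Y'' t * X' t - Y' t * X'' t) / X' t ^+ 2.
have Dq t : `|t - t0| <= eta -> is_derive t 1 (fun t => Y' t * (X' t)^-1) (q t).
  move=> ht; have n := X'n t ht.
  have e1 := derV _ _ _ n (DX' t); have e2 := DY' t.
  by der_by ltac:(rewrite /q; field).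
pose BY' := `|Y' t0| + B; pose BX' := `|X' t0| + B.
have BY'0 : 0 <= BY' by rewrite addr_ge0.
have BX'0 : 0 <= BX' by rewrite addr_ge0.
pose B1 := BY' / kappa.
pose B2 := (B * BX' + BY' * B) / kappa ^+ 2 / kappa.
have B10 : 0 <= B1 by rewrite divr_ge0 // ltW.
have B20 : 0 <= B2.
  by rewrite !divr_ge0 ?(ltW k0) ?exprn_ge0 ?(ltW k0) // addr_ge0 // mulr_ge0.
exists eta, d, (fun x => Y (T x)), (fun x => Y' (T x) * (X' (T x))^-1),
  (fun x => q (T x) * (X' (T x))^-1), (B1 + B2); split=> //; last first.
  by move=> t ht hX; rewrite TK.
move=> x hx; have [/ltW h1 h2] := TP x hx; have D1 := DT x hx.
have V0 : `|(X' (T x))^-1| <= kappa^-1.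
  by rewrite normfV lef_pV2 ?posrE ?X'k // (lt_le_trans k0) // X'k.
split.
- exact: (@der_comp R Y T x _ _ (DY _) D1).
- exact: (@der_comp R (fun t => Y' t * (X' t)^-1) T x _ _ (Dq _ h1) D1).
- apply: (@le_trans _ _ B1); last by rewrite lerDl.
  by rewrite normrM; apply: ler_pM => //; exact: bd h1.
- apply: (@le_trans _ _ B2); last by rewrite lerDr.
  rewrite normrM; apply: ler_pM => //.
  rewrite /q normrM; apply: ler_pM => //; last first.
    rewrite normfV normrX lef_pV2 ?posrE ?exprn_gt0 // ?(lt_le_trans k0) ?X'k //.
    by rewrite lerXn2r ?nnegrE ?(ltW k0) // X'k.
  apply: le_trans (ler_normB _ _) _; rewrite !normrM; apply: lerD; apply: ler_pM => //.
    exact: bd h1.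
  exact: bd h1.
Qed.

Lemma segment_separation (X Y : R -> R) (t0 a b : R) :
  (forall t, {for t, continuous X}) -> (forall t, {for t, continuous Y}) ->
  (forall t, a <= t <= b -> X t = X t0 -> Y t = Y t0 -> False) ->
  exists2 e : R, 0 < e & forall t, a <= t <= b -> `|X t - X t0| < e -> `|Y t - Y t0| < e -> False.
Proof.
move=> cX cY inj; have [ab|ba] := leP a b; last first.
  by exists 1 => // t /andP[h1 h2]; have := le_trans h1 h2; rewrite leNgt ba.
have cN (f : R -> R) t : {for t, continuous f} -> (fun t => `|f t - f t0|) x @[x --> t] --> `|f t - f t0|.
  by move=> cf; apply: cvg_norm; apply: cvgB => //; exact: cvg_cst.
have [|c] := @EVT_min R (fun t => `|X t - X t0| + `|Y t - Y t0|) a b ab.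
  apply: continuous_in_subspaceT => t _.
  by apply: cvgD; apply: cN.
rewrite in_itv /= => hc Hc.
pose m : R := `|X c - X t0| + `|Y c - Y t0|.
have m0 : 0 < m.
  rewrite lt_neqAle addr_ge0 // andbT; apply/eqP => E.
  have /eqP : m == 0 by rewrite -E.
  move=> /eqP; rewrite paddr_eq0 // !normr_eq0 !subr_eq0 => /andP[/eqP h1 /eqP h2].
  exact: inj h1 h2.
exists (m / 2) => [|t ht h1 h2]; first by rewrite divr_gt0.
have := Hc t; rewrite in_itv /= => /(_ ht); rewrite -/m; clear -h1 h2; lra.
Qed.

(** By injectivity and compactness the rest of the arc has a positive distance from the point of
    parameter [t0]. Hence a small box around that point meets only the piece of the arc described by
    a graph. *)
Lemma arc_separation (X Y : R -> R) (t0 eta : R) :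
  (forall t, {for t, continuous X}) -> (forall t, {for t, continuous Y}) ->
  (forall s t, unit_itv s -> unit_itv t -> X s = X t -> Y s = Y t -> s = t) ->
  unit_itv t0 -> 0 < eta ->
  exists2 e : R, 0 < e & forall t, unit_itv t -> `|X t - X t0| < e -> `|Y t - Y t0| < e ->
    `|t - t0| < eta.
Proof.
move=> cX cY inj I0 eta0; have /unit_itvP/andP[t00 t01] := I0.
have I1 t : 0 <= t <= t0 - eta -> X t = X t0 -> Y t = Y t0 -> False.
  move=> /andP[h1 h2] E1 E2; have E : t = t0.
    by apply: inj => //; apply/unit_itvP; clear -h1 h2 t01 eta0; apply/andP; split; lra.
  by clear -h2 E eta0; lra.
have I2 t : t0 + eta <= t <= 1 -> X t = X t0 -> Y t = Y t0 -> False.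
  move=> /andP[h1 h2] E1 E2; have E : t = t0.
    by apply: inj => //; apply/unit_itvP; clear -h1 h2 t00 eta0; apply/andP; split; lra.
  by clear -h1 E eta0; lra.
have [e1 e10 H1] := segment_separation X Y t0 _ _ cX cY I1.
have [e2 e20 H2] := segment_separation X Y t0 _ _ cX cY I2.
exists (Num.min e1 e2); first by rewrite lt_min e10.
move=> t /unit_itvP/andP[h0 h1]; rewrite !lt_min => /andP[a1 a2] /andP[b1 b2].
rewrite ltr_distl; apply/andP; split; rewrite ltNge; apply/negP => h.
  by apply: (H1 t) => //; rewrite h0.
by apply: (H2 t) => //; rewrite h.
Qed.

(** Connectedness of [0, 1]: the indicator of P, continued by [clamp] to the line, has derivative 0
    everywhere. *)
Lemma locally_constant (P : R -> Prop) :
  (forall t, unit_itv t -> exists2 e : R, 0 < e &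
     forall s, unit_itv s -> `|s - t| < e -> (P s <-> P t)) -> P 0 -> P 1.
Proof.
move=> H P0.
pose f t : R := `[< P (clamp t) >]%:R.
have Df t : is_derive t 1 f 0.
  apply/is_deriveP => e e0; have [d d0 Hd] := H (clamp t) (clamp_itv t).
  exists d => // s sd.
  have E : P (clamp s) <-> P (clamp t).
    by apply: Hd; [exact: clamp_itv|apply: le_lt_trans (clamp_dist _ _) sd].
  rewrite /f (_ : `[< P (clamp s) >] = `[< P (clamp t) >]); last by apply/asbool_equiv_eq.
  by rewrite subrr mul0r subr0 normr0 mulr_ge0 // ltW.
have := is_derive_0_is_cst 0 1 Df.
rewrite /f clamp_le0 // clamp_ge1 // asboolT // => E.
by apply: contrapT => nP1; move: E; rewrite asboolF // => /eqP; rewrite oner_eq0.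
Qed.
End Curves.

(** * Pairs of functions near a boundary graph *)

Section Local.
Context {R : realType}.
Implicit Types (p q : R * R) (x y e : R).

Record jet := Jet { j0 : R * R -> R; jx : R * R -> R; jy : R * R -> R;
  jxx : R * R -> R; jyy : R * R -> R }.

Definition C2jet (D : set (R * R)) (F : jet) :=
  C2fun D (j0 F) (jx F) (jy F) (jxx F) (jyy F) /\
  forall p, D p -> cont_at (jx F) p /\ cont_at (jy F) p.

Definition grad2 (F1 F2 : jet) p : R := jx F1 p ^+ 2 + jy F1 p ^+ 2 + jx F2 p ^+ 2 + jy F2 p ^+ 2.

Definition jac (F1 F2 : jet) p : R := jx F1 p * jy F2 p - jy F1 p * jx F2 p.

(* What is used of the pair (F1, F2) of components of f: quasiconformality, through its
   consequence kap |grad f|^2 <= |J_f|, and the Laplacian inequality. *)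
Definition qcpair (D : set (R * R)) (F1 F2 : jet) (kap M N : R) :=
  [/\ C2jet D F1, C2jet D F2, forall p, D p -> kap * grad2 F1 F2 p <= `|jac F1 F2 p|,
    forall p, D p -> `|jxx F1 p + jyy F1 p| <= M * grad2 F1 F2 p + N &
    forall p, D p -> `|jxx F2 p + jyy F2 p| <= M * grad2 F1 F2 p + N].

Lemma qcpair_sub (D E : set (R * R)) F1 F2 kap M N : E `<=` D ->
  qcpair D F1 F2 kap M N -> qcpair E F1 F2 kap M N.
Proof.
move=> ED [[C1 c1] [C2 c2] H1 H2 H3]; split; try by [move=> p /ED; auto].
- by split; [exact: C2fun_sub C1|move=> p /ED /c1].
- by split; [exact: C2fun_sub C2|move=> p /ED /c2].
Qed.

Lemma grad2C F1 F2 p : grad2 F2 F1 p = grad2 F1 F2 p.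
Proof. by rewrite /grad2; ring. Qed.

Lemma qcpairC D F1 F2 kap M N : qcpair D F1 F2 kap M N -> qcpair D F2 F1 kap M N.
Proof.
move=> [C1 C2 H1 H2 H3]; split=> // p Dp; rewrite grad2C; auto.
have -> : jac F2 F1 p = - jac F1 F2 p by rewrite /jac; ring.
by rewrite normrN; exact: H1.
Qed.

Definition jswap (F : jet) := Jet (swap (j0 F)) (swap (jy F)) (swap (jx F))
  (swap (jyy F)) (swap (jxx F)).

Lemma C2jet_swap D F : C2jet D F -> C2jet (swap D) (jswap F).
Proof.
move=> [C c]; split; first exact: C2fun_swap.
by move=> p /c[c1 c2]; split; exact: cont_at_swap.
Qed.

(** Transposition reverses orientation and changes the sign of the Jacobian, which is why [qcpair]
    is stated with its absolute value. *)
Lemma qcpair_swap D F1 F2 kap M N : qcpair D F1 F2 kap M N ->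
  qcpair (swap D) (jswap F1) (jswap F2) kap M N.
Proof.
move=> [C1 C2 H1 H2 H3].
have G p : grad2 (jswap F1) (jswap F2) p = grad2 F1 F2 (p.2, p.1).
  by rewrite /grad2 /= /swap; ring.
split; [exact: C2jet_swap|exact: C2jet_swap|..] => p Dp; rewrite G.
- have -> : jac (jswap F1) (jswap F2) p = - jac F1 F2 (p.2, p.1).
    by rewrite /jac /= /swap; ring.
  by rewrite normrN; exact: H1.
- by rewrite /= /swap addrC; exact: H2.
- by rewrite /= /swap addrC; exact: H3.
Qed.

Definition refl {T : Type} (u : R * R -> T) p := u (p.1, - p.2).

Definition jrefl (F : jet) := Jet (refl (j0 F)) (refl (jx F)) (fun p => - refl (jy F) p)
  (refl (jxx F)) (refl (jyy F)).

Lemma cont_at_refl u p : cont_at u (p.1, - p.2) -> cont_at (refl u) p.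
Proof. by move=> cu; apply: continuous_comp2 => //; cont. Qed.

Lemma der_refl (u : R -> R) x l : is_derive (- x) 1 u l -> is_derive x 1 (fun t => u (- t)) (- l).
Proof.
move=> Du; have Dn : is_derive x 1 (fun t : R => - t) (- 1) by der.
by apply: der_eq (@der_comp R u (fun t => - t) x _ _ Du Dn) _; ring.
Qed.

Lemma C2jet_refl D F : C2jet D F -> C2jet (refl D) (jrefl F).
Proof.
move=> [[c1 c2 c3 c4 c5] c]; split=> [|p Dp]; last first.
  have [d1 d2] := c _ Dp; split; first exact: cont_at_refl.
  by apply: contN; exact: cont_at_refl.
split=> [p Dp|x y Dp|x y Dp|x y Dp|x y Dp].
- by apply: cont_at_refl; exact: c1.
- exact: (c2 x (- y) Dp).
- exact: (der_refl (fun t => j0 F (x, t)) _ _ (c3 _ _ Dp)).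
- exact: (c4 x (- y) Dp).
- rewrite -[jyy (jrefl F) (x, y)]opprK; apply: derN.
  exact: (der_refl (fun t => jy F (x, t)) _ _ (c5 _ _ Dp)).
Qed.

Lemma grad2_refl F1 F2 p : grad2 (jrefl F1) (jrefl F2) p = grad2 F1 F2 (p.1, - p.2).
Proof. by rewrite /grad2 /= /refl; ring. Qed.

Lemma grad2_swap F1 F2 p : grad2 (jswap F1) (jswap F2) p = grad2 F1 F2 (p.2, p.1).
Proof. by rewrite /grad2 /= /swap; ring. Qed.

Lemma qcpair_refl D F1 F2 kap M N : qcpair D F1 F2 kap M N ->
  qcpair (refl D) (jrefl F1) (jrefl F2) kap M N.
Proof.
move=> [C1 C2 H1 H2 H3].
split; [exact: C2jet_refl|exact: C2jet_refl|..] => p Dp; rewrite grad2_refl.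
- have -> : jac (jrefl F1) (jrefl F2) p = - jac F1 F2 (p.1, - p.2).
    by rewrite /jac /= /refl; ring.
  by rewrite normrN; exact: H1.
- exact: H2.
- exact: H3.
Qed.

Lemma C2fun_graph_comp D u ux uy uxx uyy v vx vy vxx vyy (w1 d : R) (g g' g'' : R -> R) :
  C2fun D u ux uy uxx uyy -> C2fun D v vx vy vxx vyy ->
  (forall p, D p -> `|u p - w1| < d) ->
  (forall s, `|s - w1| < d -> is_derive s 1 g (g' s) /\ is_derive s 1 g' (g'' s)) ->
  C2fun D (fun p => v p - g (u p)) (fun p => vx p - g' (u p) * ux p)
   (fun p => vy p - g' (u p) * uy p)
   (fun p => vxx p - (g'' (u p) * ux p ^+ 2 + g' (u p) * uxx p))
   (fun p => vyy p - (g'' (u p) * uy p ^+ 2 + g' (u p) * uyy p)).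
Proof.
move=> [c1 c2 c3 c4 c5] [d1 d2 d3 d4 d5] ud Dg; split=> [p Dp|x y Dp|x y Dp|x y Dp|x y Dp].
- apply: contB; first exact: d1.
  apply: (@continuous_comp _ _ _ u g); first exact: c1.
  by have [h _] := Dg _ (ud _ Dp); exact: is_derive_continuous h.
- have [h _] := Dg _ (ud _ Dp); apply: derB; first exact: d2.
  exact: (@der_comp R g (fun t => u (t, y)) x _ _ h (c2 _ _ Dp)).
- have [h _] := Dg _ (ud _ Dp); apply: derB; first exact: d3.
  exact: (@der_comp R g (fun t => u (x, t)) y _ _ h (c3 _ _ Dp)).
- have [_ h] := Dg _ (ud _ Dp); have e1 := d4 _ _ Dp; have e2 := c4 _ _ Dp.
  have e3 := @der_comp R g' (fun t => u (t, y)) x _ _ h (c2 _ _ Dp).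
  by der_by ltac:(ring).
- have [_ h] := Dg _ (ud _ Dp); have e1 := d5 _ _ Dp; have e2 := c5 _ _ Dp.
  have e3 := @der_comp R g' (fun t => u (x, t)) y _ _ h (c3 _ _ Dp).
  by der_by ltac:(ring).
Qed.

(* Quasiconformality lets the single function v - g(u) control the whole gradient,
   because J(u, v - g(u)) = J(u, v). *)
Lemma grad2_le (a1 a2 b1 b2 m kap : R) : 0 < kap ->
  kap * (a1 ^+ 2 + a2 ^+ 2 + b1 ^+ 2 + b2 ^+ 2) <= `|a1 * b2 - a2 * b1| ->
  kap ^+ 2 * (a1 ^+ 2 + a2 ^+ 2 + b1 ^+ 2 + b2 ^+ 2) <= (b1 - m * a1) ^+ 2 + (b2 - m * a2) ^+ 2.
Proof.
move=> k0; set G := _ + b2 ^+ 2 => H.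
have [A1 A2 B1 B2] : [/\ 0 <= a1 ^+ 2, 0 <= a2 ^+ 2, 0 <= b1 ^+ 2 & 0 <= b2 ^+ 2] by rewrite !sqr_ge0.
have G0 : 0 <= G by rewrite /G; clear -A1 A2 B1 B2; lra.
set c1 := b1 - m * a1; set c2 := b2 - m * a2.
have C0 : 0 <= c1 ^+ 2 + c2 ^+ 2 by rewrite addr_ge0 ?sqr_ge0.
have [->|Gn] := eqVneq G 0; first by rewrite mulr0.
have Gp : 0 < G by rewrite lt_neqAle eq_sym Gn.
have : (kap * G) ^+ 2 <= (a1 * c2 - a2 * c1) ^+ 2.
  rewrite (_ : a1 * c2 - a2 * c1 = a1 * b2 - a2 * b1); last by rewrite /c1 /c2; ring.
  rewrite -[leRHS]real_normK ?num_real // lerXn2r ?nnegrE ?normr_ge0 // mulr_ge0 // ltW //.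
have : (a1 * c2 - a2 * c1) ^+ 2 <= (a1 ^+ 2 + a2 ^+ 2) * (c1 ^+ 2 + c2 ^+ 2).
  rewrite -subr_ge0 (_ : _ - _ = (a1 * c1 + a2 * c2) ^+ 2) ?sqr_ge0 //; ring.
have : (a1 ^+ 2 + a2 ^+ 2) * (c1 ^+ 2 + c2 ^+ 2) <= G * (c1 ^+ 2 + c2 ^+ 2).
  by rewrite ler_wpM2r // /G; clear -B1 B2; lra.
move=> h1 h2 h3; have := le_trans (le_trans h3 h2) h1.
by rewrite exprMn (expr2 G) mulrCA ler_pM2l.
Qed.

Definition holder_graph_on (g m : R -> R) (alpha K L x0 d : R) :=
  [/\ 0 < d, 0 < alpha <= 1, 0 <= K, 1 <= L &
  [/\ forall x x', `|x - x0| < d -> `|x' - x0| < d -> `|g x' - g x| <= L * `|x' - x|,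
    forall x, `|x - x0| < d -> `|m x| <= L &
    forall x x', `|x - x0| < d -> `|x' - x0| < d ->
      `|g x' - g x - m x * (x' - x)| <= K * `|x' - x| `^ (1 + alpha)]].

Definition C2_graph_on (gt gt' gt'' : R -> R) (w1 d B : R) :=
  0 < d /\ forall s, `|s - w1| < d ->
    [/\ is_derive s 1 gt (gt' s), is_derive s 1 gt' (gt'' s), `|gt' s| <= B & `|gt'' s| <= B].

(** [gradient_bound_above] is applied to w = F2 - gt(F1), which tends to 0 at the graph because (F1,
    F2) tends to a point of the graph of [gt]. *)
Lemma side_grad (g m : R -> R) (alpha K L x0 d kap M N : R) (F1 F2 : jet)
    (gt gt' gt'' : R -> R) (w1 d' B S : R) :
  holder_graph_on g m alpha K L x0 d -> C2_graph_on gt gt' gt'' w1 d' B ->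
  qcpair (above g x0 d) F1 F2 kap M N -> 0 < kap -> 0 <= M -> 0 <= N ->
  (forall p, above g x0 d p -> `|j0 F1 p - w1| < d' /\ `|j0 F2 p| <= S) ->
  (forall x, `|x - x0| < d -> exists2 w, `|w - w1| < d' &
     forall e, 0 < e -> exists2 r : R, 0 < r &
       forall x' y', `|x' - x| < r -> `|y' - g x| < r -> above g x0 d (x', y') ->
       `|j0 F1 (x', y') - w| < e /\ `|j0 F2 (x', y') - gt w| < e) ->
  exists C rho : R, 0 < rho /\ forall x y, above g x0 d (x, y) ->
    `|x - x0| < rho -> `|y - g x0| < rho -> grad2 F1 F2 (x, y) <= C.
Proof.
move=> [d0 al K0 L1 [hL hm hK]] [d'0 Hg] [[C1 c1] [C2 c2] HJ HL1 HL2] k0 M0 N0 HS Hlim.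
have B0 : 0 <= B.
  by have [|_ _ h _] := Hg w1; [rewrite subrr normr0|exact: le_trans h].
have Dg s : `|s - w1| < d' -> is_derive s 1 gt (gt' s) /\ is_derive s 1 gt' (gt'' s).
  by move=> /Hg[].
have Cu := C2fun_graph_comp _ _ _ _ _ _ _ _ _ _ _ w1 d' gt gt' gt'' C1 C2 (fun p ap => (HS p ap).1) Dg.
have [k2 k20] : exists k2 : R, 0 < k2 /\ k2 = kap ^+ 2 by exists (kap ^+ 2); rewrite exprn_gt0.
have H2 p : above g x0 d p -> k2 * grad2 F1 F2 p <=
    (jx F2 p - gt' (j0 F1 p) * jx F1 p) ^+ 2 + (jy F2 p - gt' (j0 F1 p) * jy F1 p) ^+ 2.
  by move=> ap; case: k20 => _ ->; apply: grad2_le => //; exact: HJ.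
case: k20 => k20 _.
(* The Laplacian of w is Lap F2 - gt'' |grad F1|^2 - gt' Lap F1, at most ((1 + B) M + B) |grad F|^2
   + (1 + B) N in modulus, and [k2] times |grad F|^2 is at most |grad w|^2. The added 1 makes [a]
   positive. *)
pose a : R := ((1 + B) * M + B) / k2 + 1.
have a1 : 0 <= ((1 + B) * M + B) / k2.
  by rewrite divr_ge0 ?(ltW k20) // addr_ge0 // mulr_ge0 // addr_ge0.
have a0 : 0 < a by rewrite ltr_wpDl.
have b0 : 0 <= (1 + B) * N by rewrite mulr_ge0 // addr_ge0.
have [||||C [rho [rho0 HC]]] := gradient_bound_above g m alpha K L x0 d (S + `|gt w1| + B * d') a ((1 + B) * N)
  _ _ _ _ _ d0 al K0 L1 hL hm hK Cu _ _ a0 b0.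
- move=> p ap; have [e1 e2] := c1 p ap; have [e3 e4] := c2 p ap.
  have [_ h] := Dg _ (HS p ap).1.
  have e5 : cont_at (fun q => gt' (j0 F1 q)) p.
    apply: (@continuous_comp _ _ _ (j0 F1) gt'); first exact: (C2c _ _ _ _ _ _ C1).
    exact: is_derive_continuous h.
  by split; apply: contB => //; apply: contM.
- move=> p ap; have [h1 h2] := HS p ap.
  have [c [hc1 _ E]] : exists c, [/\ `|c - w1| <= `|j0 F1 p - w1|, `|c - w1| <= `|j0 F1 p - w1|
      & gt (j0 F1 p) - gt w1 = gt' c * (j0 F1 p - w1)].
    apply: (mean_value gt gt' w1 _ w1 (j0 F1 p)) => //; last by rewrite subrr normr0.
    by move=> t ht; have [] := Dg t (le_lt_trans ht h1).
  have h3 : `|gt (j0 F1 p) - gt w1| <= B * d'.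
    rewrite E normrM; apply: ler_pM => //; last exact: ltW.
    by have [] := Hg c (le_lt_trans hc1 h1).
  have := ler_normB (j0 F2 p) (gt (j0 F1 p)); have := ler_distD (gt w1) (gt (j0 F1 p)) 0.
  by rewrite !subr0; clear -h2 h3; lra.
- move=> p ap; have [h1 _] := HS p ap; have [_ _ B1 B2] := Hg _ h1.
  set G := grad2 F1 F2 p; set H := (X in _ <= a * X + _).
  have GH : k2 * G <= H by exact: H2.
  have G0 : jx F1 p ^+ 2 + jy F1 p ^+ 2 <= G.
    by rewrite /G /grad2; have := sqr_ge0 (jx F2 p); have := sqr_ge0 (jy F2 p); clear; lra.
  have G1 : 0 <= jx F1 p ^+ 2 + jy F1 p ^+ 2 by rewrite addr_ge0 ?sqr_ge0.
  have L1' := HL1 p ap; have L2' := HL2 p ap.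
  rewrite -/G in L1' L2'.
  have t1 : `|gt'' (j0 F1 p) * (jx F1 p ^+ 2 + jy F1 p ^+ 2)| <= B * G.
    by rewrite normrM; apply: ler_pM => //; rewrite ger0_norm.
  have t2 : `|gt' (j0 F1 p) * (jxx F1 p + jyy F1 p)| <= B * (M * G + N).
    by rewrite normrM; apply: ler_pM.
  set E := (X in `|X| <= _).
  have -> : E = (jxx F2 p + jyy F2 p) - (gt'' (j0 F1 p) * (jx F1 p ^+ 2 + jy F1 p ^+ 2))
     - gt' (j0 F1 p) * (jxx F1 p + jyy F1 p) by rewrite /E; ring.
  have t3 : ((1 + B) * M + B) * G <= ((1 + B) * M + B) / k2 * H.
    rewrite -mulrA ler_wpM2l ?addr_ge0 ?mulr_ge0 ?addr_ge0 //.
    by rewrite ler_pdivlMl.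
  have H0 : 0 <= H by rewrite /H addr_ge0 ?sqr_ge0.
  rewrite /a; move: t3; set aa := _ / k2 => t3.
  clear -t1 t2 t3 L2' H0.
  move: t1 t2 L2'; rewrite !ler_norml => /andP[? ?] /andP[? ?] /andP[? ?].
  by apply/andP; split; lra.
- move=> x hx e e0; have [w hw Hw] := Hlim x hx.
  have [h _] := Dg w hw; have /cvgrPdist_lt := is_derive_continuous _ _ _ h.
  have e2 : 0 < e / 2 by rewrite divr_gt0.
  move=> /(_ _ e2) /nbhs_ballP[r1 /= r10 Hr1].
  have e3 : 0 < Num.min r1 (e / 2) by rewrite lt_min r10.
  have [r r0 Hr] := Hw _ e3.
  exists r => // x' y' h1 h2 h3; have [] := Hr x' y' h1 h2 h3.
  rewrite !lt_min => /andP[k1 _] /andP[_ k2'].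
  have := Hr1 (j0 F1 (x', y')); rewrite /ball /= distrC => /(_ k1) k3.
  have := ler_distD (gt w) (j0 F2 (x', y')) (gt (j0 F1 (x', y'))).
  by clear -k2' k3; lra.
exists (C ^+ 2 / k2), rho; split=> // x y axy hx hy.
rewrite ler_pdivlMr // mulrC; apply: le_trans (H2 _ axy) _.
have := HC x y axy hx hy => /=; set u := _ - _; set v := _ - _ => uv.
have C0 : 0 <= C by apply: le_trans uv; rewrite addr_ge0.
apply: (@le_trans _ _ ((`|u| + `|v|) ^+ 2)).
  rewrite [leRHS]sqrrD !real_normK ?num_real //; have := mulr_ge0 (normr_ge0 u) (normr_ge0 v).
  by clear; lra.
by rewrite lerXn2r ?nnegrE ?addr_ge0.
Qed.

Lemma mean_value_bound (f f' : R -> R) (a b C : R) :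
  (forall t, Num.min a b <= t <= Num.max a b -> is_derive t 1 f (f' t) /\ `|f' t| <= C) ->
  `|f b - f a| <= C * `|b - a|.
Proof.
wlog ab : a b / a < b => [H|] Hf.
  have [ab|ba|->] := ltgtP a b; [exact: H| |by rewrite !subrr normr0 mulr0].
  by rewrite distrC (distrC b); apply: H => // t; rewrite minC maxC; exact: Hf.
move: Hf; rewrite (min_idPl (ltW ab)) (max_idPr (ltW ab)) => Hf.
have [c [hc ->]] := mean_value_lt f f' a b ab (fun t ht => (Hf t ht).1).
by rewrite normrM ler_wpM2r // (Hf c hc).2.
Qed.

(** The path goes up from both points to the common height [Yh] and across. The slope bound keeps
    the horizontal segment above the graph, and division of the radius by [2 * L + 1] keeps the path
    where the gradient is bounded. *)
Lemma side_lipschitz (g : R -> R) (L x0 d rho C : R) u ux uy uxx uyy :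
  1 <= L -> 0 < rho -> rho <= d ->
  (forall x x', `|x - x0| < d -> `|x' - x0| < d -> `|g x' - g x| <= L * `|x' - x|) ->
  C2fun (above g x0 d) u ux uy uxx uyy ->
  (forall x y, above g x0 d (x, y) -> `|x - x0| < rho -> `|y - g x0| < rho ->
     `|ux (x, y)| <= C /\ `|uy (x, y)| <= C) ->
  forall x y x' y', above g x0 d (x, y) -> above g x0 d (x', y') ->
    `|x - x0| < rho / (2 * L + 1) -> `|y - g x0| < rho / (2 * L + 1) ->
    `|x' - x0| < rho / (2 * L + 1) -> `|y' - g x0| < rho / (2 * L + 1) ->
    `|u (x, y) - u (x', y')| <= C * (2 * L + 1) * (`|x - x'| + `|y - y'|).
Proof.
move=> L1 rho0 rhod hL Cu HC x y x' y' a1 a2 hx hy hx' hy'.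
set r := rho / (2 * L + 1) in hx hy hx' hy'.
have LL : 0 < 2 * L + 1 by clear -L1; lra.
have rE : (2 * L + 1) * r = rho by rewrite /r mulrC divfK // gt_eqF.
clearbody r.
have r0 : 0 < r by apply: le_lt_trans hx.
have Lr : r <= L * r by rewrite ler_peMl // ltW.
have rrho : 3 * r <= rho by clear -rE Lr; lra.
pose Yh : R := Num.max y y' + L * `|x - x'|.
have xx' : `|x - x'| <= 2 * r.
  by have := ler_distD x0 x x'; rewrite (distrC x0 x'); clear -hx hx'; lra.
have Lxx : L * `|x - x'| <= L * (2 * r) by rewrite ler_wpM2l //; clear -L1; lra.
have Lxx0 : 0 <= L * `|x - x'| by rewrite mulr_ge0 //; clear -L1; lra.
have [m1 m2] : y <= Num.max y y' /\ y' <= Num.max y y' by rewrite !le_max !lexx orbT.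
have m3 : Num.max y y' - y <= `|y - y'|.
  by case: (leP y y') => h; [rewrite distrC ler_norm|rewrite subrr].
have m4 : Num.max y y' - y' <= `|y - y'|.
  by case: (leP y y') => h; [rewrite subrr|exact: ler_norm].
have m5 : Num.max y y' < g x0 + r.
  by rewrite gt_max; move: hy hy'; rewrite !ltr_distl => /andP[_ ->] /andP[_ ->].
have Yrho : Yh < g x0 + rho by rewrite /Yh; clear -m5 Lxx rE; lra.
have [/= x1 /andP[x2 x3]] := a1; have [/= x1' /andP[x2' x3']] := a2.
have yh1 : y <= Yh by rewrite /Yh; clear -m1 Lxx0; lra.
have yh2 : y' <= Yh by rewrite /Yh; clear -m2 Lxx0; lra.
have low t : y <= t -> - rho < t - g x0.
  by move: hy; rewrite ltr_distl => /andP[h _]; clear -h rrho r0; lra.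
have low' t : y' <= t -> - rho < t - g x0.
  by move: hy'; rewrite ltr_distl => /andP[h _]; clear -h rrho r0; lra.
have E1 : `|u (x, Yh) - u (x, y)| <= C * `|Yh - y|.
  apply: (mean_value_bound (fun t => u (x, t)) (fun t => uy (x, t))) => t.
  rewrite (min_idPl yh1) (max_idPr yh1) => /andP[t1 t2].
  have at_ : above g x0 d (x, t).
    by split=> //=; clear -x2 t1 t2 Yrho rhod; apply/andP; split; lra.
  split; first exact: (C2y _ _ _ _ _ _ Cu).
  have [] // := HC x t at_; first by clear -hx rrho r0; lra.
  by rewrite ltr_norml low //=; clear -t2 Yrho; lra.
have E2 : `|u (x', Yh) - u (x', y')| <= C * `|Yh - y'|.
  apply: (mean_value_bound (fun t => u (x', t)) (fun t => uy (x', t))) => t.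
  rewrite (min_idPl yh2) (max_idPr yh2) => /andP[t1 t2].
  have at_ : above g x0 d (x', t).
    by split=> //=; clear -x2' t1 t2 Yrho rhod; apply/andP; split; lra.
  split; first exact: (C2y _ _ _ _ _ _ Cu).
  have [] // := HC x' t at_; first by clear -hx' rrho r0; lra.
  by rewrite ltr_norml low' //=; clear -t2 Yrho; lra.
have E3 : `|u (x', Yh) - u (x, Yh)| <= C * `|x' - x|.
  apply: (mean_value_bound (fun t => u (t, Yh)) (fun t => ux (t, Yh))) => t.
  rewrite ge_min le_max => /andP[/orP t1 /orP t2].
  have tr : `|t - x0| < r.
    move: hx hx'; clear -t1 t2; rewrite !ltr_distl => /andP[? ?] /andP[? ?].
    by apply/andP; case: t1 => ?; case: t2 => ?; split; lra.
  have td : `|t - x0| < d by clear -tr rrho rhod r0; lra.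
  have tx : `|t - x| <= `|x - x'|.
    rewrite ler_norml; have := ler_norm (x - x'); have := ler_norm (x' - x); rewrite distrC.
    by clear -t1 t2 => ? ?; apply/andP; case: t1 => ?; case: t2 => ?; split; lra.
  have at_ : above g x0 d (t, Yh).
    split=> //=; have := hL x t x1 td; rewrite ler_norml => /andP[_ h].
    have : L * `|t - x| <= L * `|x - x'| by rewrite ler_wpM2l //; clear -L1; lra.
    have : y + L * `|x - x'| <= Yh by rewrite /Yh lerD2r.
    by clear -h x2 Yrho rhod => ? ?; apply/andP; split; lra.
  split; first exact: (C2x _ _ _ _ _ _ Cu).
  have [] // := HC t Yh at_; first by clear -tr rrho r0; lra.
  by rewrite ltr_norml low //=; clear -Yrho; lra.
have C0 : 0 <= C.
  by have [] // := HC x y a1; [clear -hx rrho r0; lra|clear -hy rrho r0; lra|move=> h _; apply: le_trans h].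
have -> : u (x, y) - u (x', y') = - (u (x, Yh) - u (x, y)) - (u (x', Yh) - u (x, Yh))
  + (u (x', Yh) - u (x', y')) by ring.
apply: le_trans (ler_normD _ _) _; apply: le_trans (lerD (ler_normB _ _) (lexx _)) _; rewrite normrN.
apply: le_trans (lerD (lerD E1 E3) E2) _.
rewrite -!mulrDr -mulrA ler_wpM2l // (ger0_norm (_ : 0 <= Yh - y)) ?subr_ge0 //.
rewrite (ger0_norm (_ : 0 <= Yh - y')) ?subr_ge0 // (distrC x').
have := normr_ge0 (y - y'); have h : 1 * `|y - y'| <= L * `|y - y'| by rewrite ler_wpM2r.
by rewrite /Yh; clear -m3 m4 h; lra.
Qed.

(** The bound [C + 1] avoids a square root, since |z| <= z^2 + 1. *)
Lemma grad2_entries F1 F2 p (C : R) : grad2 F1 F2 p <= C ->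
  [/\ `|jx F1 p| <= C + 1, `|jy F1 p| <= C + 1, `|jx F2 p| <= C + 1 & `|jy F2 p| <= C + 1].
Proof.
rewrite /grad2 => H.
have aux z : z ^+ 2 <= C -> `|z| <= C + 1.
  move=> zC; have : 0 <= (`|z| - 2^-1) ^+ 2 by exact: sqr_ge0.
  by rewrite sqrrB real_normK ?num_real //; clear -zC; lra.
have := sqr_ge0 (jx F1 p); have := sqr_ge0 (jy F1 p).
have := sqr_ge0 (jx F2 p); have := sqr_ge0 (jy F2 p).
by clear -H aux => *; split; apply: aux; lra.
Qed.

Lemma side_bound (g m : R -> R) (alpha K L x0 d kap M N : R) (F1 F2 : jet)
    (gt gt' gt'' : R -> R) (w1 d' B S : R) :
  holder_graph_on g m alpha K L x0 d -> C2_graph_on gt gt' gt'' w1 d' B ->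
  qcpair (above g x0 d) F1 F2 kap M N -> 0 < kap -> 0 <= M -> 0 <= N ->
  (forall p, above g x0 d p -> `|j0 F1 p - w1| < d' /\ `|j0 F2 p| <= S) ->
  (forall x, `|x - x0| < d -> exists2 w, `|w - w1| < d' &
     forall e, 0 < e -> exists2 r : R, 0 < r &
       forall x' y', `|x' - x| < r -> `|y' - g x| < r -> above g x0 d (x', y') ->
       `|j0 F1 (x', y') - w| < e /\ `|j0 F2 (x', y') - gt w| < e) ->
  exists C rho : R, 0 < rho /\ forall x y, above g x0 d (x, y) ->
    `|x - x0| < rho -> `|y - g x0| < rho -> grad2 F1 F2 (x, y) <= C /\
    forall x' y', above g x0 d (x', y') -> `|x' - x0| < rho -> `|y' - g x0| < rho ->
      `|j0 F1 (x, y) - j0 F1 (x', y')| <= C * (`|x - x'| + `|y - y'|) /\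
      `|j0 F2 (x, y) - j0 F2 (x', y')| <= C * (`|x - x'| + `|y - y'|).
Proof.
move=> Hg Ht Hq k0 M0 N0 HS Hl.
have [C [rho [rho0 HC]]] := side_grad _ _ _ _ _ _ _ _ _ _ _ _ _ _ _ _ _ _ _ Hg Ht Hq k0 M0 N0 HS Hl.
have [d0 al K0 L1 [hL hm hK]] := Hg; have [[C1 _] [C2 _] _ _ _] := Hq.
pose r : R := Num.min rho d.
have r0 : 0 < r by rewrite lt_min rho0.
have rd : r <= d by rewrite ge_min lexx orbT.
have rrho : r <= rho by rewrite ge_min lexx.
clearbody r.
have LL : 0 < 2 * L + 1 by clear -L1; lra.
have s0 : 0 < r / (2 * L + 1) by exact: divr_gt0.
have sr : r / (2 * L + 1) <= rho.
  apply: le_trans rrho; rewrite ler_pdivrMr // ler_peMr ?(ltW r0) //; clear -L1; lra.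
exists (Num.max C ((C + 1) * (2 * L + 1))), (r / (2 * L + 1)); split=> // x y a1 hx hy; split.
  rewrite le_max; apply/orP; left; apply: HC => //; exact: lt_le_trans sr.
move=> x' y' a2 hx' hy'.
have HC' s t : above g x0 d (s, t) -> `|s - x0| < r -> `|t - g x0| < r ->
    [/\ `|jx F1 (s, t)| <= C + 1, `|jy F1 (s, t)| <= C + 1,
        `|jx F2 (s, t)| <= C + 1 & `|jy F2 (s, t)| <= C + 1].
  by move=> k1 k2 k3; apply: grad2_entries; apply: HC => //; exact: lt_le_trans rrho.
have nn : 0 <= `|x - x'| + `|y - y'| by rewrite addr_ge0.
have mx : (C + 1) * (2 * L + 1) <= Num.max C ((C + 1) * (2 * L + 1)) by rewrite le_max lexx orbT.
split; apply: le_trans (ler_wpM2r nn mx).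
  apply: (side_lipschitz _ _ _ _ _ _ _ _ _ _ _ L1 r0 rd hL C1) a1 a2 hx hy hx' hy' => s t k1 k2 k3.
  by have [] := HC' s t k1 k2 k3.
apply: (side_lipschitz _ _ _ _ _ _ _ _ _ _ _ L1 r0 rd hL C2) a1 a2 hx hy hx' hy' => s t k1 k2 k3.
by have [] := HC' s t k1 k2 k3.
Qed.

Definition box (x0 y0 d : R) : set (R * R) := [set p | `|p.1 - x0| < d /\ `|p.2 - y0| < d].

(* The situation near tau = (x0, g x0): the boundary of Om is the graph of g, Om may lie on
   one side or on both sides of it, and F = (F1, F2) maps the boundary into the graph of gt. *)
Definition local_setting (Om : set (R * R)) (F1 F2 : jet) (g m : R -> R) (alpha K L x0 d kap M N : R)
    (gt gt' gt'' : R -> R) (w1 d' B S : R) :=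
  [/\ holder_graph_on g m alpha K L x0 d, C2_graph_on gt gt' gt'' w1 d' B,
      qcpair (Om `&` box x0 (g x0) d) F1 F2 kap M N, [/\ 0 < kap, 0 <= M & 0 <= N] &
  [/\ forall x, `|x - x0| < d -> ~ Om (x, g x),
      forall x y, `|x - x0| < d -> `|y - g x0| < d -> y != g x ->
        exists2 e : R, 0 < e &
          (forall x' y', `|x' - x| < e -> `|y' - y| < e -> Om (x', y')) \/
          (forall x' y', `|x' - x| < e -> `|y' - y| < e -> ~ Om (x', y')),
      forall p, (Om `&` box x0 (g x0) d) p -> `|j0 F1 p - w1| < d' /\ `|j0 F2 p| <= S &
      forall x, `|x - x0| < d -> exists2 w, `|w - w1| < d' &
        forall e, 0 < e -> exists2 r : R, 0 < r &
          forall x' y', `|x' - x| < r -> `|y' - g x| < r -> Om (x', y') ->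
          `|j0 F1 (x', y') - w| < e /\ `|j0 F2 (x', y') - gt w| < e]].

Lemma local_setting_refl Om F1 F2 g m alpha K L x0 d kap M N gt gt' gt'' w1 d' B S :
  local_setting Om F1 F2 g m alpha K L x0 d kap M N gt gt' gt'' w1 d' B S ->
  local_setting (refl Om) (jrefl F1) (jrefl F2) (fun x => - g x) (fun x => - m x)
    alpha K L x0 d kap M N gt gt' gt'' w1 d' B S.
Proof.
move=> [[d0 al K0 L1 [hL hm hK]] Ht Hq Hc [H1 H2 H3 H4]].
have nE (y z : R) : `|- y - z| = `|y - - z| by rewrite -normrN; congr `|_|; ring.
split=> //.
- split=> //; split=> [x x' hx hx'|x hx|x x' hx hx'].
  + by rewrite -opprD normrN; exact: hL.
  + by rewrite normrN; exact: hm.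
  + rewrite (_ : _ - _ = - (g x' - g x - m x * (x' - x))); last by ring.
    by rewrite normrN; exact: hK.
- apply: qcpair_sub (qcpair_refl _ _ _ _ _ _ Hq) => p [Op [/= h1 h2]].
  by split=> //; split=> //=; rewrite nE.
- split=> [x hx|x y hx hy yg|p [Op [/= h1 h2]]|x hx].
  + by rewrite /refl /= opprK; exact: H1.
  + have [||e e0 He] := H2 x (- y) hx; first by rewrite nE.
      by apply: contraNneq yg => <-; rewrite opprK.
    exists e => //; case: He => He; [left|right] => x' y' h1 h2; apply: He => //=.
      by rewrite -opprD normrN.
    by rewrite -opprD normrN.
  + by apply: H3; split=> //; split=> //=; rewrite nE.
  + have [w hw Hw] := H4 x hx; exists w => // e e0.
    have [r r0 Hr] := Hw e e0; exists r => // x' y' h1 h2 Op.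
    by apply: Hr => //; rewrite nE.
Qed.

Lemma locally_constant_segment (P : R * R -> Prop) (x y x' y' : R) :
  (forall s, 0 <= s <= 1 -> exists2 e : R, 0 < e &
     (forall a b, `|a - (x + s * (x' - x))| < e -> `|b - (y + s * (y' - y))| < e -> P (a, b)) \/
     (forall a b, `|a - (x + s * (x' - x))| < e -> `|b - (y + s * (y' - y))| < e -> ~ P (a, b))) ->
  P (x, y) -> P (x', y').
Proof.
move=> H Pxy.
have := locally_constant (fun s => P (x + s * (x' - x), y + s * (y' - y))).
rewrite !mul0r !addr0 !mul1r => LC.
have -> : x' = x + (x' - x) by ring.
have -> : y' = y + (y' - y) by ring.
apply: LC => // s /unit_itvP Is; have [e e0 He] := H s Is.
pose c : R := `|x' - x| + `|y' - y| + 1.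
have c0 : 0 < c by rewrite /c ltr_wpDl // addr_ge0.
exists (e / c) => [|t _]; first by rewrite divr_gt0.
rewrite ltr_pdivlMr // => ht.
have aux (z z' : R) : `|z' - z| <= c -> `|z + t * (z' - z) - (z + s * (z' - z))| < e.
  move=> zc; rewrite (_ : _ - _ = (t - s) * (z' - z)); last by ring.
  by rewrite normrM; apply: le_lt_trans ht; rewrite ler_wpM2l.
have a1 : `|x' - x| <= c by rewrite /c; have := normr_ge0 (y' - y); clear; lra.
have a2 : `|y' - y| <= c by rewrite /c; have := normr_ge0 (x' - x); clear; lra.
have e1 : `|x + s * (x' - x) - (x + s * (x' - x))| < e by rewrite subrr normr0.
have e2 : `|y + s * (y' - y) - (y + s * (y' - y))| < e by rewrite subrr normr0.
case: He => He; split=> // h.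
- by apply: He.
- by apply: He; apply: aux.
- by exfalso; apply: He h; apply: aux.
- by exfalso; apply: He h.
Qed.

(** Membership in [Om] is locally constant off the graph, hence constant along paths. Two points are
    joined through the height [top], which exceeds the graph over the whole interval; the larger
    region [big] contains this path, and [(L + 2) * d1 <= d] keeps it in the given box. *)
Lemma above_dichotomy Om F1 F2 g m alpha K L x0 d kap M N gt gt' gt'' w1 d' B S d1 :
  local_setting Om F1 F2 g m alpha K L x0 d kap M N gt gt' gt'' w1 d' B S ->
  0 < d1 -> (L + 2) * d1 <= d ->
  above g x0 d1 `<=` Om \/ forall p, above g x0 d1 p -> ~ Om p.
Proof.
move=> [[d0 al K0 L1 [hL _ _]] _ _ _ [_ H2 _ _]] d10 d1d.
have Ld1 : d1 <= L * d1 by rewrite ler_peMl // ltW.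
pose big x y := `|x - x0| < d1 /\ g x < y < g x0 + (L + 1) * d1.
have bigloc x y : big x y -> exists2 e : R, 0 < e &
    (forall x' y', `|x' - x| < e -> `|y' - y| < e -> Om (x', y')) \/
    (forall x' y', `|x' - x| < e -> `|y' - y| < e -> ~ Om (x', y')).
  move=> [h1 /andP[h2 h3]]; apply: H2; last by rewrite gt_eqF.
    by clear -h1 d1d Ld1 d10; lra.
  have h1' : `|x - x0| < d by clear -h1 d1d Ld1 d10; lra.
  have h0 : `|x0 - x0| < d by rewrite subrr normr0.
  have := hL x0 x h0 h1'; rewrite ler_norml => /andP[h4 _].
  have : L * `|x - x0| <= L * d1 by rewrite ler_wpM2l ?(ltW h1) //; clear -L1; lra.
  by rewrite ltr_norml; clear -h4 h2 h3 d1d Ld1 d10 => ?; apply/andP; split; lra.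
pose top := g x0 + (L + 2^-1) * d1.
have gtop x : `|x - x0| < d1 -> g x < top.
  move=> h1; have h1' : `|x - x0| < d by clear -h1 d1d Ld1 d10; lra.
  have h0 : `|x0 - x0| < d by rewrite subrr normr0.
  have := hL x0 x h0 h1'; rewrite ler_norml => /andP[_ h4].
  have : L * `|x - x0| <= L * d1 by rewrite ler_wpM2l ?(ltW h1) //; clear -L1; lra.
  by rewrite /top; clear -h4 d10; lra.
have topb : top < g x0 + (L + 1) * d1 by rewrite /top; clear -d10; lra.
have conv (s z z' lo : R) : 0 <= s <= 1 -> lo < z -> lo < z' -> lo < z + s * (z' - z).
  move=> /andP[s0 s1] h1 h2; have := mulr_ge0 s0 (ltW (_ : 0 < z' - lo)).
  rewrite subr_gt0 => /(_ h2).
  have [->|sn] := eqVneq s 1; first by rewrite mul1r; clear -h2; lra.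
  have s1' : 0 < 1 - s by rewrite subr_gt0 lt_neqAle sn.
  by have := mulr_gt0 s1' (_ : 0 < z - lo); rewrite subr_gt0 => /(_ h1); clear; lra.
have conv' (s z z' hi : R) : 0 <= s <= 1 -> z < hi -> z' < hi -> z + s * (z' - z) < hi.
  move=> Is h1 h2; have := conv s (- z) (- z') (- hi) Is; rewrite !ltrN2 => /(_ h1 h2).
  by clear; lra.
have vert x y y' : big x y -> big x y' -> Om (x, y) -> Om (x, y').
  move=> [h1 /andP[h2 h3]] [_ /andP[h2' h3']]; apply: locally_constant_segment => s Is.
  rewrite subrr mulr0 addr0; apply: bigloc; split=> //.
  by rewrite conv // conv'.
have hor x x' : `|x - x0| < d1 -> `|x' - x0| < d1 -> Om (x, top) -> Om (x', top).
  move=> h1 h1'; apply: locally_constant_segment => s Is.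
  rewrite subrr mulr0 addr0; apply: bigloc.
  have h : `|x + s * (x' - x) - x0| < d1.
    move: h1 h1'; rewrite !ltr_distl => /andP[? ?] /andP[? ?].
    by rewrite conv // conv'.
  by split=> //; rewrite gtop.
have bigtop x : `|x - x0| < d1 -> big x top by move=> h; split=> //; rewrite gtop.
have sub x y : above g x0 d1 (x, y) -> big x y.
  move=> [/= h1 /andP[h2 h3]]; split=> //; rewrite h2 /=; clear -h3 Ld1 d10; lra.
have [[[x y] [a1 O1]]|no] := pselect (exists p, above g x0 d1 p /\ Om p); last first.
  by right=> p ap Op; apply: no; exists p.
left=> -[x' y'] a2; have [[h1 _] [h1' _]] := (a1, a2).
apply: (vert x' top) => //; [exact: bigtop|exact: sub|].
apply: (hor x) => //; apply: (vert x y) => //; [exact: sub|exact: bigtop].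
Qed.

(** One point of [Om] above the graph forces the whole side into [Om]. That membership is part of
    the conclusion because a path across the graph visits points over [x'] not known beforehand to
    be in [Om]. If the side is disjoint from [Om] the claim is vacuous. *)
Lemma one_side Om F1 F2 g m alpha K L x0 d kap M N gt gt' gt'' w1 d' B S :
  local_setting Om F1 F2 g m alpha K L x0 d kap M N gt gt' gt'' w1 d' B S ->
  exists C rho : R, [/\ 0 <= C, 0 < rho & forall x y, Om (x, y) -> g x < y ->
    `|x - x0| < rho -> `|y - g x0| < rho -> grad2 F1 F2 (x, y) <= C /\
    forall x' y', g x' < y' -> `|x' - x0| < rho -> `|y' - g x0| < rho ->
      [/\ Om (x', y'), `|j0 F1 (x, y) - j0 F1 (x', y')| <= C * (`|x - x'| + `|y - y'|) &
      `|j0 F2 (x, y) - j0 F2 (x', y')| <= C * (`|x - x'| + `|y - y'|)]].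
Proof.
move=> HH; have [[d0 al K0 L1 [hL hm hK]] Ht Hq [k0 M0 N0] [H1 H2 H3 H4]] := HH.
have LL : 0 < L + 2 by clear -L1; lra.
pose d1 := d / (L + 2).
have d10 : 0 < d1 by exact: divr_gt0.
have d1E : (L + 2) * d1 = d by rewrite /d1 mulrC divfK // gt_eqF.
clearbody d1.
have Ld1 : d1 <= L * d1 by rewrite ler_peMl // ltW.
have d1d : d1 <= d by clear -Ld1 d10 d1E; lra.
have inab x y : g x < y -> `|x - x0| < d1 -> `|y - g x0| < d1 -> above g x0 d1 (x, y).
  move=> h1 h2; rewrite ltr_distl => /andP[_ h3]; split=> //=; by rewrite h1.
have [sub|dis] := above_dichotomy _ _ _ _ _ _ _ _ _ _ _ _ _ _ _ _ _ _ _ _ d1 HH d10 ltac:(by rewrite d1E); last first.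
  exists 0, d1; split=> // x y O h1 h2 h3.
  by exfalso; apply: (dis (x, y)) => //; exact: inab.
have subb : above g x0 d1 `<=` Om `&` box x0 (g x0) d.
  move=> [x y] a1; split; first exact: sub.
  have [/= h1 /andP[h2 h3]] := a1; have h1' := lt_le_trans h1 d1d.
  split=> //=; have h0 : `|x0 - x0| < d by rewrite subrr normr0.
  have := hL x0 x h0 h1'; rewrite ler_norml => /andP[h4 _].
  have : L * `|x - x0| <= L * d1 by rewrite ler_wpM2l ?(ltW h1) //; clear -L1; lra.
  by rewrite ltr_norml; clear -h4 h2 h3 d1E d1d Ld1 d10 => ?; apply/andP; split; lra.
have Hg1 : holder_graph_on g m alpha K L x0 d1.
  by split=> //; split=> [x x' hx hx'|x hx|x x' hx hx']; [apply: hL|apply: hm|apply: hK];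
    exact: lt_le_trans d1d.
have [|x hx|C [rho [rho0 HC]]] := side_bound g m alpha K L x0 d1 kap M N F1 F2 gt gt' gt'' w1 d' B S
  Hg1 Ht (qcpair_sub _ _ _ _ _ _ _ subb Hq) k0 M0 N0.
- by move=> p /subb; exact: H3.
- have [w hw Hw] := H4 x (lt_le_trans hx d1d); exists w => // e e0.
  have [r r0 Hr] := Hw e e0; exists r => // x' y' k1 k2 a; apply: Hr => //; exact: sub.
have [m1 m2] : Num.min rho d1 <= rho /\ Num.min rho d1 <= d1 by rewrite !ge_min !lexx orbT.
exists (Num.max C 0), (Num.min rho d1); split; rewrite ?le_max ?lexx ?orbT ?lt_min ?rho0 //.
have CM : C <= Num.max C 0 by rewrite le_max lexx.
move=> x y O h1 h2 h3.
have axy := inab x y h1 (lt_le_trans h2 m2) (lt_le_trans h3 m2).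
have [b1 b2] := HC x y axy (lt_le_trans h2 m1) (lt_le_trans h3 m1).
split=> [|x' y' k1 k2 k3]; first exact: le_trans CM.
have axy' := inab x' y' k1 (lt_le_trans k2 m2) (lt_le_trans k3 m2).
have [c1 c2] := b2 x' y' axy' (lt_le_trans k2 m1) (lt_le_trans k3 m1).
have nn : 0 <= `|x - x'| + `|y - y'| by rewrite addr_ge0.
by split; [exact: sub|apply: le_trans c1 _|apply: le_trans c2 _]; rewrite ler_wpM2r.
Qed.

(* Two points on different sides of the graph are joined through the boundary point
   (x', g x'), where u has the same limit w from both sides. *)
Lemma cross_lipschitz (u : R * R -> R) (Om : set (R * R)) (g : R -> R) (L x0 rho C w x y x' y' : R) :
  0 <= C -> 1 <= L -> `|g x' - g x| <= L * `|x' - x| -> `|g x' - g x0| < rho / 2 ->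
  0 < rho -> `|x' - x0| < rho -> g x < y -> y' < g x' ->
  (forall t, g x' < t -> `|t - g x0| < rho ->
     Om (x', t) /\ `|u (x, y) - u (x', t)| <= C * (`|x - x'| + `|y - t|)) ->
  (forall t, t < g x' -> `|t - g x0| < rho ->
     Om (x', t) /\ `|u (x', y') - u (x', t)| <= C * (`|x' - x'| + `|y' - t|)) ->
  (forall e, 0 < e -> exists2 r : R, 0 < r & forall t, `|t - g x'| < r -> Om (x', t) ->
     `|u (x', t) - w| < e) ->
  `|u (x, y) - u (x', y')| <= C * (2 * L + 2) * (`|x - x'| + `|y - y'|).
Proof.
move=> C0 L1 hL hg rho0 hx' hy hy' Hup Hdn Hw.
apply/ler_addgt0Pr => e0 e00.
have CC : 0 < 2 * C + 2 by clear -C0; lra.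
(* The error is [2 * e] from the two limits at (x', g x') and at most [2 * C * e] from the heights
   [h <= e] at which the path stops on either side. *)
pose e := e0 / (2 * C + 2).
have ep : 0 < e by exact: divr_gt0.
have eE : e0 = (2 * C + 2) * e by rewrite /e mulrC divfK // gt_eqF.
have [r r0 Hr] := Hw e ep.
have [h [h0 hr hrho he]] : exists h : R, [/\ 0 < h, h < r, h < rho / 2 & h <= e].
  have m0 : 0 < Num.min (Num.min r (rho / 2)) e by rewrite !lt_min r0 ep divr_gt0.
  exists (Num.min (Num.min r (rho / 2)) e / 2).
  have a1 : Num.min (Num.min r (rho / 2)) e <= r by rewrite !ge_min lexx.
  have a2 : Num.min (Num.min r (rho / 2)) e <= rho / 2 by rewrite !ge_min lexx orbT.
  have a3 : Num.min (Num.min r (rho / 2)) e <= e by rewrite !ge_min lexx !orbT.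
  by clear -m0 a1 a2 a3; split; lra.
clearbody e.
have hrr : `|g x' + h - g x'| < r by rewrite addrAC subrr add0r gtr0_norm.
have hrr' : `|g x' - h - g x'| < r by rewrite addrAC subrr add0r normrN gtr0_norm.
have [k1 k2] : `|g x' + h - g x0| < rho /\ `|g x' - h - g x0| < rho.
  move: hg; rewrite !ltr_norml => /andP[i1 i2].
  by clear -hrho h0 i1 i2; split; apply/andP; split; lra.
have [ O1 E1] := Hup (g x' + h) ltac:(by rewrite ltrDl) k1.
have [ O2 E2] := Hdn (g x' - h) ltac:(by rewrite gtrBl) k2.
have := Hr _ hrr O1; have := Hr _ hrr' O2.
set u1 := u (x', g x' + h) in E1 *; set u2 := u (x', g x' - h) in E2 *.
move=> E3 E4.
have T : `|u (x, y) - u (x', y')| <= C * (`|x - x'| + `|y - (g x' + h)|) + (e + e) +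
    C * (`|y' - (g x' - h)|).
  have -> : u (x, y) - u (x', y') = (u (x, y) - u1) + ((u1 - w) - (u2 - w)) - (u (x', y') - u2) by ring.
  apply: le_trans (ler_normB _ _) _; apply: lerD; last by move: E2; rewrite subrr normr0 add0r.
  apply: le_trans (ler_normD _ _) _; apply: lerD => //.
  by apply: le_trans (ler_normB _ _) _; apply: lerD; exact: ltW.
have Lx : L * `|x' - x| = L * `|x - x'| by rewrite distrC.
rewrite Lx in hL.
have n1 : `|y - g x'| <= `|y - y'| + L * `|x - x'|.
  move: hL; rewrite !ler_norml => /andP[i1 i2].
  have := ler_norm (y - y'); have := normr_ge0 (y - y'); have := normr_ge0 (x - x').
  by clear -i1 i2 hy hy' => ? ? ?; apply/andP; split; lra.
have n2 : `|y' - g x'| <= `|y - y'| + L * `|x - x'|.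
  move: hL; rewrite !ler_norml => /andP[i1 i2].
  have := ler_norm (y - y'); have := normr_ge0 (y - y'); have := normr_ge0 (x - x').
  by clear -i1 i2 hy hy' => ? ? ?; apply/andP; split; lra.
have n3 : `|y - (g x' + h)| <= `|y - g x'| + h.
  by rewrite opprD addrA; apply: le_trans (ler_normB _ _) _; rewrite (gtr0_norm h0).
have n4 : `|y' - (g x' - h)| <= `|y' - g x'| + h.
  by rewrite opprB addrCA addrC; apply: le_trans (ler_normD _ _) _; rewrite (gtr0_norm h0).
apply: le_trans T _; rewrite eE.
have c1 : C * (`|x - x'| + `|y - (g x' + h)| + `|y' - (g x' - h)|) <=
    C * ((2 * L + 2) * (`|x - x'| + `|y - y'|) + 2 * e).
  apply: ler_wpM2l => //.
  have : 0 <= L * `|y - y'| by rewrite mulr_ge0 //; clear -L1; lra.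
  by have := normr_ge0 (x - x'); clear -n1 n2 n3 n4 he; lra.
by clear -c1; lra.
Qed.

Lemma two_sides Om F1 F2 g m alpha K L x0 d kap M N gt gt' gt'' w1 d' B S :
  local_setting Om F1 F2 g m alpha K L x0 d kap M N gt gt' gt'' w1 d' B S ->
  exists C rho : R, 0 < rho /\ forall x y, Om (x, y) ->
    `|x - x0| < rho -> `|y - g x0| < rho -> grad2 F1 F2 (x, y) <= C /\
    forall x' y', Om (x', y') -> `|x' - x0| < rho -> `|y' - g x0| < rho ->
      `|j0 F1 (x, y) - j0 F1 (x', y')| <= C * (`|x - x'| + `|y - y'|) /\
      `|j0 F2 (x, y) - j0 F2 (x', y')| <= C * (`|x - x'| + `|y - y'|).
Proof.
move=> HH; have [[d0 al K0 L1 [hL hm hK]] _ _ _ [H1 _ _ H4]] := HH.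
have [C1 [r1 [C10 r10 HU]]] := one_side _ _ _ _ _ _ _ _ _ _ _ _ _ _ _ _ _ _ _ _ HH.
have [C2 [r2 [C20 r20 HD0]]] := one_side _ _ _ _ _ _ _ _ _ _ _ _ _ _ _ _ _ _ _ _ (local_setting_refl _ _ _ _ _ _ _ _ _ _ _ _ _ _ _ _ _ _ _ _ HH).
have HD x y : Om (x, y) -> y < g x -> `|x - x0| < r2 -> `|y - g x0| < r2 -> grad2 F1 F2 (x, y) <= C2 /\
    forall x' y', y' < g x' -> `|x' - x0| < r2 -> `|y' - g x0| < r2 ->
      [/\ Om (x', y'), `|j0 F1 (x, y) - j0 F1 (x', y')| <= C2 * (`|x - x'| + `|y - y'|) &
      `|j0 F2 (x, y) - j0 F2 (x', y')| <= C2 * (`|x - x'| + `|y - y'|)].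
  have nE (z w : R) : `|- z - - w| = `|z - w| by rewrite -normrN; congr `|_|; ring.
  move=> O h1 h2 h3; have := HD0 x (- y); rewrite /refl /= opprK ltrN2 nE => /(_ O h1 h2 h3).
  rewrite grad2_refl /= opprK => -[g1 g2]; split=> // x' y' k1 k2 k3.
  by have := g2 x' (- y'); rewrite ltrN2 !nE /refl /= !opprK => /(_ k1 k2 k3).
have LL : 0 < 2 * (L + 1) by clear -L1; lra.
pose C : R := Num.max C1 C2.
have [CC1 CC2] : C1 <= C /\ C2 <= C by rewrite !le_max !lexx orbT.
have C0 : 0 <= C by apply: le_trans CC1.
pose rho0 : R := Num.min (Num.min r1 r2) d.
have rho00 : 0 < rho0 by rewrite !lt_min r10 r20.
have [m1 m2 m3] : [/\ rho0 <= r1, rho0 <= r2 & rho0 <= d] by rewrite !ge_min !lexx !orbT.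
clearbody C rho0.
(* The graph then stays within [L * rho < rho0 / 2] of [g x0], which leaves room to approach it
   vertically from both sides inside the radius [rho0]. *)
pose rho := rho0 / (2 * (L + 1)).
have rhop : 0 < rho by exact: divr_gt0.
have rhoE : (2 * (L + 1)) * rho = rho0 by rewrite /rho mulrC divfK // gt_eqF.
clearbody rho.
have Lr : rho <= L * rho by rewrite ler_peMl // ltW.
have rr : rho <= rho0 by clear -rhoE Lr rhop; lra.
have CCC : C <= C * (2 * L + 2) by rewrite ler_peMr //; clear -L1; lra.
exists (C * (2 * L + 2)), rho; split=> // x y O hx hy.
have [hxd hx1 hx2] : [/\ `|x - x0| < d, `|x - x0| < r1 & `|x - x0| < r2].
  by clear -hx rr m1 m2 m3; split; lra.
have [hy1 hy2] : `|y - g x0| < r1 /\ `|y - g x0| < r2 by clear -hy rr m1 m2; split; lra.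
split.
  have [yg|yg|yg] := ltgtP y (g x); last by exfalso; apply: (H1 x hxd); rewrite -yg.
    by apply: le_trans (HD x y O yg hx2 hy2).1 (le_trans CC2 CCC).
  by apply: le_trans (HU x y O yg hx1 hy1).1 (le_trans CC1 CCC).
move=> x' y' O' hx' hy'.
have [hxd' hx1' hx2'] : [/\ `|x' - x0| < d, `|x' - x0| < r1 & `|x' - x0| < r2].
  by clear -hx' rr m1 m2 m3; split; lra.
have [hy1' hy2'] : `|y' - g x0| < r1 /\ `|y' - g x0| < r2 by clear -hy' rr m1 m2; split; lra.
have gx0 s : `|s - x0| < rho -> `|g s - g x0| < rho0 / 2.
  move=> hs; have h0 : `|x0 - x0| < d by rewrite subrr normr0.
  have hsd : `|s - x0| < d by clear -hs rr m3; lra.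
  apply: le_lt_trans (hL x0 s h0 hsd) _.
  have : L * `|s - x0| <= L * rho by rewrite ler_wpM2l ?(ltW hs) //; clear -L1; lra.
  by clear -rhoE rhop; lra.
have nn s t s' t' : 0 <= `|s - s'| + `|t - t'| :> R by rewrite addr_ge0.
have wk (z c s t s' t' : R) : c <= C -> z <= c * (`|s - s'| + `|t - t'|) ->
    z <= C * (`|s - s'| + `|t - t'|).
  by move=> h1 h2; apply: le_trans h2 _; rewrite ler_wpM2r.
have wk2 (z s t s' t' : R) : z <= C * (`|s - s'| + `|t - t'|) ->
    z <= C * (2 * L + 2) * (`|s - s'| + `|t - t'|).
  by move=> h2; apply: le_trans h2 _; rewrite ler_wpM2r.
have cross (F : jet) a b a' b' : F = F1 \/ F = F2 -> Om (a, b) -> Om (a', b') ->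
    `|a - x0| < rho -> `|b - g x0| < rho -> `|a' - x0| < rho -> `|b' - g x0| < rho ->
    g a < b -> b' < g a' ->
    `|j0 F (a, b) - j0 F (a', b')| <= C * (2 * L + 2) * (`|a - a'| + `|b - b'|).
  move=> HF Oa Oa' k1 k2 k3 k4 k5 k6.
  have [k1d k3d] : `|a - x0| < d /\ `|a' - x0| < d by clear -k1 k3 rr m3; split; lra.
  have [w _ Hw] := H4 a' k3d.
  have [_ HUa] := HU a b Oa k5 ltac:(clear -k1 rr m1; lra) ltac:(clear -k2 rr m1; lra).
  have [_ HDa] := HD a' b' Oa' k6 ltac:(clear -k3 rr m2; lra) ltac:(clear -k4 rr m2; lra).
  have k3' : `|a' - x0| < rho0 by exact: lt_le_trans rr.
  have gl := hL a a' k1d k3d.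
  have Hup t : g a' < t -> `|t - g x0| < rho0 -> [/\ Om (a', t),
      `|j0 F1 (a, b) - j0 F1 (a', t)| <= C1 * (`|a - a'| + `|b - t|)
      & `|j0 F2 (a, b) - j0 F2 (a', t)| <= C1 * (`|a - a'| + `|b - t|)].
    by move=> t1 t2; apply: HUa => //; [exact: lt_le_trans m1|exact: lt_le_trans m1].
  have Hdn t : t < g a' -> `|t - g x0| < rho0 -> [/\ Om (a', t),
      `|j0 F1 (a', b') - j0 F1 (a', t)| <= C2 * (`|a' - a'| + `|b' - t|)
      & `|j0 F2 (a', b') - j0 F2 (a', t)| <= C2 * (`|a' - a'| + `|b' - t|)].
    by move=> t1 t2; apply: HDa => //; [exact: lt_le_trans m2|exact: lt_le_trans m2].
  have [w' Hw'] : exists w', forall e, 0 < e -> exists2 r : R, 0 < r & forall t, `|t - g a'| < r ->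
      Om (a', t) -> `|j0 F (a', t) - w'| < e.
    case: HF => ->; [exists w|exists (gt w)] => e e0; have [r r0 Hr] := Hw e e0;
      exists r => // t t1 Ot; have [] // := Hr a' t _ t1 Ot; by rewrite subrr normr0.
  apply: (cross_lipschitz (j0 F) Om g L x0 rho0 C w' a b a' b') => //; first exact: gx0.
    move=> t t1 t2; have [ O1 E1 E2] := Hup t t1 t2; split=> //.
    by case: HF => ->; exact: wk CC1 _.
  move=> t t1 t2; have [ O1 E1 E2] := Hdn t t1 t2; split=> //.
  by case: HF => ->; exact: wk CC2 _.
have [yg|yg|yg] := ltgtP y (g x); last by exfalso; apply: (H1 x hxd); rewrite -yg.
- have [yg'|yg'|yg'] := ltgtP y' (g x'); last by exfalso; apply: (H1 x' hxd'); rewrite -yg'.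
  + have [_ h] := HD x y O yg hx2 hy2; have [_ h1 h2] := h x' y' yg' hx2' hy2'.
    by split; apply: wk2; apply: wk CC2 _.
  + rewrite (distrC (j0 F1 _)) (distrC (j0 F2 _)) (distrC x) (distrC y).
    by split; apply: cross => //; [left|right].
- have [yg'|yg'|yg'] := ltgtP y' (g x'); last by exfalso; apply: (H1 x' hxd'); rewrite -yg'.
  + by split; apply: cross => //; [left|right].
  + have [_ h] := HU x y O yg hx1 hy1; have [_ h1 h2] := h x' y' yg' hx1' hy1'.
    by split; apply: wk2; apply: wk CC1 _.
Qed.
End Local.

(** * From the arcs and the mapping to the local setting *)

Section Assembly.
Context {R : realType}.
Implicit Types (p q : R * R) (x y e t : R).

Definition locally_bounded_at (Om : set (R * R)) (F1 F2 : jet) (x0 y0 : R) :=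
  exists C rho : R, 0 < rho /\ forall x y, Om (x, y) ->
    `|x - x0| < rho -> `|y - y0| < rho -> grad2 F1 F2 (x, y) <= C /\
    forall x' y', Om (x', y') -> `|x' - x0| < rho -> `|y' - y0| < rho ->
      `|j0 F1 (x, y) - j0 F1 (x', y')| <= C * (`|x - x'| + `|y - y'|) /\
      `|j0 F2 (x, y) - j0 F2 (x', y')| <= C * (`|x - x'| + `|y - y'|).

Lemma locally_bounded_atC Om F1 F2 x0 y0 :
  locally_bounded_at Om F1 F2 x0 y0 -> locally_bounded_at Om F2 F1 x0 y0.
Proof.
move=> [C [rho [rho0 H]]]; exists C, rho; split=> // x y O hx hy.
have [h1 h2] := H x y O hx hy; split; first by rewrite grad2C.
by move=> x' y' O' hx' hy'; have [] := h2 x' y' O' hx' hy'.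
Qed.

Lemma locally_bounded_at_swap Om F1 F2 x0 y0 :
  locally_bounded_at (swap Om) (jswap F1) (jswap F2) y0 x0 -> locally_bounded_at Om F1 F2 x0 y0.
Proof.
move=> [C [rho [rho0 H]]]; exists C, rho; split=> // x y O hx hy.
have [h1 h2] := H y x O hy hx; split; first by move: h1; rewrite grad2_swap.
move=> x' y' O' hx' hy'; have [] := h2 y' x' O' hy' hx'.
by rewrite (addrC `|y - y'|).
Qed.

Definition has_limit (Om : set (R * R)) (F1 F2 : jet) (x y w1 w2 : R) :=
  forall e, 0 < e -> exists2 r : R, 0 < r & forall x' y', `|x' - x| < r -> `|y' - y| < r ->
    Om (x', y') -> `|j0 F1 (x', y') - w1| < e /\ `|j0 F2 (x', y') - w2| < e.

Definition C1curve (X X' Y Y' : R -> R) (alpha K : R) :=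
  [/\ forall t, is_derive t 1 X (X' t), forall t, is_derive t 1 Y (Y' t),
    forall s t, `|X' s - X' t| <= K * `|s - t| `^ alpha,
    forall s t, `|Y' s - Y' t| <= K * `|s - t| `^ alpha &
    forall s t, unit_itv s -> unit_itv t -> X s = X t -> Y s = Y t -> s = t].

(** Boundary points are seen here through boxes. The last clause expresses that near (x0, y0) the
    arc is all of the boundary: any other point is interior to [Om] or to its complement. *)
Definition boundary_near (Om : set (R * R)) (X Y : R -> R) (x0 y0 : R) :=
  [/\ forall t, unit_itv t -> ~ Om (X t, Y t),
    forall t, unit_itv t -> forall e, 0 < e ->
      exists x y, [/\ Om (x, y), `|x - X t| < e & `|y - Y t| < e] &
    exists2 d : R, 0 < d & forall x y, `|x - x0| < d -> `|y - y0| < d ->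
      ~ (exists t, [/\ unit_itv t, X t = x & Y t = y]) ->
      exists2 e : R, 0 < e &
        (forall x' y', `|x' - x| < e -> `|y' - y| < e -> Om (x', y')) \/
        (forall x' y', `|x' - x| < e -> `|y' - y| < e -> ~ Om (x', y'))].

(** The image arc enters as a relation [TG] that is a graph near (w1, w2), so that the roles of the
    two components can be exchanged afterwards. *)
Lemma bounded_graph_graph Om F1 F2 X X' Y Y' (alpha K t0 d1 kap M N : R)
    (TG : R -> R -> Prop) (gt gt' gt'' : R -> R) (w1 w2 d' B : R) :
  C1curve X X' Y Y' alpha K -> 0 < alpha <= 1 -> 0 <= K -> 0 < t0 < 1 -> X' t0 != 0 ->
  boundary_near Om X Y (X t0) (Y t0) ->
  0 < d1 -> qcpair (Om `&` box (X t0) (Y t0) d1) F1 F2 kap M N -> 0 < kap -> 0 <= M -> 0 <= N ->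
  C2_graph_on gt gt' gt'' w1 d' B ->
  (forall v1 v2, TG v1 v2 -> `|v1 - w1| < d' -> `|v2 - w2| < d' -> v2 = gt v1) ->
  (forall t, unit_itv t -> exists v1 v2, TG v1 v2 /\ has_limit Om F1 F2 (X t) (Y t) v1 v2) ->
  has_limit Om F1 F2 (X t0) (Y t0) w1 w2 ->
  locally_bounded_at Om F1 F2 (X t0) (Y t0).
Proof.
move=> [DX DY HX HY inj] al K0 /andP[t00 t01] X0 [Hb Hadh [d2 d20 Hd2]] d10 Hq k0 M0 N0 Ht HTG Hlim Hlim0.
have [al0 al1] := andP al.
(* This bound keeps the parameters of the graph in [0, 1]; beyond it the curve is only a
   continuation of the arc. *)
have e00 : 0 < Num.min t0 (1 - t0) by rewrite lt_min t00 subr_gt0.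
have [eta [d [g [m [K' [L [[eta0 etale d0 K'0 L1] hL hm hK [Hg1 Hg2]]]]]]]] :=
  holder_graph X X' Y Y' t0 _ alpha K DX DY al0 K0 HX HY X0 e00.
have etaI t : `|t - t0| < eta -> unit_itv t.
  move: etale; rewrite le_min => /andP[i1 i2].
  rewrite ltr_distl => /andP[i3 i4]; apply/unit_itvP.
  by clear -i1 i2 i3 i4; apply/andP; split; lra.
have I0 : unit_itv t0 by apply: etaI; rewrite subrr normr0.
have xx0 : `|X t0 - X t0| < d by rewrite subrr normr0.
have gx0 : g (X t0) = Y t0 by rewrite -Hg2 // subrr normr0 ltW.
have [e1 e10 Hsep] := arc_separation X Y t0 eta (fun t => is_derive_continuous _ _ _ (DX t))
  (fun t => is_derive_continuous _ _ _ (DY t)) inj I0 eta0.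
have [d'0 _] := Ht.
have d'2 : 0 < d' / 2 by rewrite divr_gt0.
have [r1 r10 Hr1] := Hlim0 _ d'2.
have L2 : 0 < 2 * L by clear -L1; lra.
(* The last entry keeps the box and the graph over it within [r1 / 2] of the centre, where F is
   within [d' / 2] of (w1, w2), with room for a nearby point of [Om]. *)
pose dn : R := Num.min (Num.min d d1) (Num.min (Num.min d2 e1) (r1 / (2 * L))).
have dn0 : 0 < dn by rewrite !lt_min d0 d10 d20 e10 divr_gt0.
have [n1 n2 n3 n4 n5] : [/\ dn <= d, dn <= d1, dn <= d2, dn <= e1 & dn <= r1 / (2 * L)].
  by rewrite /dn !ge_min !lexx !orbT.
clearbody dn.
have n6 : 2 * (L * dn) <= r1 by move: n5; rewrite ler_pdivlMr // mulrC mulrA.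
have Ldn : dn <= L * dn by rewrite ler_peMl // ltW.
have n7 : dn <= r1 / 2 by clear -n6 Ldn; lra.
rewrite -gx0; apply: (two_sides _ _ _ g m alpha K' L (X t0) dn kap M N gt gt' gt'' w1 d' B (`|w2| + d')).
have HS p : (Om `&` box (X t0) (g (X t0)) dn) p -> `|j0 F1 p - w1| < d' / 2 /\ `|j0 F2 p - w2| < d' / 2.
  case: p => x y [ O [/= h1 h2]]; rewrite gx0 in h2.
  by apply: Hr1 => //; clear -h1 h2 n7 r10; lra.
split=> //.
- split=> //; split=> [x x' hx hx'|x hx|x x' hx hx']; [apply: hL|apply: hm|apply: hK];
    exact: lt_le_trans n1.
- apply: qcpair_sub Hq => p [ O [h1 h2]]; split=> //; rewrite gx0 in h2.
  by split; exact: lt_le_trans n2.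
- split.
  + move=> x hx; have [t [t1 t2 t3]] := Hg1 x (lt_le_trans hx n1).
    by rewrite -t2 -Hg2 ?(ltW t1) ?t2 ?(lt_le_trans hx n1) //; rewrite -[x in (x, _)]t2; apply: Hb; exact: etaI.
  + move=> x y hx hy yg; rewrite gx0 in hy; apply: Hd2; rewrite ?(lt_le_trans hx) ?(lt_le_trans hy) //.
    move=> [t [It tx ty]]; move/eqP: yg; apply.
    have te : `|t - t0| < eta by apply: Hsep => //; rewrite ?tx ?ty ?(lt_le_trans hx) ?(lt_le_trans hy).
    by rewrite -ty -tx Hg2 ?(ltW te) // tx (lt_le_trans hx).
  + move=> p /HS[h1 h2]; split; first by clear -h1 d'0; lra.
    by have := ler_distD w2 (j0 F2 p) 0; rewrite !subr0; clear -h2 d'0; lra.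
  + move=> x hx; have hxd := lt_le_trans hx n1.
    have [t [t1 t2 t3]] := Hg1 x hxd; have It := etaI t t1.
    have [v1 [v2 [Tv Lv]]] := Hlim t It; rewrite t2 t3 in Lv.
    have gxd : `|g x - g (X t0)| < r1 / 2.
      apply: le_lt_trans (hL _ _ xx0 hxd) _.
      have : L * `|x - X t0| < L * dn by rewrite ltr_pM2l //; clear -L1; lra.
      by clear -n6; lra.
    have d'4 : 0 < d' / 2 by rewrite divr_gt0.
    have [r2 r20 Hr2] := Lv _ d'4.
    have r3 : 0 < Num.min r2 (r1 / 2) by rewrite lt_min r20 divr_gt0.
    (* A point of [Om] close to the boundary point compares its limit (v1, v2) with (w1, w2): two
       errors of [d' / 2] place the limit in the box where the image arc is a graph. *)
    have [a [b [ Oab]]] := Hadh t It _ r3; rewrite t2 t3 !lt_min => /andP[a1 a2] /andP[b1 b2].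
    have [c1 c2] := Hr2 a b a1 b1 Oab.
    have [||c3 c4] := Hr1 a b _ _ Oab.
    * by have := ler_distD x a (X t0); clear -a2 hx n7; lra.
    * by rewrite -gx0; have := ler_distD (g x) b (g (X t0)); clear -b2 gxd; lra.
    have v1w : `|v1 - w1| < d'.
      by have := ler_distD (j0 F1 (a, b)) v1 w1; rewrite (distrC v1 (j0 F1 _)); clear -c1 c3; lra.
    have v2w : `|v2 - w2| < d'.
      by have := ler_distD (j0 F2 (a, b)) v2 w2; rewrite (distrC v2 (j0 F2 _)); clear -c2 c4; lra.
    by exists v1 => //; rewrite -(HTG _ _ Tv v1w v2w).
Qed.

Definition C2curve (X X' X'' Y Y' Y'' : R -> R) (B : R) :=
  [/\ forall t, is_derive t 1 X (X' t) /\ is_derive t 1 Y (Y' t),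
    forall t, is_derive t 1 X' (X'' t) /\ is_derive t 1 Y' (Y'' t),
    forall t, `|X'' t| <= B /\ `|Y'' t| <= B &
    forall s t, unit_itv s -> unit_itv t -> X s = X t -> Y s = Y t -> s = t].

Definition on_arc (X Y : R -> R) (v1 v2 : R) := exists t, [/\ unit_itv t, X t = v1 & Y t = v2].

Lemma C2curveC X X' X'' Y Y' Y'' B : C2curve X X' X'' Y Y' Y'' B -> C2curve Y Y' Y'' X X' X'' B.
Proof.
move=> [h1 h2 h3 h4]; split=> [t|t|t|s t Is It E1 E2].
- by have [] := h1 t.
- by have [] := h2 t.
- by have [] := h3 t.
- exact: h4.
Qed.

Lemma C2curve_graph X X' X'' Y Y' Y'' (B t1 : R) :
  C2curve X X' X'' Y Y' Y'' B -> unit_itv t1 -> X' t1 != 0 ->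
  exists (gt gt' gt'' : R -> R) (d' B' : R), C2_graph_on gt gt' gt'' (X t1) d' B' /\
    forall v1 v2, on_arc X Y v1 v2 -> `|v1 - X t1| < d' -> `|v2 - Y t1| < d' -> v2 = gt v1.
Proof.
move=> [D1 D2 BB inj] I1 X1.
have [eta [d [g [g' [g'' [B' [eta0 d0 Hg Hgr]]]]]]] := C2_graph X X' X'' Y Y' Y'' t1 B
  (fun t => (D1 t).1) (fun t => (D2 t).1) (fun t => (D1 t).2) (fun t => (D2 t).2)
  (fun t => (BB t).1) (fun t => (BB t).2) X1.
have [e1 e10 Hsep] := arc_separation X Y t1 eta (fun t => is_derive_continuous _ _ _ (D1 t).1)
  (fun t => is_derive_continuous _ _ _ (D1 t).2) inj I1 eta0.
have [m1 m2] : Num.min d e1 <= d /\ Num.min d e1 <= e1 by rewrite !ge_min !lexx orbT.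
exists g, g', g'', (Num.min d e1), B'; split.
  by split=> [|s hs]; [rewrite lt_min d0|apply: Hg; exact: lt_le_trans m1].
move=> v1 v2 [t [It <- <-]] h1 h2; apply: Hgr; last exact: lt_le_trans m1.
by apply/ltW; apply: Hsep => //; exact: lt_le_trans m2.
Qed.

Lemma has_limitC Om F1 F2 x y v1 v2 : has_limit Om F1 F2 x y v1 v2 -> has_limit Om F2 F1 x y v2 v1.
Proof.
move=> H e e0; have [r r0 Hr] := H e e0; exists r => // x' y' h1 h2 O.
by have [] := Hr x' y' h1 h2 O.
Qed.

(** An image arc with a vertical tangent is a graph over the second axis; exchanging F1 and F2
    reduces this case to the first. *)
Lemma bounded_graph_arc Om F1 F2 X X' Y Y' U U' U'' V V' V'' (alpha K t0 t1 d1 kap M N B : R) :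
  C1curve X X' Y Y' alpha K -> 0 < alpha <= 1 -> 0 <= K -> 0 < t0 < 1 -> X' t0 != 0 ->
  boundary_near Om X Y (X t0) (Y t0) ->
  0 < d1 -> qcpair (Om `&` box (X t0) (Y t0) d1) F1 F2 kap M N -> 0 < kap -> 0 <= M -> 0 <= N ->
  C2curve U U' U'' V V' V'' B -> unit_itv t1 -> (U' t1 != 0) || (V' t1 != 0) ->
  (forall t, unit_itv t -> exists v1 v2, on_arc U V v1 v2 /\ has_limit Om F1 F2 (X t) (Y t) v1 v2) ->
  has_limit Om F1 F2 (X t0) (Y t0) (U t1) (V t1) ->
  locally_bounded_at Om F1 F2 (X t0) (Y t0).
Proof.
move=> C1 al K0 It0 X0 Hb d10 Hq k0 M0 N0 C2 It1 /orP[U0|V0] Hl Hl0.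
  have [gt [gt' [gt'' [d' [B' [Hgt HT]]]]]] := C2curve_graph _ _ _ _ _ _ _ _ C2 It1 U0.
  exact: (bounded_graph_graph Om F1 F2 X X' Y Y' alpha K t0 d1 kap M N (on_arc U V) gt gt' gt'' (U t1) (V t1) d' B').
have [gt [gt' [gt'' [d' [B' [Hgt HT]]]]]] := C2curve_graph _ _ _ _ _ _ _ _ (C2curveC _ _ _ _ _ _ _ C2) It1 V0.
apply: locally_bounded_atC.
apply: (bounded_graph_graph Om F2 F1 X X' Y Y' alpha K t0 d1 kap M N (on_arc V U) gt gt' gt'' (V t1) (U t1) d' B') => //.
- exact: qcpairC.
- move=> t It; have [v1 [v2 [[s [Is s1 s2]] L]]] := Hl t It; exists v2, v1; split; last exact: has_limitC.
  by exists s.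
- exact: has_limitC.
Qed.

Lemma C1curveC X X' Y Y' alpha K : C1curve X X' Y Y' alpha K -> C1curve Y Y' X X' alpha K.
Proof. by move=> [h1 h2 h3 h4 h5]; split=> // s t Is It E1 E2; exact: h5. Qed.

Lemma boundary_near_swap Om X Y x0 y0 : boundary_near Om X Y x0 y0 ->
  boundary_near (swap Om) Y X y0 x0.
Proof.
move=> [h1 h2 [d d0 h3]]; split=> //.
  by move=> t It e e0; have [x [y [ O a b]]] := h2 t It e e0; exists y, x.
exists d => // x y hx hy nt.
have [[t [It a b]]|e e0 He] := h3 y x hy hx; first by apply: nt; exists t.
exists e => //; case: He => He; [left|right] => x' y' a b; exact: He.
Qed.

Lemma has_limit_swap Om F1 F2 x y v1 v2 : has_limit Om F1 F2 x y v1 v2 ->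
  has_limit (swap Om) (jswap F1) (jswap F2) y x v1 v2.
Proof.
move=> H e e0; have [r r0 Hr] := H e e0; exists r => // x' y' h1 h2 O.
exact: Hr.
Qed.

(** The same reduction for the boundary arc, by transposition of the variables. *)
Lemma bounded_arc_arc Om F1 F2 X X' Y Y' U U' U'' V V' V'' (alpha K t0 t1 d1 kap M N B : R) :
  C1curve X X' Y Y' alpha K -> 0 < alpha <= 1 -> 0 <= K -> 0 < t0 < 1 ->
  (X' t0 != 0) || (Y' t0 != 0) ->
  boundary_near Om X Y (X t0) (Y t0) ->
  0 < d1 -> qcpair (Om `&` box (X t0) (Y t0) d1) F1 F2 kap M N -> 0 < kap -> 0 <= M -> 0 <= N ->
  C2curve U U' U'' V V' V'' B -> unit_itv t1 -> (U' t1 != 0) || (V' t1 != 0) ->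
  (forall t, unit_itv t -> exists v1 v2, on_arc U V v1 v2 /\ has_limit Om F1 F2 (X t) (Y t) v1 v2) ->
  has_limit Om F1 F2 (X t0) (Y t0) (U t1) (V t1) ->
  locally_bounded_at Om F1 F2 (X t0) (Y t0).
Proof.
move=> C1 al K0 It0 /orP[X0|Y0] Hb d10 Hq k0 M0 N0 C2 It1 U0 Hl Hl0.
  exact: (bounded_graph_arc Om F1 F2 X X' Y Y' U U' U'' V V' V'' alpha K t0 t1 d1 kap M N B).
apply: locally_bounded_at_swap.
apply: (bounded_graph_arc (swap Om) (jswap F1) (jswap F2) Y Y' X X' U U' U'' V V' V'' alpha K t0 t1 d1 kap M N B) => //.
- exact: C1curveC.
- exact: boundary_near_swap.
- by apply: qcpair_sub (qcpair_swap _ _ _ _ _ _ Hq) => p [ O [a b]].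
- move=> t It; have [v1 [v2 [T Lv]]] := Hl t It; exists v1, v2; split=> //.
  exact: has_limit_swap.
- exact: has_limit_swap.
Qed.

(** * Real components of the complex data: modulus, partial derivatives, Jacobian *)

Lemma normc_ge0 (z : R[i]) : 0 <= ComplexField.Normc.normc z.
Proof. by case: z => a b; exact: sqrtr_ge0. Qed.

Lemma normc_sq (a b : R) : ComplexField.Normc.normc (Complex a b) ^+ 2 = a ^+ 2 + b ^+ 2.
Proof. by rewrite /= sqr_sqrtr // addr_ge0 ?sqr_ge0. Qed.

Lemma cabs_sq p : cabs p ^+ 2 = p.1 ^+ 2 + p.2 ^+ 2.
Proof. exact: normc_sq. Qed.

Lemma cabs_ge0 p : 0 <= cabs p.
Proof. exact: normc_ge0. Qed.

Lemma cabs_ge p : `|p.1| <= cabs p /\ `|p.2| <= cabs p.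
Proof.
by split; rewrite -(@ler_pXn2r _ 2 isT) ?nnegrE ?normr_ge0 ?cabs_ge0 // real_normK ?num_real //
  cabs_sq ?lerDl ?lerDr sqr_ge0.
Qed.

Lemma cabs_le p : cabs p <= `|p.1| + `|p.2|.
Proof.
rewrite -(@ler_pXn2r _ 2 isT) ?nnegrE ?addr_ge0 ?cabs_ge0 // cabs_sq.
rewrite [leRHS]sqrrD !real_normK ?num_real //.
by have := mulr_ge0 (normr_ge0 p.1) (normr_ge0 p.2); clear; lra.
Qed.

Definition jet1 (f : R * R -> R * R) := Jet (fun p => (f p).1) (fun p => (dx f p).1)
  (fun p => (dy f p).1) (fun p => (dx (dx f) p).1) (fun p => (dy (dy f) p).1).

Definition jet2 (f : R * R -> R * R) := Jet (fun p => (f p).2) (fun p => (dx f p).2)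
  (fun p => (dy f p).2) (fun p => (dx (dx f) p).2) (fun p => (dy (dy f) p).2).

Lemma is_derive_of_cvg (f : R -> R) x l :
  h^-1 * (f (h + x) - f x) @[h --> 0^'] --> l -> is_derive x 1 f l.
Proof.
move=> /cvgrPdist_le H; apply/is_deriveP => e e0; have := H e e0.
rewrite near_withinE => /nbhs_ballP[d /= d0 Hd].
exists d => // s sd; have [->|st] := eqVneq s x; first by rewrite !subrr mulr0 subrr !normr0 mulr0.
have st0 : s - x != 0 by rewrite subr_eq0.
have /Hd /(_ st0) : ball 0 d (s - x) by rewrite /ball /= sub0r normrN.
rewrite subrK.
have -> : f s - f x - l * (s - x) = - (l - (s - x)^-1 * (f s - f x)) * (s - x).
  by rewrite opprB mulrBl mulrAC mulVf // mul1r.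
by rewrite normrM normrN => Hle; rewrite ler_pM2r // normr_gt0.
Qed.

Lemma is_derive_dx (f : R * R -> R * R) x y : derivable f (x, y) (e_x R) ->
  is_derive x 1 (fun t => (f (t, y)).1) (dx f (x, y)).1 /\
  is_derive x 1 (fun t => (f (t, y)).2) (dx f (x, y)).2.
Proof.
move=> df.
have H : h^-1 *: (f (h + x, y) - f (x, y)) @[h --> 0^'] --> dx f (x, y).
  move: df; rewrite /derivable -/(dx f (x, y)) => df.
  have -> : (fun h : R => h^-1 *: (f (h + x, y) - f (x, y))) =
     (fun h : R => h^-1 *: ((f \o shift (x, y)) (h *: e_x R) - f (x, y))).
    apply/funext => h /=; congr (_ *: (f _ - _)).
    by rewrite /e_x; congr pair; rewrite /= /GRing.scale /= ?mulr1 ?mulr0 ?add0r.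
  exact: df.
split; apply: is_derive_of_cvg.
  exact: (cvg_comp _ _ H (@cvg_fst _ _ (nbhs (dx f (x, y)).1) (nbhs (dx f (x, y)).2) _)).
exact: (cvg_comp _ _ H (@cvg_snd _ _ (nbhs (dx f (x, y)).1) (nbhs (dx f (x, y)).2) _)).
Qed.

Lemma is_derive_dy (f : R * R -> R * R) x y : derivable f (x, y) (e_y R) ->
  is_derive y 1 (fun t => (f (x, t)).1) (dy f (x, y)).1 /\
  is_derive y 1 (fun t => (f (x, t)).2) (dy f (x, y)).2.
Proof.
move=> df.
have H : h^-1 *: (f (x, h + y) - f (x, y)) @[h --> 0^'] --> dy f (x, y).
  move: df; rewrite /derivable -/(dy f (x, y)) => df.
  have -> : (fun h : R => h^-1 *: (f (x, h + y) - f (x, y))) =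
     (fun h : R => h^-1 *: ((f \o shift (x, y)) (h *: e_y R) - f (x, y))).
    apply/funext => h /=; congr (_ *: (f _ - _)).
    by rewrite /e_y; congr pair; rewrite /= /GRing.scale /= ?mulr1 ?mulr0 ?add0r.
  exact: df.
split; apply: is_derive_of_cvg.
  exact: (cvg_comp _ _ H (@cvg_fst _ _ (nbhs (dy f (x, y)).1) (nbhs (dy f (x, y)).2) _)).
exact: (cvg_comp _ _ H (@cvg_snd _ _ (nbhs (dy f (x, y)).1) (nbhs (dy f (x, y)).2) _)).
Qed.

Lemma cont_at_components (f : R * R -> R * R) p : {for p, continuous f} ->
  cont_at (fun q => (f q).1) p /\ cont_at (fun q => (f q).2) p.
Proof.
move=> cf; split.
  exact: (cvg_comp _ _ cf (@cvg_fst _ _ (nbhs (f p).1) (nbhs (f p).2) _)).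
exact: (cvg_comp _ _ cf (@cvg_snd _ _ (nbhs (f p).1) (nbhs (f p).2) _)).
Qed.

(** [C1_on] speaks of partial derivatives and of their continuity; joint continuity of the function
    follows from their local boundedness along two segments parallel to the axes. *)
Lemma cont_at_of_partials (D : set (R * R)) (u ux uy : R * R -> R) p : open D -> D p ->
  (forall x y, D (x, y) -> is_derive x 1 (fun t => u (t, y)) (ux (x, y)) /\
     is_derive y 1 (fun t => u (x, t)) (uy (x, y))) ->
  cont_at ux p -> cont_at uy p -> cont_at u p.
Proof.
move=> oD Dp Du /continuous_boxP cx /continuous_boxP cy.
have /nbhs_boxP[e1 e10 He1] : nbhs p D by exact: open_nbhs_nbhs.
have [r1 r10 H1] := cx 1 ltr01; have [r2 r20 H2] := cy 1 ltr01.
pose C : R := `|ux p| + `|uy p| + 1.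
have C0 : 0 < C by rewrite /C ltr_wpDl // addr_ge0.
apply/continuous_boxP => e e0.
pose r : R := Num.min (Num.min e1 (e / (2 * C))) (Num.min r1 r2).
have CC : 0 < 2 * C by clear -C0; lra.
have r0 : 0 < r by rewrite !lt_min e10 r10 r20 divr_gt0.
have [m1 m2 m3 m4] : [/\ r <= e1, r <= e / (2 * C), r <= r1 & r <= r2].
  by rewrite /r !ge_min !lexx !orbT.
clearbody r.
have bd x y : `|x - p.1| < r -> `|y - p.2| < r -> D (x, y) /\ `|ux (x, y)| <= C /\ `|uy (x, y)| <= C.
  move=> hx hy; split; first by apply: He1; [exact: lt_le_trans m1|exact: lt_le_trans m1].
  have := H1 x y (lt_le_trans hx m3) (lt_le_trans hy m3).
  have := H2 x y (lt_le_trans hx m4) (lt_le_trans hy m4).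
  have := ler_distD (ux p) (ux (x, y)) 0; have := ler_distD (uy p) (uy (x, y)) 0.
  rewrite !subr0 /C; have := normr_ge0 (ux p); have := normr_ge0 (uy p).
  by clear; split; lra.
have inb (a t z : R) : Num.min a z <= t <= Num.max a z -> `|z - a| < r -> `|t - a| < r.
  rewrite ge_min le_max !ltr_distl => /andP[/orP h1 /orP h2] /andP[i1 i2].
  by clear -h1 h2 i1 i2; apply/andP; case: h1 => ?; case: h2 => ?; split; lra.
exists r => // x y hx hy.
have s0 (z : R) : `|z - z| < r by rewrite subrr normr0.
have E1 : `|u (x, y) - u (p.1, y)| <= C * `|x - p.1|.
  apply: (mean_value_bound (fun t => u (t, y)) (fun t => ux (t, y))) => t ht.
  have [Dt [b _]] := bd t y (inb _ _ _ ht hx) hy.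
  by split=> //; have [] := Du t y Dt.
have E2 : `|u (p.1, y) - u (p.1, p.2)| <= C * `|y - p.2|.
  apply: (mean_value_bound (fun t => u (p.1, t)) (fun t => uy (p.1, t))) => t ht.
  have [Dt [_ b]] := bd p.1 t (s0 _) (inb _ _ _ ht hy).
  by split=> //; have [] := Du p.1 t Dt.
rewrite -surjective_pairing in E2.
apply: le_lt_trans (ler_distD (u (p.1, y)) _ _) _.
have c1 : C * `|x - p.1| < C * (e / (2 * C)) by rewrite ltr_pM2l // (lt_le_trans hx).
have c2 : C * `|y - p.2| < C * (e / (2 * C)) by rewrite ltr_pM2l // (lt_le_trans hy).
have cE : C * (e / (2 * C)) = e / 2 by field; rewrite gt_eqF.
by rewrite cE in c1 c2; clear -E1 E2 c1 c2; lra.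
Qed.

Lemma C2_on_jets (Om : set (R * R)) (f : R * R -> R * R) : open Om -> C2_on Om f ->
  C2jet Om (jet1 f) /\ C2jet Om (jet2 f).
Proof.
move=> oO [H0 Hx Hy].
have cx p : Om p -> cont_at (fun q => (dx f q).1) p /\ cont_at (fun q => (dx f q).2) p.
  by move=> /H0[_ _ c _]; exact: cont_at_components.
have cy p : Om p -> cont_at (fun q => (dy f q).1) p /\ cont_at (fun q => (dy f q).2) p.
  by move=> /H0[_ _ _ c]; exact: cont_at_components.
have Dx x y : Om (x, y) -> _ := fun O => let: And4 a _ _ _ := H0 _ O in is_derive_dx f x y a.
have Dy x y : Om (x, y) -> _ := fun O => let: And4 _ a _ _ := H0 _ O in is_derive_dy f x y a.
have Dxx x y : Om (x, y) -> _ := fun O => let: And4 a _ _ _ := Hx _ O in is_derive_dx (dx f) x y a.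
have Dyy x y : Om (x, y) -> _ := fun O => let: And4 _ a _ _ := Hy _ O in is_derive_dy (dy f) x y a.
split; split=> [|p Op].
- split=> [p Op|x y O|x y O|x y O|x y O] /=.
  + apply: (cont_at_of_partials Om _ _ _ p oO Op _ (cx p Op).1 (cy p Op).1) => x y O.
    by split; [exact: (Dx _ _ O).1|exact: (Dy _ _ O).1].
  + exact: (Dx _ _ O).1.
  + exact: (Dy _ _ O).1.
  + exact: (Dxx _ _ O).1.
  + exact: (Dyy _ _ O).1.
- by split; [exact: (cx p Op).1|exact: (cy p Op).1].
- split=> [p Op|x y O|x y O|x y O|x y O] /=.
  + apply: (cont_at_of_partials Om _ _ _ p oO Op _ (cx p Op).2 (cy p Op).2) => x y O.
    by split; [exact: (Dx _ _ O).2|exact: (Dy _ _ O).2].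
  + exact: (Dx _ _ O).2.
  + exact: (Dy _ _ O).2.
  + exact: (Dxx _ _ O).2.
  + exact: (Dyy _ _ O).2.
- by split; [exact: (cx p Op).2|exact: (cy p Op).2].
Qed.

Lemma grad_sqE f p : grad_sq f p = grad2 (jet1 f) (jet2 f) p.
Proof.
have E : grad_sq f p = ((dx f p).1 ^+ 2 + (dx f p).2 ^+ 2) + ((dy f p).1 ^+ 2 + (dy f p).2 ^+ 2) :=
  f_equal2 _ (cabs_sq (dx f p)) (cabs_sq (dy f p)).
have G : grad2 (jet1 f) (jet2 f) p =
  (dx f p).1 ^+ 2 + (dy f p).1 ^+ 2 + (dx f p).2 ^+ 2 + (dy f p).2 ^+ 2 := erefl.
rewrite E G; move: (dx f p) (dy f p) => a b.
by ring.
Qed.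

(** With G = |grad f|^2 and J the Jacobian, 4 |f_z|^2 = G + 2 J and 4 |f_zbar|^2 = G - 2 J. Squaring
    the hypothesis gives (1 - k^2) G <= 2 (1 + k^2) J <= 4 J. *)
Lemma qc_jacobian (a b : R * R) (k : R) : 0 <= k < 1 ->
  ComplexField.Normc.normc ((toC a + 'i%C * toC b) / 2%:R)
    <= k * ComplexField.Normc.normc ((toC a - 'i%C * toC b) / 2%:R) ->
  (1 - k ^+ 2) / 4 * (a.1 ^+ 2 + b.1 ^+ 2 + a.2 ^+ 2 + b.2 ^+ 2) <= `|a.1 * b.2 - b.1 * a.2|.
Proof.
move=> /andP[k0 k1]; rewrite !ComplexField.Normc.normcM mulrA.
set c := ComplexField.Normc.normc (2%:R^-1).
have c0 : 0 < c.
  rewrite lt_neqAle normc_ge0 andbT eq_sym; apply/eqP => /ComplexField.Normc.eq0_normc /eqP.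
  by rewrite invr_eq0 pnatr_eq0.
rewrite ler_pM2r //.
set z1 := _ + _; set z2 := _ - _ => H.
have E1 : ComplexField.Normc.normc z1 ^+ 2 = (a.1 - b.2) ^+ 2 + (a.2 + b.1) ^+ 2.
  have -> : z1 = Complex (a.1 - b.2) (a.2 + b.1).
    by rewrite /z1 /toC; apply/eqP; rewrite eq_complex /= !mul0r !mul1r sub0r add0r !eqxx.
  exact: normc_sq.
have E2 : ComplexField.Normc.normc z2 ^+ 2 = (a.1 + b.2) ^+ 2 + (a.2 - b.1) ^+ 2.
  have -> : z2 = Complex (a.1 + b.2) (a.2 - b.1).
    by rewrite /z2 /toC; apply/eqP; rewrite eq_complex /= !mul0r !mul1r sub0r add0r opprK !eqxx.
  exact: normc_sq.
have : ComplexField.Normc.normc z1 ^+ 2 <= (k * ComplexField.Normc.normc z2) ^+ 2.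
  by rewrite lerXn2r ?nnegrE ?mulr_ge0 ?normc_ge0.
rewrite exprMn E1 E2 => {}H.
set J := a.1 * b.2 - b.1 * a.2; set G := a.1 ^+ 2 + _ + _ + _.
have F1 : (a.1 - b.2) ^+ 2 + (a.2 + b.1) ^+ 2 = G - 2 * J by rewrite /G /J; ring.
have F2 : (a.1 + b.2) ^+ 2 + (a.2 - b.1) ^+ 2 = G + 2 * J by rewrite /G /J; ring.
rewrite F1 F2 in H.
have GJ : 0 <= G + 2 * J by rewrite -F2 addr_ge0 ?sqr_ge0.
have GJ' : 0 <= G - 2 * J by rewrite -F1 addr_ge0 ?sqr_ge0.
have kk : k ^+ 2 <= 1 by rewrite expr_le1 // ltW.
have kk0 : 0 <= k ^+ 2 by exact: sqr_ge0.
have J0 : 0 <= J.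
  have : k ^+ 2 * (G + 2 * J) <= 1 * (G + 2 * J) by rewrite ler_wpM2r.
  by clear -H; lra.
rewrite ger0_norm //.
have : k ^+ 2 * J <= 1 * J by rewrite ler_wpM2r.
by move: H; clear; lra.
Qed.

Lemma qcpair_jets (Om : set (R * R)) (f : R * R -> R * R) (tau : R * R) (k r M N : R) :
  open Om -> C2_on Om f -> 0 <= k < 1 ->
  (forall z, Om z -> ComplexField.Normc.normc (d_zbar f z) <= k * ComplexField.Normc.normc (d_z f z)) ->
  (forall z, (Om `&` disk tau r) z -> cabs (laplacian f z) <= M * grad_sq f z + N) ->
  qcpair (Om `&` box tau.1 tau.2 (r / 2)) (jet1 f) (jet2 f) ((1 - k ^+ 2) / 4) M N.
Proof.
move=> oO Cf hk Hqc Hlap; have [C1 C2] := C2_on_jets _ _ oO Cf.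
(* The modulus is at most the sum of the absolute values of the coordinates, hence the half side
   [r / 2]. *)
have sub : Om `&` box tau.1 tau.2 (r / 2) `<=` Om `&` disk tau r.
  move=> z [Oz [h1 h2]]; split=> //; apply: le_lt_trans (cabs_le _) _ => /=.
  by clear -h1 h2; lra.
split.
- by split; [apply: C2fun_sub C1.1 => z []|move=> p [/C1.2]].
- by split; [apply: C2fun_sub C2.1 => z []|move=> p [/C2.2]].
- move=> p [Op _]; have := qc_jacobian _ _ _ hk (Hqc p Op).
  by rewrite /grad2 /jac.
- move=> p /sub Hp; rewrite -grad_sqE; apply: le_trans (Hlap p Hp).
  exact: (cabs_ge (laplacian f p)).1.
- move=> p /sub Hp; rewrite -grad_sqE; apply: le_trans (Hlap p Hp).
  exact: (cabs_ge (laplacian f p)).2.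
Qed.

(** * Jordan arcs as curves defined on the whole line, and the boundary near tau *)

Lemma hoelder_components (I : set R) (alpha : R) (g : R -> R * R) : hoelder_in I alpha g ->
  exists2 K : R, 0 <= K & forall s t, I s -> I t ->
    `|(g s).1 - (g t).1| <= K * `|s - t| `^ alpha /\ `|(g s).2 - (g t).2| <= K * `|s - t| `^ alpha.
Proof.
move=> [K HK]; exists `|K| => // s t Is It.
have h : cabs (g s - g t) <= `|K| * `|s - t| `^ alpha.
  by apply: le_trans (HK s t Is It) _; rewrite ler_wpM2r ?powR_ge0 // ler_norm.
have [h1 h2] := cabs_ge (g s - g t).
by split; [exact: le_trans h1 h|exact: le_trans h2 h].
Qed.

Lemma taylor_ext0 (f : R -> R) t : taylor_ext f (fun=> 0) (fun=> 0) t = f (clamp t).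
Proof. by rewrite /taylor_ext !mul0r !addr0. Qed.

(** Continuation beyond [0, 1] by tangent lines leaves the derivative constant there, and the
    Hoelder bound survives with the same constant because [clamp] does not increase distances. *)
Lemma jordan_arc_C1curve (alpha : R) (g : R -> R * R) (gamma : set (R * R)) :
  0 < alpha -> jordan_arc 1 alpha g gamma ->
  exists X X' Y Y' K, [/\ C1curve X X' Y Y' alpha K, 0 <= K,
    forall t, unit_itv t -> g t = (X t, Y t) &
    forall t, unit_itv t -> (X' t != 0) || (Y' t != 0)].
Proof.
move=> al0 [inj _ [g1 /has_derivative_in_rderiv[D1 D2] /hoelder_components[K K0 HK]]].
move=> [g2 /has_derivative_in_rderiv[E1 E2] nz].
pose X := taylor_ext (fun t => (g t).1) (fun t => (g1 t).1) (fun=> 0).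
pose Y := taylor_ext (fun t => (g t).2) (fun t => (g1 t).2) (fun=> 0).
have gE t : unit_itv t -> g t = (X t, Y t).
  by move=> It; rewrite /X /Y !taylor_ext_id // -surjective_pairing.
exists X, (fun t => (g1 (clamp t)).1), Y, (fun t => (g1 (clamp t)).2), K; split=> //.
- split.
  + by move=> t; rewrite -(taylor_ext0 (fun t => (g1 t).1)); exact: is_derive_taylor_ext.
  + by move=> t; rewrite -(taylor_ext0 (fun t => (g1 t).2)); exact: is_derive_taylor_ext.
  + move=> s t; apply: le_trans (HK _ _ (clamp_itv s) (clamp_itv t)).1 _.
    rewrite ler_wpM2l //; apply: ge0_ler_powR; rewrite ?nnegrE ?clamp_dist // ltW //.
  + move=> s t; apply: le_trans (HK _ _ (clamp_itv s) (clamp_itv t)).2 _.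
    rewrite ler_wpM2l //; apply: ge0_ler_powR; rewrite ?nnegrE ?clamp_dist // ltW //.
  + move=> s t Is It e1 e2; apply: inj; rewrite ?inE //.
    by rewrite (gE s Is) (gE t It) e1 e2.
- move=> t It; rewrite !clamp_id // (rderiv_unique _ _ _ D1 E1 t It) (rderiv_unique _ _ _ D2 E2 t It).
  rewrite -negb_and; apply: contra (nz t It) => /andP[/eqP h1 /eqP h2].
  by rewrite [g2 t]surjective_pairing h1 h2.
Qed.

Lemma jordan_arc_C2curve (alpha : R) (g : R -> R * R) (gamma : set (R * R)) :
  0 < alpha -> jordan_arc 2 alpha g gamma ->
  exists X X' X'' Y Y' Y'' B, [/\ C2curve X X' X'' Y Y' Y'' B,
    forall t, unit_itv t -> g t = (X t, Y t) &
    forall t, unit_itv t -> (X' t != 0) || (Y' t != 0)].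
Proof.
move=> al0 [inj _ [g1 /has_derivative_in_rderiv[D1 D2]]].
move=> [h /has_derivative_in_rderiv[DD1 DD2] /hoelder_components[K K0 HK]].
move=> [g2 /has_derivative_in_rderiv[E1 E2] nz].
pose X := taylor_ext (fun t => (g t).1) (fun t => (g1 t).1) (fun t => (h t).1).
pose Y := taylor_ext (fun t => (g t).2) (fun t => (g1 t).2) (fun t => (h t).2).
pose X' := taylor_ext (fun t => (g1 t).1) (fun t => (h t).1) (fun=> 0).
pose Y' := taylor_ext (fun t => (g1 t).2) (fun t => (h t).2) (fun=> 0).
have gE t : unit_itv t -> g t = (X t, Y t).
  by move=> It; rewrite /X /Y !taylor_ext_id // -surjective_pairing.
have I0 : unit_itv (0 : R) by apply/unit_itvP; rewrite lexx ler01.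
exists X, X', (fun t => (h (clamp t)).1), Y, Y', (fun t => (h (clamp t)).2),
  (`|(h 0).1| + `|(h 0).2| + K); split=> //.
- split.
  + by move=> t; split; exact: is_derive_taylor_ext.
  + move=> t; rewrite -(taylor_ext0 (fun t => (h t).1)) -(taylor_ext0 (fun t => (h t).2)).
    by split; exact: is_derive_taylor_ext.
  (* On an interval of length 1 the Hoelder bound gives |h(t)| <= |h(0)| + K in each component. *)
  + move=> t; have Ic := clamp_itv t; have [k1 k2] := HK _ _ Ic I0.
    have c1 : K * `|clamp t - 0| `^ alpha <= K.
      apply: (@le_trans _ _ (K * 1 `^ alpha)); last by rewrite powR1 mulr1.
      rewrite ler_wpM2l //.
      have /unit_itvP/andP[c0 c1] := Ic.
      by apply: ge0_ler_powR; rewrite ?nnegrE ?(ltW al0) // subr0 ger0_norm.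
    have := ler_distD (h 0).1 (h (clamp t)).1 0; have := ler_distD (h 0).2 (h (clamp t)).2 0.
    rewrite !subr0; have := normr_ge0 (h 0).1; have := normr_ge0 (h 0).2.
    by rewrite subr0 in k1 k2 c1; clear -k1 k2 c1; split; lra.
  + move=> s t Is It e1 e2; apply: inj; rewrite ?inE //.
    by rewrite (gE s Is) (gE t It) e1 e2.
- move=> t It; rewrite /X' /Y' !taylor_ext_id // (rderiv_unique _ _ _ D1 E1 t It) (rderiv_unique _ _ _ D2 E2 t It).
  rewrite -negb_and; apply: contra (nz t It) => /andP[/eqP h1 /eqP h2].
  by rewrite [g2 t]surjective_pairing h1 h2.
Qed.

Lemma boundary_nearP (Om : set (R * R)) (gO : R -> R * R) (gamma : set (R * R)) X Y tau :
  open Om -> gamma = gO @` unit_itv -> gamma `<=` boundary Om ->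
  (forall t, unit_itv t -> gO t = (X t, Y t)) ->
  (\forall zeta \near tau, boundary Om zeta -> gamma zeta) ->
  boundary_near Om X Y tau.1 tau.2.
Proof.
move=> oO gE bd XY near; have intO : interior Om = Om by apply/interior_id.
have bdt t : unit_itv t -> boundary Om (X t, Y t).
  by move=> It; apply: bd; rewrite gE; exists t => //; exact: XY.
split.
- by move=> t /bdt[_]; rewrite intO.
- move=> t /bdt[cl _] e e0; exact: closure_boxP cl e e0.
- move: near => /nbhs_boxP[d d0 Hd]; exists d => // x y hx hy nt.
  have [Oxy|nO] := pselect (Om (x, y)).
    have /nbhs_boxP[e e0 He] : nbhs (x, y) Om by exact: open_nbhs_nbhs.
    by exists e => //; left.
  have ncl : ~ closure Om (x, y).
    move=> cl; apply: nt; have := Hd x y hx hy.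
    rewrite gE => /(_ _)[|t It E]; first by split=> //; rewrite intO.
    by exists t; move: E; rewrite XY // => -[-> ->].
  have /nbhs_boxP[e e0 He] : nbhs (x, y) (~` closure Om).
    by apply: open_nbhs_nbhs; split=> //; apply: closed_openC; exact: closed_closure.
  by exists e => //; right => x' y' h1 h2 O; apply: (He x' y' h1 h2); exact: subset_closure.
Qed.

Lemma boundary_values_limit (Om gamma : set (R * R)) (f F : R * R -> R * R) zeta :
  boundary_values Om gamma f F -> gamma zeta ->
  has_limit Om (jet1 f) (jet2 f) zeta.1 zeta.2 (F zeta).1 (F zeta).2.
Proof.
move=> hF gz e e0; have := hF zeta gz.
move=> /(_ [set q : R * R | `|q.1 - (F zeta).1| < e /\ `|q.2 - (F zeta).2| < e]).
have nb : nbhs (F zeta) [set q : R * R | `|q.1 - (F zeta).1| < e /\ `|q.2 - (F zeta).2| < e].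
  by apply/nbhs_boxP; exists e.
move=> /(_ nb); rewrite /= => /nbhs_boxP[r r0 Hr].
by exists r => // x' y' h1 h2 O; exact: Hr.
Qed.
End Assembly.

Theorem theorem3p1 (R : realType) (Omega G : set (R * R))
    (f F : R * R -> R * R) (alpha : R)
    (gO gG : R -> R * R) (gammaO gammaG : set (R * R))
    (tau : R * R) (r M N : R)
    (hOmega : plane_domain Omega) (hG : plane_domain G)
    (hdiffeo : C2_diffeo Omega G f) (hqc : quasiconformal Omega f)
    (halpha : 0 < alpha <= 1)
    (hgammaO : jordan_arc 1 alpha gO gammaO)
    (hgammaO_bd : gammaO `<=` boundary Omega)
    (hF : boundary_values Omega gammaO f F)
    (hgammaG_eq : gammaG = F @` gammaO)
    (hgammaG : jordan_arc 2 alpha gG gammaG)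
    (hgammaG_bd : gammaG `<=` boundary G)
    (htau : gammaO tau)
    (* gammaO, without its endpoints, is all of the boundary near tau *)
    (hfree : \forall zeta \near tau,
       boundary Omega zeta -> (gO @` `]0, 1[%classic) zeta)
    (hr : 0 < r) (hM : 0 < M) (hN : 0 < N)
    (hlap : forall z, (Omega `&` disk tau r) z ->
       cabs (laplacian f z) <= M * grad_sq f z + N) :
  exists2 rtau : R, 0 < rtau < r &
    (exists K : R, forall z, (Omega `&` disk tau rtau) z ->
       cabs (dx f z) <= K /\ cabs (dy f z) <= K) /\
    (exists L : R, forall z w,
       (Omega `&` disk tau rtau) z -> (Omega `&` disk tau rtau) w ->
       cabs (f z - f w) <= L * cabs (z - w)).
Proof.
have [_ oO _] := hOmega; have [_ Cf _] := hdiffeo; have [k hk Hqc] := hqc.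
have [al0 al1] := andP halpha.
have [X [X' [Y [Y' [K [C1 K0 gOE nzO]]]]]] := jordan_arc_C1curve _ _ _ al0 hgammaO.
have [U [U' [U'' [V [V' [V'' [B [C2 gGE nzG]]]]]]]] := jordan_arc_C2curve _ _ _ al0 hgammaG.
have [_ gammaOE _ _] := hgammaO; have [_ gammaGE _ _] := hgammaG.
(* Evaluated at tau itself, [hfree] shows that tau is not an endpoint, so the arc is a graph on both
   sides of its parameter. *)
have [t0 It0 t0E] : (gO @` `]0, 1[%classic) tau.
  by apply: (nbhs_singleton hfree); exact: hgammaO_bd.
rewrite /= in_itv /= in It0.
have [t00 t01] := andP It0.
have I0 : unit_itv t0 by apply/unit_itvP; rewrite !ltW.
have [tau1 tau2] : tau.1 = X t0 /\ tau.2 = Y t0 by rewrite -t0E gOE.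
have [t1 It1 t1E] : (gG @` unit_itv) (F tau).
  by rewrite -gammaGE hgammaG_eq; exists tau.
have arcO t : unit_itv t -> gammaO (X t, Y t) by move=> It; rewrite gammaOE; exists t => //; exact: gOE.
have [C [rho [rho0 HC]]] : locally_bounded_at Omega (jet1 f) (jet2 f) tau.1 tau.2.
  have kap0 : 0 < (1 - k ^+ 2) / 4.
    have [k0 k1] := andP hk.
    by rewrite divr_gt0 // subr_gt0 exprn_ilt1.
  have Hq := qcpair_jets Omega f tau k r M N oO Cf hk Hqc hlap.
  have Hb : boundary_near Omega X Y tau.1 tau.2.
    apply: (boundary_nearP Omega gO gammaO) => //.
    apply: filterS hfree => zeta H /H [t It <-]; rewrite gammaOE; exists t => //.
    by move: It; rewrite /= !in_itv /= => /andP[/ltW -> /ltW ->].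
  have r2 : 0 < r / 2 by rewrite divr_gt0.
  rewrite tau1 tau2 in Hq Hb *.
  apply: (bounded_arc_arc Omega (jet1 f) (jet2 f) X X' Y Y' U U' U'' V V' V'' alpha K t0 t1
    (r / 2) ((1 - k ^+ 2) / 4) M N B) => //.
  - exact: nzO.
  - exact: ltW.
  - exact: ltW.
  - exact: nzG.
  - move=> t It; have gt := arcO t It; exists (F (X t, Y t)).1, (F (X t, Y t)).2; split.
      have : gammaG (F (X t, Y t)) by rewrite hgammaG_eq; exists (X t, Y t).
      by rewrite gammaGE => -[s Is sE]; exists s; rewrite -sE gGE.
    exact: (boundary_values_limit Omega gammaO f F (X t, Y t) hF gt).
  - have E : (U t1, V t1) = F tau by rewrite -gGE.
    have -> : U t1 = (F tau).1 by rewrite -E.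
    have -> : V t1 = (F tau).2 by rewrite -E.
    by rewrite -tau1 -tau2; exact: boundary_values_limit hF htau.
have [m1 m2] : Num.min rho r <= rho /\ Num.min rho r <= r by rewrite !ge_min !lexx orbT.
have m0 : 0 < Num.min rho r by rewrite lt_min rho0.
have inrho z : (Omega `&` disk tau (Num.min rho r / 2)) z ->
    [/\ Omega z, `|z.1 - tau.1| < rho & `|z.2 - tau.2| < rho].
  move=> [Oz zd]; have [h1 h2] := cabs_ge (z - tau).
  have zr : cabs (z - tau) < rho by move: zd; rewrite /disk /=; clear -m0 m1; lra.
  by split=> //; [exact: le_lt_trans h1 zr|exact: le_lt_trans h2 zr].
(* Halving makes the radius strictly smaller than [r]. *)
exists (Num.min rho r / 2); first by clear -m0 m2; apply/andP; split; lra.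
split.
  exists (2 * (C + 1)) => z /inrho[Oz h1 h2].
  have [gr _] := HC z.1 z.2 ltac:(by rewrite -surjective_pairing) h1 h2.
  rewrite -surjective_pairing in gr.
  have [/= e1 e2 e3 e4] := grad2_entries _ _ _ _ gr.
  split; apply: le_trans (cabs_le _) _; [clear -e1 e3|clear -e2 e4]; lra.
(* A factor 2 for the two components of f, and another because the sum of the coordinate differences
   is at most twice the modulus. *)
exists (4 * C) => z w /inrho[Oz z1 z2] /inrho[Ow w1 w2].
have [gr Hz] := HC z.1 z.2 ltac:(by rewrite -surjective_pairing) z1 z2.
have [/= L1 L2] := Hz w.1 w.2 ltac:(by rewrite -surjective_pairing) w1 w2.
rewrite -!surjective_pairing in gr L1 L2.
have C0 : 0 <= C by apply: le_trans gr; rewrite /grad2 !addr_ge0 ?sqr_ge0.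
have [h1 h2] := cabs_ge (z - w).
have h3 : C * (`|z.1 - w.1| + `|z.2 - w.2|) <= C * (2 * cabs (z - w)).
  by apply: ler_wpM2l => //; move: h1 h2 => /=; clear; lra.
apply: le_trans (cabs_le _) _ => /=; clear -L1 L2 h3; lra.
Qed.
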